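(* VB-FTRL for LL-OLQS can be implemented with a per-round computational complexity of $O\!\left(Td^8\log(1/\varepsilon)+d^{10}\log(1/\varepsilon)\right)$.
   Context: $\mathcal D_d$ is the set of density matrices in $\mathbb C^{d\times d}$ (Hermitian positive semidefinite, unit trace). LL-OLQS (online learning of quantum states with the logarithmic loss) is the game in which, in each round $t=1,\dots,T$, the learner announces $\rho_t\in\mathcal D_d$, then Reality announces a Hermitian positive semidefinite matrix $A_t\in\mathbb C^{d\times d}$, and the learner suffers the loss $f_t(\rho_t)$, where $f_t(\rho):=-\log\operatorname{tr}(A_t\rho)$. VB-FTRL for LL-OLQS, with parameters $\lambda,\mu>0$, outputs in round $t+1$ a minimizer $\rho_{t+1}\in\operatorname{argmin}_{\rho\in\mathcal D_d}P_t(\rho)$, where $$P_t(\rho)=L_t(\rho)+\mu V_t(\rho),\quad L_t(\rho)=\sum_{\tau=1}^t f_\tau(\rho)-\lambda\log\det\rho,\quad V_t(\rho)=\tfrac12\log\det\nabla^2\overline L_t(\mathrm{vec}(\rho)).$$ Here $\mathrm{vec}$ stacks the columns of a matrix, $\overline L_t(\mathrm{vec}(\rho))=L_t(\rho)$, and $\nabla^2\overline L_t(\mathrm{vec}(\rho))$ is the $d^2\times d^2$ complex matrix with $D^2L_t(\rho)[V,U]=\mathrm{vec}(V)^*\,\nabla^2\overline L_t(\mathrm{vec}(\rho))\,\mathrm{vec}(U)$ for all Hermitian $U,V$. The implementation solves the minimization in each round by the ellipsoid method over the $d^2$-dimensional real Hilbert space of (vectorized) $d\times d$ Hermitian matrices,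 and $\varepsilon$ is its accuracy: the method identifies an ellipsoid of volume $\varepsilon$ containing the minimizer, in $O(d^2\log(1/\varepsilon))$ iterations. *)

(* Defs.v *)
From HB Require Import structures.
From mathcomp Require Import all_boot all_order all_algebra.
From mathcomp Require Import all_classical all_reals all_analysis.
From mathcomp Require Import complex.

Set Implicit Arguments.
Unset Strict Implicit.
Unset Printing Implicit Defensive.

Import Order.TTheory GRing.Theory Num.Theory.
Import numFieldNormedType.Exports.

Local Open Scope classical_set_scope.
Local Open Scope complex_scope.
Local Open Scope sesquilinear_scope.
Local Open Scope ring_scope.

Section Matrices.
Context {R : realType} {d : nat}.
Implicit Types rho U V : 'M[R[i]]_d.

Definition psd (M : 'M[R[i]]_d) : Prop :=
  M \is hermsymmx /\ forall v : 'cV[R[i]]_d, 0 <= (v^t* *m M *m v) 0 0.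

Definition density rho : Prop := psd rho /\ \tr rho = 1.

(* [mxvec] is row-major, hence the transpose: [vec] stacks columns. *)
Definition vec (M : 'M[R[i]]_d) : 'cV[R[i]]_(d * d) := (mxvec M^T)^T.

(* The second directional derivative D^2 F(rho)[V, U]. *)
Definition D2 (F : 'M[R[i]]_d -> R) rho V U : R :=
  derive1 (fun s : R => derive1 (fun u : R => F (rho + s%:C *: V + u%:C *: U)) 0) 0.

Definition is_hessian (F : 'M[R[i]]_d -> R) rho (H : 'M[R[i]]_(d * d)) : Prop :=
  forall V U, V \is hermsymmx -> U \is hermsymmx ->
    (D2 F rho V U)%:C = ((vec V)^t* *m H *m vec U) 0 0.

(* [is_hessian F rho] has at most one solution, because the Hermitian matrices
   span 'M[R[i]]_d over R[i]; [0] is only a default value. *)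
Definition hessian (F : 'M[R[i]]_d -> R) rho : 'M[R[i]]_(d * d) :=
  xget 0 [set H | is_hessian F rho H].

End Matrices.

(* The round losses take the value +oo where tr(A rho) = 0, and
   - log det rho takes the value +oo at singular rho. *)
Section Objective.
Context {R : realType} {d : nat}.
Variables (lambda mu : R) (A : nat -> 'M[R[i]]_d).
Implicit Types (t : nat) (rho : 'M[R[i]]_d).
Local Open Scope ereal_scope.

Definition loss (M rho : 'M[R[i]]_d) : \bar R :=
  - lne (complex.Re (\tr (M *m rho)%R))%:E.

(* [A tau] is the matrix announced in round tau + 1. *)
Definition Lt t rho : \bar R :=
  \sum_(tau < t) loss (A tau) rho - lambda%:E * lne (complex.Re (\det rho))%:E.

Definition Vt t rho : R :=
  (2^-1 * ln (complex.Re (\det (hessian (fun X => fine (Lt t X)) rho))))%R.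

(* Since [Vt] is real-valued, [Pt] is +oo wherever [Lt] is. *)
Definition Pt t rho : \bar R := Lt t rho + (mu * Vt t rho)%:E.

End Objective.

Definition minimizer {R : realType} {d : nat} (P : 'M[R[i]]_d -> \bar R)
    (rho : 'M[R[i]]_d) : Prop :=
  density rho /\ forall sigma, density sigma -> (P rho <= P sigma)%E.

Section Ellipsoids.
Context {R : realType}.

Definition dot n (x y : 'rV[R]_n) : R := (x *m y^T) 0 0.

Definition ellipsoid n (c : 'rV[R]_n) (B : 'M[R]_n) : set 'rV[R]_n :=
  [set x | dot ((x - c) *m invmx B) (x - c) <= 1].

(* Lebesgue measure on R^n as the n-fold product measure: as for the library's
   product of two measures, the value is the integral of the measures of the
   sections. *)
Fixpoint volume n : set 'rV[R]_n -> \bar R :=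
  match n with
  | 0%N => fun E => (\1_E (0 : 'rV[R]_0))%:E
  | n'.+1 => fun E =>
      (\int[lebesgue_measure]_(x in [set: R])
         volume [set y : 'rV[R]_n' | E (row_mx (const_mx x : 'rV[R]_1) y)])%E
  end.

(* The minimum-volume ellipsoid containing the half
   { x in ellipsoid c B | dot g (x - c) <= 0 } is
   ellipsoid (cut_center c B g) (cut_shape B g), for 1 < n and g != 0. *)
Definition cut_center n (c : 'rV[R]_n) (B : 'M[R]_n) (g : 'rV[R]_n) : 'rV[R]_n :=
  c - (n.+1%:R^-1 / Num.sqrt (dot (g *m B) g)) *: (g *m B).

Definition cut_shape n (B : 'M[R]_n) (g : 'rV[R]_n) : 'M[R]_n :=
  (n%:R ^+ 2 / (n%:R ^+ 2 - 1)) *: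
    (B - (2 / n.+1%:R / dot (g *m B) g) *: ((g *m B)^T *m (g *m B))).

End Ellipsoids.

Section EllipsoidMethod.
Context {R : realType} {d : nat}.
Implicit Types (x c g u : 'rV[R]_(d * d)) (B : 'M[R]_(d * d)).

(* The Hermitian matrix with coordinates x in an orthonormal basis of the real
   Hilbert space of Hermitian matrices with inner product tr(XY): the diagonal
   entries, and sqrt 2 times the real and imaginary parts of the entries above
   the diagonal. Thus dot x y = tr (herm x *m herm y). *)
Definition herm x : 'M[R[i]]_d :=
  let X := vec_mx x in
  \matrix_(i < d, j < d)
    if i == j then (X i i)%:C
    else if (i < j)%N then (X i j / Num.sqrt 2) +i* (X j i / Num.sqrt 2)
    else (X j i / Num.sqrt 2) -i* (X i j / Num.sqrt 2).

Variable P : 'M[R[i]]_d -> \bar R.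

Definition in_domain c : Prop := density (herm c) /\ (P (herm c) < +oo)%E.

(* The density matrices span only the hyperplane of unit-trace matrices, so
   cuts are taken along the hyperplane (traceless g), and the objective enters
   through its gradient within the hyperplane. Cuts across it would yield
   ellipsoids that still contain all density matrices but are arbitrarily thin,
   whose volume says nothing about the minimizer. *)
Definition traceless u : Prop := \tr (herm u) = 0.

Definition gradient_cut c g : Prop :=
  in_domain c /\
  forall u, traceless u ->
    is_derive (0 : R) 1 (fun s : R => fine (P (herm (c + s *: u)))) (dot g u).

Definition feasibility_cut c g : Prop :=
  ~ in_domain c /\ forall x, density (herm x) -> dot g (x - c) <= 0.

(* [ellipsoid_method k c B]: ellipsoid c B is reached after k iterations. The
   initial ellipsoid is the unit ball around the maximally mixed state, which
   contains all density matrices. When the center is a minimizer there may be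
   nothing left to cut, and the ellipsoid is shrunk around it. *)
Inductive ellipsoid_method : nat -> 'rV[R]_(d * d) -> 'M[R]_(d * d) -> Prop :=
| em_init : ellipsoid_method 0%N (mxvec (d%:R^-1)%:M) 1%:M
| em_cut k c B g :
    ellipsoid_method k c B -> traceless g -> g != 0 ->
    gradient_cut c g \/ feasibility_cut c g ->
    ellipsoid_method k.+1 (cut_center c B g) (cut_shape B g)
| em_optimal k c B (s : R) :
    ellipsoid_method k c B -> minimizer P (herm c) -> 0 < s < 1 ->
    ellipsoid_method k.+1 c (s *: B).

End EllipsoidMethod.

(* A structured real RAM. Index registers hold natural numbers; real arrays
   hold exact real numbers, addressed by index expressions. Arithmetic
   operations, square roots, comparisons and memory accesses have unit cost.
   There is no rounding from reals to indices. Programs contain no real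
   constants other than natural numbers. *)
Inductive iexp : Type :=
| ICst of nat
| IVar of nat
| IAdd of iexp & iexp
| ISub of iexp & iexp
| IMul of iexp & iexp.

Inductive rexp : Type :=
| RNat of iexp
| RGet of nat & iexp
| RAdd of rexp & rexp
| RSub of rexp & rexp
| RMul of rexp & rexp
| RDiv of rexp & rexp
| RSqrt of rexp.

Inductive bexp : Type :=
| ILe of iexp & iexp
| RLe of rexp & rexp
| BNot of bexp
| BAnd of bexp & bexp.

Inductive com : Type :=
| Skip
| ISet of nat & iexp
| RSet of nat & iexp & rexp
| Seq of com & com
| If of bexp & com & com
| While of bexp & com.

Record memory (R : Type) := Memory {
  ireg : nat -> nat;
  rarr : nat -> nat -> R }.

Section Semantics.
Context {R : realType}.
Implicit Type m : memory R.

Fixpoint ieval m (e : iexp) : nat :=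
  match e with
  | ICst n => n
  | IVar v => ireg m v
  | IAdd e1 e2 => (ieval m e1 + ieval m e2)%N
  | ISub e1 e2 => (ieval m e1 - ieval m e2)%N
  | IMul e1 e2 => (ieval m e1 * ieval m e2)%N
  end.

Fixpoint reval m (e : rexp) : R :=
  match e with
  | RNat e1 => (ieval m e1)%:R
  | RGet a e1 => rarr m a (ieval m e1)
  | RAdd e1 e2 => reval m e1 + reval m e2
  | RSub e1 e2 => reval m e1 - reval m e2
  | RMul e1 e2 => reval m e1 * reval m e2
  | RDiv e1 e2 => reval m e1 / reval m e2
  | RSqrt e1 => Num.sqrt (reval m e1)
  end.

Fixpoint beval m (b : bexp) : bool :=
  match b with
  | ILe e1 e2 => (ieval m e1 <= ieval m e2)%N
  | RLe e1 e2 => reval m e1 <= reval m e2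
  | BNot b1 => ~~ beval m b1
  | BAnd b1 b2 => beval m b1 && beval m b2
  end.

Fixpoint icost (e : iexp) : nat :=
  match e with
  | ICst _ | IVar _ => 1%N
  | IAdd e1 e2 | ISub e1 e2 | IMul e1 e2 => (icost e1 + icost e2).+1%N
  end.

Fixpoint rcost (e : rexp) : nat :=
  match e with
  | RNat e1 | RGet _ e1 => (icost e1).+1
  | RAdd e1 e2 | RSub e1 e2 | RMul e1 e2 | RDiv e1 e2 =>
      (rcost e1 + rcost e2).+1%N
  | RSqrt e1 => (rcost e1).+1
  end.

Fixpoint bcost (b : bexp) : nat :=
  match b with
  | ILe e1 e2 => (icost e1 + icost e2).+1%N
  | RLe e1 e2 => (rcost e1 + rcost e2).+1%N
  | BNot b1 => (bcost b1).+1
  | BAnd b1 b2 => (bcost b1 + bcost b2).+1%N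
  end.

Definition set_ireg m (v n : nat) : memory R :=
  Memory (fun w => if w == v then n else ireg m w) (rarr m).

Definition set_rarr m (a l : nat) (x : R) : memory R :=
  Memory (ireg m)
    (fun b k => if (b == a) && (k == l) then x else rarr m b k).

(* [exec c m k m']: from m, the program c halts in m' at total cost k. *)
Inductive exec : com -> memory R -> nat -> memory R -> Prop :=
| exec_skip m : exec Skip m 1%N m
| exec_iset m v e :
    exec (ISet v e) m (icost e).+1 (set_ireg m v (ieval m e))
| exec_rset m a e r :
    exec (RSet a e r) m (icost e + rcost r).+1%N
      (set_rarr m a (ieval m e) (reval m r))
| exec_seq m1 m2 m3 c1 c2 k1 k2 :
    exec c1 m1 k1 m2 -> exec c2 m2 k2 m3 -> exec (Seq c1 c2) m1 (k1 + k2)%N m3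
| exec_if m m' b c1 c2 k :
    exec (if beval m b then c1 else c2) m k m' ->
    exec (If b c1 c2) m (bcost b + k).+1%N m'
| exec_while_stop m b c :
    ~~ beval m b -> exec (While b c) m (bcost b).+1 m
| exec_while_step m1 m2 m3 b c k1 k2 :
    beval m1 b -> exec c m1 k1 m2 -> exec (While b c) m2 k2 m3 ->
    exec (While b c) m1 (bcost b + k1 + k2).+1%N m3.

End Semantics.

(* Memory layout: index register 0 holds d, and index register 1 the number of
   matrices announced so far; array 0 holds lambda, mu, eps; arrays 1 and 2
   hold the real and imaginary parts of the announced matrices, one after the
   other in row-major order; arrays 3 and 4 receive the center and, in
   row-major order, the shape matrix of the ellipsoid. *)
Section Protocol.
Context {R : realType} {d : nat}.
Implicit Type m : memory R.

Definition initial_memory (lambda mu eps : R) : memory R :=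
  Memory (fun v => if v == 0%N then d else 0%N)
    (fun a l => if a == 0%N then nth 0 [:: lambda; mu; eps] l else 0).

Definition write_row n (f : nat -> R) (base : nat) (v : 'rV[R]_n) : nat -> R :=
  fun l => if (base <= l)%N then oapp (v 0) (f l) (insub (l - base)%N) else f l.

(* Reality announces M, after t earlier announcements. *)
Definition announce m (t : nat) (M : 'M[R[i]]_d) : memory R :=
  let write a part := write_row (rarr m a) (t * (d * d))%N (mxvec (map_mx part M)) in
  Memory (fun v => if v == 1%N then t.+1 else ireg m v)
    (fun a => match a with
              | 1%N => write 1%N (@complex.Re R)
              | 2%N => write 2%N (@complex.Im R)
              | _ => rarr m a
              end).

Definition output_center m : 'rV[R]_(d * d) := \row_k rarr m 3%N k.

Definition output_shape m : 'M[R]_(d * d) :=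
  \matrix_(k, l) rarr m 4%N (k * (d * d) + l)%N.

End Protocol.
Arguments initial_memory {R} d lambda mu eps.
Arguments output_center {R} d m.
Arguments output_shape {R} d m.

(* In the round after t announcements the program has performed at most K
   iterations of the ellipsoid method for the VB-FTRL objective; it outputs the
   last ellipsoid, which has volume at most eps and contains a minimizer. *)
Definition solves_round {R : realType} {d : nat} (lambda mu eps : R)
    (A : nat -> 'M[R[i]]_d) (t : nat) (K : R)
    (c : 'rV[R]_(d * d)) (B : 'M[R]_(d * d)) : Prop :=
  [/\ exists2 k, ellipsoid_method (Pt lambda mu A t) k c B & k%:R <= K,
      (volume (ellipsoid c B) <= eps%:E)%E
    & exists2 x, ellipsoid c B x & minimizer (Pt lambda mu A t) (herm x)].

(* Main.v *)
Require Import Defs.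
From mathcomp Require Import all_boot all_order all_algebra.
From mathcomp Require Import all_classical all_reals all_analysis.
From mathcomp Require Import complex measurable_realfun spectral ring lra zify.

(* Identify Hermitian matrices with their coordinates x in R^n, n = d^2, and
   represent herm x by a real symmetric matrix S(x) of size 2d, linear in x.
   The objective becomes

     P(x) = - sum_tau ln <a_tau, x> - (lambda/2) ln det S(x)
            + (mu/2) ln det H(x),

   where H(x), the Hessian of the first two terms, is a positive combination of
   rank-one matrices. Diagonalizing S(x) and S(y), respectively H(x) and H(y),
   simultaneously, Jensen's inequality gives the tangent inequality
   P(y) - P(x) >= <grad P(x), y - x>. With the continuity of grad P it yields
   the directional derivatives of P, the validity of the gradient cuts and the
   existence of a minimizer.

   A central cut multiplies det B by at most (n + 1)/(n + 2), and ellipsoid c B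
   has volume at most e^pi sqrt(det B), by comparison with a Gaussian. Hence
   O(n ln(1/eps)) cuts suffice. One cut costs O(T d^4 + d^8): all quantities are
   finite sums computed by nested loops, except the inverses, which are computed
   by principal pivots. A pivot of S(c) that is not positive provides a vector
   u with u S(c) u^T <= 0, and x |-> u S(x) u^T separates c from the density
   matrices. If the traceless part of the gradient vanishes, or if some A tau
   is zero (so that P is +oo everywhere), the center is a minimizer and the
   ellipsoid is shrunk. *)

Set Implicit Arguments.
Unset Strict Implicit.
Unset Printing Implicit Defensive.

Import Order.TTheory GRing.Theory Num.Theory.
Import numFieldNormedType.Exports.
Local Open Scope ring_scope.
Local Open Scope classical_set_scope.
Local Open Scope complex_scope.
Local Open Scope sesquilinear_scope.

(** * Positive definite matrices *)

(** The obstacle is the gradient of [vol_barrier], which involves third derivatives: obtaining it by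
    calculus would mean differentiating the determinant of a matrix built from inverses. Instead
    [grad_vol] is written down as a candidate. Tangent inequalities at both ends of a segment trap
    the difference quotient, so continuity of the candidate suffices. [H(x)] and [H(y)] are
    comparable because one congruence diagonalizing both [S(x)] and [S(y)] expresses them over the
    same rank-one matrices; the logarithms of the weight ratios are bounded below by linear
    functions of [y - x].

    Cut normals are traceless, so a nonzero one exists only if [1 < n], as the cut formulas require;
    for [d = 1] the center is optimal at once. Since e^pi <= 100, the loop may stop when
    [\det B <= (eps / 100) ^+ 2]. No determinant is computed: the program multiplies a bound on it
    by a rational ratio at each cut. The budget [T * d ^ 6 + d ^ 8] per iteration, times O(d^2
    ln(1/eps)) iterations, is the claimed cost. *)

Section DotProduct.
Context {R : realType} {n : nat}.
Implicit Types (u v w : 'rV[R]_n) (M : 'M[R]_n).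

Lemma dotE u v : dot u v = \sum_j u 0 j * v 0 j.
Proof. by rewrite /dot mxE; apply: eq_bigr => j _; rewrite mxE. Qed.

Lemma dotC u v : dot u v = dot v u.
Proof. by rewrite !dotE; apply: eq_bigr => j _; rewrite mulrC. Qed.

Lemma dotDl u v w : dot (u + v) w = dot u w + dot v w.
Proof. by rewrite /dot mulmxDl mxE. Qed.

Lemma dotDr u v w : dot w (u + v) = dot w u + dot w v.
Proof. by rewrite !(dotC w) dotDl. Qed.

Lemma dotZl a u v : dot (a *: u) v = a * dot u v.
Proof. by rewrite /dot -scalemxAl mxE. Qed.

Lemma dotZr a u v : dot u (a *: v) = a * dot u v.
Proof. by rewrite !(dotC u) dotZl. Qed.

Lemma dotNl u v : dot (- u) v = - dot u v.
Proof. by rewrite -scaleN1r dotZl mulN1r. Qed.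

Lemma dotNr u v : dot u (- v) = - dot u v.
Proof. by rewrite !(dotC u) dotNl. Qed.

Lemma dot0l u : dot 0 u = 0.
Proof. by rewrite /dot mul0mx mxE. Qed.

Lemma dot0r u : dot u 0 = 0.
Proof. by rewrite dotC dot0l. Qed.

Lemma dot_ge0 u : 0 <= dot u u.
Proof. by rewrite dotE sumr_ge0// => j _; rewrite -expr2 sqr_ge0. Qed.

Lemma dot_eq0 u : (dot u u == 0) = (u == 0).
Proof.
apply/eqP/eqP => [|->]; last by rewrite dot0l.
rewrite dotE => /eqP; rewrite psumr_eq0; last first.
  by move=> j _; rewrite -expr2 sqr_ge0.
move=> /allP u0; apply/rowP => j; rewrite mxE.
by apply/eqP; have := u0 j (mem_index_enum _); rewrite mulf_eq0 orbb.
Qed.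

Lemma dot_gt0 u : u != 0 -> 0 < dot u u.
Proof. by move=> u0; rewrite lt_def dot_eq0 u0 dot_ge0. Qed.

Lemma dot_mulmxl m (A : 'M[R]_(m, n)) (x : 'rV[R]_m) u :
  dot (x *m A) u = dot x (u *m A^T).
Proof. by rewrite /dot trmx_mul trmxK mulmxA. Qed.

Lemma dot_sym M u v : M^T = M -> dot (u *m M) v = dot (v *m M) u.
Proof. by move=> sM; rewrite dot_mulmxl sM dotC. Qed.

Lemma dot_delta u i : dot (delta_mx 0 i) u = u 0 i.
Proof.
rewrite dotE (bigD1 i)//= big1 ?mxE ?eqxx ?mul1r ?addr0// => j /negPf ji.
by rewrite mxE ji andbF mul0r.
Qed.

End DotProduct.

Definition posdef {R : realType} {n} (M : 'M[R]_n) :=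
  M^T = M /\ forall u : 'rV[R]_n, u != 0 -> 0 < dot (u *m M) u.

Section PositiveDefinite.
Context {R : realType}.

Lemma posdef_ge0 n (M : 'M[R]_n) u : posdef M -> 0 <= dot (u *m M) u.
Proof.
move=> [_ M0]; have [->|/M0/ltW//] := eqVneq u 0.
by rewrite mul0mx dot0l.
Qed.

Lemma posdef_unit n (M : 'M[R]_n) : posdef M -> M \in unitmx.
Proof.
move=> [_ M0]; rewrite -row_free_unit -kermx_eq0.
apply/rowV0P => u /sub_kermxP uM; apply/eqP; apply: contraT => /M0.
by rewrite uM dot0l ltxx.
Qed.

Lemma posdef_inv n (M : 'M[R]_n) : posdef M -> posdef (invmx M).
Proof.
move=> pM; have uM := posdef_unit pM; case: pM => sM M0.
split; first by rewrite trmx_inv sM.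
move=> u u0; set v := u *m invmx M.
have -> : u = v *m M by rewrite mulmxKV.
rewrite dotC; apply: M0; apply: contra_neq u0 => v0.
by rewrite -(mulmxKV uM u) -/v v0 mul0mx.
Qed.

Lemma posdef1 n : posdef (1%:M : 'M[R]_n).
Proof. by split; [rewrite trmx1 | move=> u u0; rewrite mulmx1 dot_gt0]. Qed.

Lemma posdefZ n (M : 'M[R]_n) a : 0 < a -> posdef M -> posdef (a *: M).
Proof.
move=> a0 [sM M0]; split; first by rewrite linearZ/= sM.
by move=> u u0; rewrite -scalemxAr dotZl mulr_gt0// M0.
Qed.

Lemma dot_row_mx m n (u1 v1 : 'rV[R]_m) (u2 v2 : 'rV[R]_n) :
  dot (row_mx u1 u2) (row_mx v1 v2) = dot u1 v1 + dot u2 v2.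
Proof. by rewrite /dot tr_row_mx mul_row_col mxE. Qed.

(* Schur complement of the lower right block *)
Lemma posdef_block n (M : 'M[R]_(1 + n)) : posdef M ->
  exists (D : 'M[R]_n) (b : 'rV[R]_n) (s : R),
    [/\ posdef D, 0 < s, \det M = s * \det D
      & forall (x : R) y, dot (row_mx (const_mx x) y *m M) (row_mx (const_mx x) y) =
          s * x ^+ 2 + dot ((y + x *: b) *m D) (y + x *: b)].
Proof.
move=> pM; have [sM M0] := pM.
set a := M 0 0; set w := ursubmx M; set D := drsubmx M.
have [e2 sD] : ursubmx M = (dlsubmx M)^T /\ D^T = D.
  have := sM; rewrite -{1 2}[M]submxK tr_block_mx.
  by move=> /eq_block_mx[_ <- _ e4].
have eM : M = block_mx a%:M w w^T D.
  rewrite -[LHS]submxK /w e2 trmxK; f_equal.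
  apply/matrixP => i j; rewrite !mxE !ord1 eqxx mulr1n.
  by congr (M _ _); apply: val_inj.
have pD : posdef D.
  split=> // u u0; have := M0 (row_mx 0 u); rewrite row_mx_eq0 negb_and u0 orbT.
  move=> /(_ isT); rewrite eM mul_row_block !mul0mx !add0r dot_row_mx.
  by rewrite dot0r add0r.
have uD := posdef_unit pD.
pose b := w *m invmx D; have bD : b *m D = w by rewrite mulmxKV.
have quad x y : dot (row_mx (const_mx x) y *m M) (row_mx (const_mx x) y) =
    (a - dot b w) * x ^+ 2 + dot ((y + x *: b) *m D) (y + x *: b).
  have -> : const_mx x = x%:M :> 'M[R]_1.
    by apply/matrixP => i j; rewrite !mxE !ord1 eqxx.
  rewrite eM mul_row_block dot_row_mx !mulmxDl !dotDl !dotDr -!scalemxAl bD.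
  rewrite !dotZl !dotZr (dotC w b) !mul_scalar_mx !dotZl (dotC w y).
  have -> : dot (y *m D) b = dot y w by rewrite dot_mulmxl sD bD.
  have -> : dot (y *m w^T) x%:M = x * dot y w.
    by rewrite dotE big_ord1 [x%:M _ _]mxE eqxx mulr1n mulrC.
  have -> : dot a%:M x%:M = a * x.
    by rewrite dotE big_ord1 !mxE eqxx !mulr1n.
  ring.
exists D, b, (a - dot b w); split=> //.
(* The vector [(1, -b)] annihilates the completed square and leaves exactly [s]. *)
- have := M0 (row_mx (const_mx 1) (- b)); rewrite quad scale1r addNr mul0mx dot0l.
  rewrite expr1n mulr1 addr0; apply; rewrite row_mx_eq0 negb_and.
  apply/orP; left; apply/eqP => /matrixP/(_ 0 0); rewrite !mxE => /eqP.
  by rewrite oner_eq0.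
- have -> : M = block_mx 1%:M b 0 1%:M *m block_mx (a - dot b w)%:M 0 w^T D.
    rewrite mulmx_block !mul1mx !mul0mx !add0r bD eM; f_equal.
    apply/matrixP => i j; rewrite !ord1 [RHS]mxE ![_%:M _ _]mxE eqxx !mulr1n.
    by rewrite /dot subrK.
  by rewrite det_mulmx det_ublock det_lblock !det1 !mul1r det_scalar1.
Qed.

Lemma posdef_det_gt0 n (M : 'M[R]_n) : posdef M -> 0 < \det M.
Proof.
elim: n M => [|n IH] M; first by rewrite det_mx00.
by move=> /(@posdef_block n)[D [b [s [pD s0 -> _]]]]; rewrite mulr_gt0// IH.
Qed.

End PositiveDefinite.

(** * Volume of ellipsoids *)

Section Volume.
Context {R : realType}.

(* Unlike [ge0_le_integral], no measurability is required. *)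
Lemma ge0_integral_monotone (f g : R -> \bar R) :
  (forall x, 0 <= f x)%E -> (forall x, f x <= g x)%E ->
  (\int[lebesgue_measure]_(x in [set: R]) f x <=
   \int[lebesgue_measure]_(x in [set: R]) g x)%E.
Proof.
move=> f0 fg; rewrite !ge0_integralTE//; last first.
  by move=> x; exact: le_trans (fg x).
by apply: le_ereal_sup => _ [h hf <-]; exists h => // x; exact: le_trans (fg x).
Qed.

(** The integrand is [(Num.sqrt s)^-1] times the normal density with mean [c] and variance
    [(2 * pi * s)^-1]. *)
Lemma integral_gaussian (c s : R) : 0 < s ->
  (\int[lebesgue_measure]_(x in [set: R]) (expR (- (pi * (s * (x - c) ^+ 2))))%:E
   = ((Num.sqrt s)^-1)%:E)%E.
Proof.
move=> s0; have pi0 : 0 < pi :> R := pi_gt0 R.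
pose sg := (Num.sqrt (2 * pi * s))^-1.
have q0 : 0 < 2 * pi * s by rewrite !mulr_gt0.
have sg0 : sg != 0 by rewrite gt_eqF// invr_gt0 sqrtr_gt0.
have sg2 : sg ^+ 2 = (2 * pi * s)^-1 by rewrite exprVn sqr_sqrtr// ltW.
have peak : normal_peak sg = Num.sqrt s.
  rewrite /normal_peak sg2.
  have -> : (2 * pi * s)^-1 * pi *+ 2 = s^-1.
    rewrite -mulr_natr; move: (pi : R) pi0 => p p0.
    by field; rewrite !gt_eqF.
  by rewrite sqrtrV ?invrK// ltW.
have e x : (expR (- (pi * (s * (x - c) ^+ 2))))%:E =
    (((Num.sqrt s)^-1)%:E * (normal_pdf c sg x)%:E)%E.
  rewrite normal_pdfE// peak /normal_fun -EFinM mulKf; last first.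
    by rewrite gt_eqF// sqrtr_gt0.
  congr (expR _)%:E; rewrite sg2 -mulr_natr; move: (pi : R) pi0 => p p0.
  by field; rewrite !gt_eqF.
under eq_integral do rewrite e.
rewrite integralZl//; last exact: integrable_normal_pdf.
by rewrite integral_normal_pdf mule1.
Qed.

Lemma volume_ge0 n (E : set 'rV[R]_n) : (0 <= volume E)%E.
Proof.
elim: n E => [|n IH] E /=; first by rewrite lee_fin indicE.
by apply: integral_ge0 => x _; exact: IH.
Qed.

(** Induction on the dimension. For a fixed first coordinate [x], the Schur complement turns the
    exponent into a one-dimensional term in [x] plus the form [D] in the other coordinates, with a
    center that moves linearly with [x]. The factor [k] is general so that it can absorb the
    one-dimensional Gaussian, which is integrated last. *)
Lemma volume_gaussian n (E : set 'rV[R]_n) M c (k : R) : posdef M -> 0 <= k ->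
  (forall x, E x -> 1 <= k * expR (- (pi * dot ((x - c) *m M) (x - c)))) ->
  (volume E <= (k / Num.sqrt (\det M))%:E)%E.
Proof.
elim: n E M c k => [|n IH] E M c k pM k0 Ek /=.
  rewrite det_mx00 sqrtr1 divr1 lee_fin indicE.
  have [/set_mem/Ek|//] := boolP (0 \in E).
  by rewrite dotE big_ord0 mulr0 oppr0 expR0 mulr1.
have [D [b [s [pD s0 dM quad]]]] := posdef_block (pM : posdef (M : 'M[R]_(1 + n))).
have dD := posdef_det_gt0 pD.
pose c1 := (c : 'rV[R]_(1 + n)) 0 0; pose c2 : 'rV[R]_n := rsubmx (c : 'rV[R]_(1 + n)).
have cE : c = row_mx (const_mx c1) c2 :> 'rV[R]_(1 + n).
  rewrite -[LHS](@hsubmxK _ 1 1 n); congr row_mx.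
  by apply/matrixP => i j; rewrite !mxE !ord1; congr (c _ _); apply: val_inj.
apply: (@le_trans _ _ (\int[lebesgue_measure]_(x in [set: R])
   ((k / Num.sqrt (\det D))%:E * (expR (- (pi * (s * (x - c1) ^+ 2))))%:E))%E).
  apply: ge0_integral_monotone => x; first exact: volume_ge0.
  rewrite -EFinM mulrAC.
  apply: (IH _ _ (c2 - (x - c1) *: b)) => //; first by rewrite mulr_ge0// expR_ge0.
  move=> y /= /Ek.
  have -> : (row_mx (const_mx x : 'rV[R]_1) y : 'rV[R]_n.+1) - c =
      row_mx (const_mx (x - c1) : 'rV[R]_1) (y - c2).
    rewrite cE; apply/rowP => j; rewrite !mxE.
    by case: (@fintype.split 1 n j) => j'; rewrite !mxE.
  rewrite quad mulrDr opprD expRD -mulrA [in X in _ -> X]opprB.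
  by rewrite [y + (_ - _)]addrCA addrC -addrA.
have mf : measurable_fun [set: R]
    (fun x : R => expR (- (pi * (s * (x - c1) ^+ 2)))).
  apply: measurableT_comp => //.
  apply: measurableT_comp => //; apply: measurable_funM => //.
  apply: measurable_funM => //; apply: measurable_funX.
  exact: measurable_funB.
rewrite ge0_integralZl_EFin ?divr_ge0 ?sqrtr_ge0//; last exact/measurable_EFinP.
rewrite integral_gaussian// -EFinM lee_fin dM (sqrtrM _ (ltW s0)) invfM.
by rewrite -mulrA [X in k * X]mulrC.
Qed.

(** On the ellipsoid the form [q] of [invmx B] is at most 1, so [expR pi * expR (- (pi * q))]
    dominates the indicator. The factor [pi] in the exponent makes the Gaussian integral exactly
    [Num.sqrt (\det B)]. *)
Lemma volume_ellipsoid n (c : 'rV[R]_n) (B : 'M[R]_n) : posdef B ->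
  (volume (ellipsoid c B) <= (expR pi * Num.sqrt (\det B))%:E)%E.
Proof.
move=> pB; have dB := posdef_det_gt0 pB.
apply: le_trans (@volume_gaussian _ _ (invmx B) c (expR pi) (posdef_inv pB) _ _) _.
- exact: expR_ge0.
- move=> x; rewrite /ellipsoid /= => qx.
  rewrite -expRD -[1]expR0 ler_expR -{1}[pi]mulr1 -mulrBr mulr_ge0 ?pi_ge0//.
  by rewrite subr_ge0.
- by rewrite det_inv (sqrtrV (ltW dB)) invrK.
Qed.

End Volume.

(** * Central cuts *)

Section CentralCut.
Context {R : realType}.

Lemma posdef_cauchy_schwarz n (M : 'M[R]_n) u v : posdef M ->
  dot (u *m M) v ^+ 2 <= dot (u *m M) u * dot (v *m M) v.
Proof.
move=> pM; have sM := pM.1.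
have [->|v0] := eqVneq v 0; first by rewrite !dot0r !mulr0 expr0n.
have q0 := pM.2 v v0; set q := dot (v *m M) v in q0 *.
have := posdef_ge0 (q *: u - dot (u *m M) v *: v) pM.
rewrite mulmxBl dotDl dotNl !dotDr !dotNr -!scalemxAl !dotZl !dotZr.
rewrite (dot_sym v u sM) -/q.
move: (dot (u *m M) v) (dot (u *m M) u) => a b h.
have : 0 <= q * (b * q - a ^+ 2) by lra.
by rewrite pmulr_rge0// subr_ge0.
Qed.

(** Matrix determinant lemma: eliminating one or the other off-diagonal block of the bordered matrix
    [M] yields the two sides. *)
Lemma det_1D_mul n (u : 'cV[R]_n) (v : 'rV[R]_n) :
  \det (1%:M + u *m v) = 1 + (v *m u) 0 0.
Proof.
pose M := block_mx (1%:M : 'M[R]_1) (- v) u (1%:M : 'M[R]_n).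
have <- : \det M = \det (1%:M + u *m v).
  have -> : \det M = \det (M *m block_mx 1%:M v 0 1%:M).
    by rewrite det_mulmx det_ublock !det1 !mulr1.
  rewrite mulmx_block !mulmx1 !mulmx0 !mul1mx !addr0 subrr det_lblock det1 mul1r.
  by rewrite addrC.
have -> : \det M = \det (M *m block_mx 1%:M 0 (- u) 1%:M).
  by rewrite det_mulmx det_lblock !det1 !mulr1.
rewrite mulmx_block !mulmx1 !mulmx0 !mul1mx !add0r subrr det_ublock det1 mulr1.
by rewrite mulNmx mulmxN opprK det_mx11 !mxE.
Qed.

Lemma invmx_unique n (A X : 'M[R]_n) : A *m X = 1%:M -> invmx A = X.
Proof.
move=> AX; have [uA _] := mulmx1_unit AX.
by rewrite -[LHS]mulmx1 -AX mulmxA mulVmx// mul1mx.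
Qed.

Variables (n : nat) (B : 'M[R]_n) (g : 'rV[R]_n).
Hypotheses (n1 : (1 < n)%N) (pB : posdef B) (g0 : g != 0).

Let w := dot (g *m B) g.
Let b := g *m B.
Let w0 : 0 < w. Proof. exact: pB.2. Qed.
Let m : R := n%:R.
Let m1 : 1 < m. Proof. by rewrite /m ltr1n. Qed.
Let uB : B \in unitmx. Proof. exact: posdef_unit. Qed.
Let sg : R := 2 / n.+1%:R.
Let dl : R := m ^+ 2 / (m ^+ 2 - 1).
Let mS : n.+1%:R = m + 1 :> R. Proof. by rewrite /m -natr1. Qed.
Let m21 : 0 < m ^+ 2 - 1. Proof. by rewrite subr_gt0 expr_gt1// ltW. Qed.
Let dl0 : 0 < dl.
Proof. by rewrite divr_gt0// exprn_gt0// (lt_trans _ m1). Qed.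

Let shapeE : cut_shape B g = dl *: (B - (sg / w) *: (b^T *m b)).
Proof. by []. Qed.

Let dot_outer u v : dot (u *m (b^T *m b)) v = dot u b * dot v b.
Proof.
rewrite mulmxA; have -> : u *m b^T = (dot u b)%:M.
  by apply/matrixP => i j; rewrite !ord1 [RHS]mxE eqxx mulr1n.
by rewrite mul_scalar_mx dotZl (dotC b).
Qed.

(** By Cauchy-Schwarz for the form [B], the subtracted rank-one term is at most [sg = 2 / (n + 1)]
    times [dot (u *m B) u], and [sg < 1]. *)
Lemma posdef_cut_shape : posdef (cut_shape B g).
Proof.
rewrite shapeE; apply: posdefZ => //; split.
  by rewrite linearB/= linearZ/= trmx_mul trmxK pB.1.
move=> u u0; rewrite mulmxBr -scalemxAr dotDl dotNl dotZl dot_outer.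
have qu := pB.2 u u0.
have := posdef_cauchy_schwarz u g pB.
rewrite -/w (dot_sym u g pB.1) (dotC _ u) -/b => cs.
rewrite subr_gt0 -(ltr_pM2r w0) mulrAC mulrA (divfK (lt0r_neq0 w0)).
apply: le_lt_trans (_ : sg * (dot (u *m B) u * w) < _).
  by rewrite -mulrA -expr2 ler_wpM2l// divr_ge0.
rewrite gtr_pMl; last exact: mulr_gt0.
by rewrite /sg ltr_pdivrMr ?mul1r ?ltr0n// ltr_nat ltnS.
Qed.

(** Sherman-Morrison formula; the new coefficient is [sg / (1 - sg) = 2 / (m - 1)], divided by
    [w]. *)
Let invE : invmx (cut_shape B g) =
  dl^-1 *: (invmx B + (2 / (m - 1) / w) *: (g^T *m g)).
Proof.
apply: invmx_unique; rewrite shapeE -scalemxAl -scalemxAr scalerA divff ?lt0r_neq0//.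
rewrite scale1r mulmxBl !mulmxDr mulmxV//.
have bgE : b *m g^T = w%:M.
  by apply/matrixP => i j; rewrite !ord1 [RHS]mxE eqxx mulr1n.
have BgE : B *m g^T = b^T by rewrite trmx_mul pB.1.
have h2 : b^T *m b *m invmx B = b^T *m g by rewrite -mulmxA mulmxK.
have h3 : b^T *m b *m (g^T *m g) = w *: (b^T *m g).
  by rewrite mulmxA -(mulmxA b^T b g^T) bgE mul_mx_scalar -scalemxAl.
rewrite -scalemxAr mulmxA BgE -!scalemxAl h2 -scalemxAr h3 !scalerA.
rewrite -addrA -scalerDl -scalerBl.
rewrite (_ : _ - _ = 0) ?scale0r ?addr0// /sg mS; field.
by rewrite !lt0r_neq0// ?subr_gt0// (lt_trans _ (ltr_pwDr _ (lexx m)))// (lt_trans _ m1).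
Qed.

(** Only [q] and the normalized slope [a] enter. Multiplied by [dl], the new form is at most
    [dl + 2 / (m - 1) * (a * (1 + a))], and [-1 <= a <= 0]: the lower bound is Cauchy-Schwarz, the
    upper one is the cut. *)
Lemma cut_ellipsoid c x : ellipsoid c B x -> dot g (x - c) <= 0 ->
  ellipsoid (cut_center c B g) (cut_shape B g) x.
Proof.
rewrite /ellipsoid /= => qx gx; rewrite invE.
pose tau : R := (m + 1)^-1; pose r := Num.sqrt w.
have r0 : 0 < r by rewrite sqrtr_gt0.
have r2 : r ^+ 2 = w by rewrite sqr_sqrtr// ltW.
have -> : x - cut_center c B g = (x - c) + (tau / r) *: b.
  by rewrite /cut_center opprB addrA addrAC mS.
set y := x - c in qx gx *; clearbody y.
pose a := dot g y / r.
have bV : b *m invmx B = g by rewrite mulmxK.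
have yb : dot (y *m invmx B) b = dot g y.
  by rewrite dot_mulmxl trmx_inv pB.1 bV dotC.
have outer z : dot (z *m (g^T *m g)) z = dot g z ^+ 2.
  rewrite mulmxA; have -> : z *m g^T = (dot z g)%:M.
    by apply/matrixP => i j; rewrite !ord1 [RHS]mxE eqxx mulr1n.
  by rewrite mul_scalar_mx dotZl (dotC z).
have gy : dot g y = a * r by rewrite divfK// lt0r_neq0.
have gb : dot g b = r ^+ 2 by rewrite r2 dotC.
rewrite -scalemxAr mulmxDr dotZl dotDl -scalemxAr dotZl outer.
rewrite mulmxDl !dotDl !dotDr -!scalemxAl !dotZl !dotZr bV yb gb gy.
have a0 : a <= 0 by rewrite ler_pdivrMr// mul0r.
have a1 : -1 <= a.
  have := posdef_cauchy_schwarz y b (posdef_inv pB).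
  rewrite yb bV gb => cs.
  have : a ^+ 2 <= 1.
    rewrite expr_div_n r2 ler_pdivrMr// mul1r -r2 (le_trans cs)//.
    by rewrite ler_piMl// sqr_ge0.
  by move=> h; nra.
set q := dot (y *m invmx B) y in qx *.
have -> : dl^-1 * (q + tau / r * (a * r) + (tau / r * (a * r) + tau / r * (tau / r * r ^+ 2)) +
   2 / (m - 1) / w * (a * r + tau / r * r ^+ 2) ^+ 2) =
   dl^-1 * (q + 2 * tau * a + tau ^+ 2 + 2 / (m - 1) * (a + tau) ^+ 2).
  rewrite -r2; congr (_ * _); field.
  by rewrite !lt0r_neq0// ?subr_gt0// (lt_trans _ (ltr_pwDr _ (lexx m)))// (lt_trans _ m1).
rewrite ler_pdivrMl// mulr1.
apply: (@le_trans _ _ (1 + 2 * tau * a + tau ^+ 2 + 2 / (m - 1) * (a + tau) ^+ 2)).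
  by rewrite !lerD2r.
have -> : 1 + 2 * tau * a + tau ^+ 2 + 2 / (m - 1) * (a + tau) ^+ 2 =
   dl + 2 / (m - 1) * (a * (1 + a)).
  rewrite /dl /tau; field.
  rewrite !lt0r_neq0// ?subr_gt0// ?(lt_trans _ (ltr_pwDr _ (lexx m)))// (lt_trans _ m1)//.
rewrite gerDl mulr_ge0_le0//; first by rewrite divr_ge0// subr_ge0 ltW.
by rewrite mulr_le0_ge0// -lerBlDl sub0r.
Qed.

(** The exact factor is [dl ^+ n.-1 * (m / (m + 1)) ^+ 2]. Bounding [1 + z] by [expR z] in both
    factors leaves [expR (- (m + 1)^-1)], and the same inequality bounds this by the stated ratio,
    which is rational and hence computable by the program. *)
Lemma det_cut_shape : \det (cut_shape B g) <= (n.+1%:R / n.+2%:R) * \det B.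
Proof.
have dB := posdef_det_gt0 pB.
have -> : \det (cut_shape B g) = dl ^+ n * (1 - sg) * \det B.
  rewrite shapeE detZ -mulrA; congr (_ * _).
  have -> : B - (sg / w) *: (b^T *m b) =
      (1%:M + (- (sg / w)) *: b^T *m (b *m invmx B)) *m B.
    by rewrite mulmxDl mul1mx -mulmxA mulmxKV// -scalemxAl scaleNr.
  rewrite det_mulmx det_1D_mul mulmxK// -scalemxAr mxE.
  have -> : (g *m b^T) 0 0 = w by rewrite -/(dot g b) dotC.
  by rewrite mulNr divfK// lt0r_neq0.
rewrite ler_pM2r//.
have -> : dl ^+ n * (1 - sg) = dl ^+ n.-1 * (m / (m + 1)) ^+ 2.
  rewrite -{1}(prednK (ltnW n1)) exprSr -mulrA; congr (_ * _).
  rewrite /dl /sg mS; field.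
  by rewrite !lt0r_neq0// ?(lt_trans _ (ltr_pwDr _ (lexx m)))// (lt_trans _ m1).
have mp : 0 < m + 1 by rewrite (lt_trans _ (ltr_pwDr _ (lexx m)))// (lt_trans _ m1).
have mm : 0 < m - 1 by rewrite subr_gt0.
have h1 : dl ^+ n.-1 <= expR (m + 1)^-1.
  have -> : (m + 1)^-1 = (m ^+ 2 - 1)^-1 *+ n.-1.
    rewrite -mulr_natr -subn1 natrB ?(ltnW n1)// -/m.
    by field; rewrite !lt0r_neq0.
  rewrite -mulr_natr expRM_natr lerXn2r ?nnegrE ?expR_ge0 ?(ltW dl0)//.
  have -> : dl = 1 + (m ^+ 2 - 1)^-1 by rewrite /dl; field; rewrite !lt0r_neq0.
  exact: expR_ge1Dx.
have h2 : (m / (m + 1)) ^+ 2 <= expR (- ((m + 1)^-1 *+ 2)).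
  rewrite -mulNrn -mulr_natr expRM_natr lerXn2r ?nnegrE ?expR_ge0 ?divr_ge0 ?(ltW mp)//.
  have -> : m / (m + 1) = 1 + - (m + 1)^-1 by field; rewrite !lt0r_neq0.
  exact: expR_ge1Dx.
apply: le_trans (ler_pM _ _ h1 h2) _; rewrite ?exprn_ge0 ?(ltW dl0) ?divr_ge0 ?(ltW mp)//.
rewrite -expRD mulr2n opprD addrA subrr sub0r expRN.
have -> : n.+2%:R = m + 1 + 1 :> R by rewrite -natr1 mS.
rewrite mS -invf_div lef_pV2 ?posrE ?expR_gt0 ?divr_gt0//; last by rewrite addr_gt0.
have -> : (m + 1 + 1) / (m + 1) = 1 + (m + 1)^-1 by field; rewrite !lt0r_neq0.
exact: expR_ge1Dx.
Qed.

End CentralCut.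

(** * Simultaneous diagonalization *)

Section SimultaneousDiagonalization.
Context {R : realType}.

Let ReM m n (v : 'M[R[i]]_(m, n)) p (M : 'M[R]_(n, p)) :
  map_mx (@complex.Re R) (v *m map_mx (real_complex R) M) =
  map_mx (@complex.Re R) v *m M.
Proof.
apply/matrixP => i j; rewrite !mxE raddf_sum; apply: eq_bigr => k _.
by rewrite !mxE; case: (v i k) => a b /=; rewrite mulr0 subr0.
Qed.

Let ImM m n (v : 'M[R[i]]_(m, n)) p (M : 'M[R]_(n, p)) :
  map_mx (@complex.Im R) (v *m map_mx (real_complex R) M) =
  map_mx (@complex.Im R) v *m M.
Proof.
apply/matrixP => i j; rewrite !mxE raddf_sum; apply: eq_bigr => k _.
by rewrite !mxE; case: (v i k) => a b /=; rewrite mulr0 add0r.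
Qed.

(* For an eigenvalue [a + ib] of [S1 S0^-1] with eigenvector [x + iy],
   symmetry forces [b (x S0 x^T + y S0 y^T) = 0]. *)
Lemma generalized_eigenvector n (S0 S1 : 'M[R]_n.+1) :
  posdef S0 -> S1^T = S1 ->
  exists (u : 'rV[R]_n.+1) (a : R), u != 0 /\ u *m S1 = a *: (u *m S0).
Proof.
move=> pS0 sS1; have uS0 := posdef_unit pS0.
have [z /eigenvalueP[v vM v0]] :=
  eigenvalue_closed (map_mx (real_complex R) (S1 *m invmx S0)) (ltn0Sn n).
pose x := map_mx (@complex.Re R) v; pose y := map_mx (@complex.Im R) v.
case: z vM => a b vM.
have xE : x *m S1 = a *: (x *m S0) - b *: (y *m S0).
  have := congr1 (map_mx (@complex.Re R)) vM; rewrite ReM.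
  have -> : map_mx (@complex.Re R) ((a +i* b) *: v) = a *: x - b *: y.
    by apply/matrixP => i j; rewrite !mxE; case: (v i j).
  by move=> /(congr1 (mulmx^~ S0)); rewrite mulmxA mulmxKV// mulmxBl -!scalemxAl.
have yE : y *m S1 = b *: (x *m S0) + a *: (y *m S0).
  have := congr1 (map_mx (@complex.Im R)) vM; rewrite ImM.
  have -> : map_mx (@complex.Im R) ((a +i* b) *: v) = b *: x + a *: y.
    by apply/matrixP => i j; rewrite !mxE; case: (v i j) => ? ? /=; rewrite addrC.
  by move=> /(congr1 (mulmx^~ S0)); rewrite mulmxA mulmxKV// mulmxDl -!scalemxAl.
have xy0 : (x != 0) || (y != 0).
  apply: contra_neqT v0; rewrite negb_or !negbK => /andP[/eqP x0 /eqP y0].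
  apply/matrixP => i j; move/matrixP/(_ i j): x0; move/matrixP/(_ i j): y0.
  by rewrite !mxE; case: (v i j) => ? ? /= -> ->.
have b0 : b = 0.
  have := dot_sym x y sS1; rewrite xE yE !dotDl dotNl !dotZl (dot_sym x y pS0.1).
  move=> /eqP; rewrite -subr_eq0 => /eqP e.
  have {e} : b * (dot (y *m S0) y + dot (x *m S0) x) = 0 by lra.
  move=> /eqP; rewrite mulf_eq0 => /orP[/eqP//|]; rewrite gt_eqF//.
  case/orP: xy0 => [x0|y0].
    by rewrite ltr_wpDl ?posdef_ge0// pS0.2.
  by rewrite ltr_pwDl ?posdef_ge0// pS0.2.
case/orP: xy0 => [x0|y0].
  by exists x, a; split=> //; rewrite xE b0 scale0r subr0.
by exists y, a; split=> //; rewrite yE b0 scale0r add0r.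
Qed.

Lemma posdef_congr m n (S : 'M[R]_n) (K : 'M[R]_(m, n)) :
  posdef S -> row_free K -> posdef (K *m S *m K^T).
Proof.
move=> [sS S0] fK; split; first by rewrite !trmx_mul trmxK sS mulmxA.
move=> u u0; rewrite !mulmxA dot_mulmxl trmxK S0//.
by rewrite mulmx_free_eq0.
Qed.

Lemma col_mx_congr m1 m2 n (v : 'M[R]_(m1, n)) (w : 'M[R]_(m2, n)) (S : 'M[R]_n) :
  col_mx v w *m S *m (col_mx v w)^T =
  block_mx (v *m S *m v^T) (v *m S *m w^T) (w *m S *m v^T) (w *m S *m w^T).
Proof. by rewrite tr_col_mx mul_col_mx mul_col_row. Qed.

(** Deflation: for a normalized generalized eigenvector [v], the rows of [K] span the
    [S0]-orthogonal complement of [v]. Since [v *m S1] is a multiple of [v *m S0], they are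
    [S1]-orthogonal to [v] as well, and the induction hypothesis applies to the compressions to
    [K]. *)
Lemma simultaneous_diagonalization n (S0 S1 : 'M[R]_n) :
  posdef S0 -> S1^T = S1 ->
  exists (P : 'M[R]_n) (m : 'rV[R]_n),
    P *m S0 *m P^T = 1%:M /\ P *m S1 *m P^T = diag_mx m.
Proof.
elim: n S0 S1 => [|n IH] S0 S1 pS0 sS1.
  by exists 1%:M, 0; split; apply/matrixP => -[].
have [u [a [u0 uS1]]] := generalized_eigenvector pS0 sS1.
have {u0 uS1} [v [vS0 vS1]] : exists v : 'rV[R]_n.+1,
    dot (v *m S0) v = 1 /\ v *m S1 = a *: (v *m S0).
  have q0 := pS0.2 _ u0; pose r := Num.sqrt (dot (u *m S0) u).
  have r0 : r != 0 by rewrite gt_eqF// sqrtr_gt0.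
  exists (r^-1 *: u); rewrite -!scalemxAl uS1 scalerA mulrC -scalerA; split=> //.
  rewrite dotZl dotZr -[X in _ * (_ * X)]sqr_sqrtr ?(ltW q0)// -/r.
  by field.
pose c := S0 *m v^T.
have rc : \rank (kermx c) = n.
  rewrite mxrank_ker (_ : \rank c = 1%N) ?subn1//; apply/eqP.
  rewrite eqn_leq rank_leq_col lt0n mxrank_eq0; apply: contra_eqN vS0 => c0.
  by rewrite /dot -mulmxA -/c (eqP c0) mulmx0 mxE eq_sym oner_eq0.
have [K [fK Kc]] : exists K : 'M[R]_(n, n.+1), row_free K /\ K *m c = 0.
  (* The rank equals [n] only up to an equation, so it is first replaced by a variable [r] that
     [subst] can eliminate. *)
  suff [r [K [rn fK Kc]]] : exists r (K : 'M[R]_(r, n.+1)),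
      [/\ r = n, row_free K & K *m c = 0].
    by subst r; exists K.
  exists (\rank (kermx c)), (row_base (kermx c)).
  split=> //; first exact: row_base_free.
  by apply/sub_kermxP; rewrite eq_row_base.
have sK : (K *m S1 *m K^T)^T = K *m S1 *m K^T.
  by rewrite !trmx_mul trmxK sS1 mulmxA.
have [P [m [PS0 PS1]]] := IH _ _ (posdef_congr pS0 fK) sK.
exists (col_mx v (P *m K) : 'M[R]_(1 + n)), (row_mx (const_mx a) m : 'rV[R]_(1 + n)).
have vv : v *m S0 *m v^T = 1%:M.
  by apply/matrixP => i j; rewrite !ord1 [RHS]mxE eqxx.
have Kv : K *m S0 *m v^T = 0 by rewrite -mulmxA.
have vK : v *m S0 *m K^T = 0.
  by apply: trmx_inj; rewrite !trmx_mul trmxK trmx0 pS0.1 mulmxA.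
split.
  apply: (etrans (col_mx_congr v (P *m K) S0)).
  rewrite vv trmx_mul !mulmxA vK mul0mx -!(mulmxA P) Kv mulmx0.
  by rewrite mulmxA PS0 -scalar_mx_block.
apply: (etrans (col_mx_congr v (P *m K) S1)).
have vS1v : v *m S1 *m v^T = a%:M by rewrite vS1 -scalemxAl vv scalemx1.
have vS1K : v *m S1 *m K^T = 0 by rewrite vS1 -scalemxAl vK scaler0.
have KS1v : K *m S1 *m v^T = 0.
  by apply: trmx_inj; rewrite !trmx_mul trmxK trmx0 sS1 mulmxA.
rewrite vS1v trmx_mul !mulmxA vS1K mul0mx -!(mulmxA P) KS1v mulmx0.
rewrite mulmxA PS1; apply/esym.
apply: (etrans (diag_mx_row (const_mx a : 'rV[R]_1) m)); congr block_mx.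
by apply/matrixP => i j; rewrite !ord1 !mxE.
Qed.

End SimultaneousDiagonalization.

(** * Jensen's inequality for log-determinants *)

Section LogDetJensen.
Context {R : realType}.

Lemma ln_le_tangent (x y : R) : 0 < x -> 0 < y -> ln x <= ln y + (x / y - 1).
Proof.
move=> x0 y0; rewrite addrC -lerBlDr -ln_div ?posrE//.
have -> : x / y = 1 + (x / y - 1) by rewrite addrCA subrr addr0.
rewrite (le_trans (le_ln1Dx _))//; last by rewrite addrCA subrr addr0.
by rewrite ltrBDl subrr divr_gt0.
Qed.

Lemma ln_jensen (I : finType) (p r : I -> R) : (forall i, 0 <= p i) ->
  (forall i, 0 < r i) -> \sum_i p i = 1 -> 0 < \sum_i p i * r i ->
  \sum_i p i * ln (r i) <= ln (\sum_i p i * r i).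
Proof.
move=> p0 r0 p1; set m := \sum_i p i * r i => m0.
apply: (@le_trans _ _ (\sum_i p i * (ln m + (r i / m - 1)))).
  by apply: ler_sum => i _; rewrite ler_wpM2l// ln_le_tangent.
under eq_bigr do rewrite mulrDr mulrBr mulr1 mulrA.
rewrite big_split sumrB/= -!mulr_suml p1 mul1r -/m divff ?gt_eqF//.
by rewrite subrr addr0.
Qed.

Lemma ln_prod (I : finType) (f : I -> R) : (forall i, 0 < f i) ->
  ln (\prod_i f i) = \sum_i ln (f i).
Proof.
move=> f0; suff [_ ->//] : 0 < \prod_i f i /\ ln (\prod_i f i) = \sum_i ln (f i).
elim/big_rec2: _ => [|i x y _ [x0 e]]; first by rewrite ln1.
by rewrite mulr_gt0// lnM ?posrE// e.
Qed.

Lemma diag_congr_entry n (P S : 'M[R]_n) m j : P *m S *m P^T = diag_mx m ->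
  dot (row j P *m S) (row j P) = m 0 j.
Proof.
move=> e; have <- : (P *m S *m P^T) j j = m 0 j by rewrite e mxE eqxx mulr1n.
by rewrite -row_mul dotE mxE; apply: eq_bigr => k _; rewrite !mxE.
Qed.

Lemma congr1_inv n (P S : 'M[R]_n) : P *m S *m P^T = 1%:M ->
  P \in unitmx /\ invmx S = P^T *m P.
Proof.
move=> e; have [uP _] : P \in unitmx /\ (S *m P^T) \in unitmx.
  by apply: mulmx1_unit; rewrite mulmxA.
split=> //; apply: invmx_unique; rewrite -[LHS](mulKmx uP) (mulmxA P).
by rewrite (mulmxA (P *m S)) e mul1mx mulVmx.
Qed.

(** A single congruence describes both matrices, both inverses and the ratio of determinants through
    the positive numbers [m], the eigenvalues of [S1] relative to [S0]. *)
Lemma posdef_pair_diag n (S0 S1 : 'M[R]_n) : posdef S0 -> posdef S1 ->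
  exists (P : 'M[R]_n) (m : 'rV[R]_n),
    [/\ P *m S0 *m P^T = 1%:M, P *m S1 *m P^T = diag_mx m, forall i, 0 < m 0 i
      & P \in unitmx] /\
    [/\ invmx S0 = P^T *m P,
        invmx S1 = P^T *m diag_mx (\row_i (m 0 i)^-1) *m P
      & ln (\det S1) - ln (\det S0) = \sum_i ln (m 0 i)].
Proof.
move=> p0 p1; have [P [m [P0 P1]]] := simultaneous_diagonalization p0 p1.1.
have [uP S0V] := congr1_inv P0.
have m0 j : 0 < m 0 j.
  rewrite -(diag_congr_entry j P1); apply: p1.2.
  apply: contraTneq uP => Pj; rewrite unitmxE.
  rewrite (expand_det_row _ j) big1 ?unitr0// => k _.
  by move/rowP/(_ k): Pj; rewrite !mxE => ->; rewrite mul0r.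
exists P, m; split=> //; split=> //.
- apply: invmx_unique.
  rewrite -[LHS](mulKmx uP) (mulmxA P) 2!(mulmxA (P *m S1)) P1.
  rewrite mulmx_diag; have -> : \row_i (m 0 i * (\row_i0 (m 0 i0)^-1) 0 i) = const_mx 1.
    by apply/rowP => i; rewrite !mxE divff// gt_eqF.
  by rewrite diag_const_mx mul1mx mulVmx.
- have d0 := posdef_det_gt0 p0; have d1 := posdef_det_gt0 p1.
  rewrite -ln_div ?posrE// -ln_prod// -det_diag -P1 !det_mulmx det_tr.
  have := congr1 determinant P0; rewrite !det_mulmx det_tr det1 => e.
  congr ln; rewrite mulrAC -[RHS]divr1 -e.
  have dP : \det P != 0.
    by apply: contra_eq_neq e => ->; rewrite !mul0r eq_sym oner_eq0.
  by field; rewrite dP gt_eqF.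
Qed.

(** After a congruence taking [H0] to the identity and [H1] to [diag_mx m], the numbers
    [w i * c i 0 j ^+ 2] are for each [j] a probability distribution over [i], and [m 0 j] is the
    mean of [r] under it. Concavity of [ln] for each [j] gives the claim, because the squares
    [c i 0 j ^+ 2] sum over [j] to the leverage [dot (b i *m invmx H0) (b i)]. *)
Lemma ln_det_jensen (I : finType) n (w r : I -> R) (b : I -> 'rV[R]_n) :
  let H0 := \sum_i w i *: ((b i)^T *m b i) in
  let H1 := \sum_i (w i * r i) *: ((b i)^T *m b i) in
  (forall i, 0 <= w i) -> (forall i, 0 < r i) -> posdef H0 -> posdef H1 ->
  \sum_i w i * ln (r i) * dot (b i *m invmx H0) (b i) <=
  ln (\det H1) - ln (\det H0).
Proof.
move=> H0 H1 w0 r0 pH0 pH1.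
have [P [m [[PH0 PH1 m0 _] [H0V _ ->]]]] := posdef_pair_diag pH0 pH1.
pose c i := b i *m P^T.
have expand (v : I -> R) j : (P *m (\sum_i v i *: ((b i)^T *m b i)) *m P^T) j j =
    \sum_i v i * c i 0 j ^+ 2.
  rewrite mulmx_sumr mulmx_suml summxE; apply: eq_bigr => i _.
  rewrite -scalemxAr -scalemxAl mxE mulmxA -(mulmxA _ (b i)) -/(c i) expr2.
  have -> : P *m (b i)^T = (c i)^T by rewrite trmx_mul trmxK.
  by rewrite mxE big_ord1 !mxE.
have mE j : m 0 j = \sum_i (w i * r i) * c i 0 j ^+ 2.
  by rewrite -expand PH1 mxE eqxx mulr1n.
have w1 j : \sum_i w i * c i 0 j ^+ 2 = 1.
  by rewrite -expand PH0 mxE eqxx.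
have -> : \sum_i w i * ln (r i) * dot (b i *m invmx H0) (b i) =
    \sum_j \sum_i (w i * c i 0 j ^+ 2) * ln (r i).
  rewrite exchange_big/=; apply: eq_bigr => i _.
  rewrite H0V mulmxA dot_mulmxl -/(c i) dotE mulr_sumr.
  by apply: eq_bigr => j _; rewrite -expr2; ring.
apply: ler_sum => j _; rewrite mE.
under [X in _ <= ln X]eq_bigr do rewrite mulrAC.
apply: ln_jensen => // [i|].
  by rewrite mulr_ge0// sqr_ge0.
by under eq_bigr do rewrite mulrAC; rewrite -mE.
Qed.

End LogDetJensen.

(** * The objective in real coordinates *)

Section DiagonalTraces.
Context {R : realType}.

Lemma mxtrace_diag2 n (d e : 'rV[R]_n) (M N : 'M[R]_n) :
  \tr (diag_mx d *m M *m (diag_mx e *m N)) =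
  \sum_i \sum_j d 0 i * e 0 j * (M i j * N j i).
Proof.
apply: eq_bigr => i _; rewrite mxE; apply: eq_bigr => j _.
by rewrite mul_diag_mx mxE mul_diag_mx mxE mulrACA.
Qed.

End DiagonalTraces.

Section LinearMatrixModel.
Context {R : realType} {n p t : nat}.
Variables (S : 'I_n -> 'M[R]_p) (a : 'I_t -> 'rV[R]_n) (lam mu : R).
Implicit Types (x u : 'rV[R]_n).

Definition pencil x : 'M[R]_p := \sum_k x 0 k *: S k.

Definition hess_mx x : 'M[R]_n :=
  let X := invmx (pencil x) in
  \matrix_(k, l) (\sum_tau a tau 0 k * a tau 0 l / dot (a tau) x ^+ 2
    + lam / 2 * \tr (X *m S k *m (X *m S l))).

(** The weight is [lam / 2] because the determinant of the real representation is the square of that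
    of the Hermitian matrix. *)
Definition log_barrier x : R :=
  - (\sum_tau ln (dot (a tau) x)) - lam / 2 * ln (\det (pencil x)).

Definition vol_barrier x : R := 2^-1 * ln (\det (hess_mx x)).

Definition grad_log x : 'rV[R]_n :=
  let X := invmx (pencil x) in
  \row_k (- (\sum_tau a tau 0 k / dot (a tau) x) - lam / 2 * \tr (X *m S k)).

(** The derivative of the trace part of [hess_mx] is cubic in the inverse pencil. Contracting it
    with [invmx (hess_mx x)] before pairing it with a direction leaves one matrix, common to all
    coordinates of the gradient; this keeps the cost at degree 8 in [d]. *)
Definition vol_weight x : 'M[R]_p :=
  \sum_k \sum_l invmx (hess_mx x) k l *: (S k *m invmx (pencil x) *m S l).

Definition grad_vol x : 'rV[R]_n :=
  let X := invmx (pencil x) in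
  \row_k (- (\sum_tau dot (a tau *m invmx (hess_mx x)) (a tau) * a tau 0 k
                       / dot (a tau) x ^+ 3)
          - lam / 2 * \tr (S k *m (X *m vol_weight x *m X))).

Definition feasible x := posdef (pencil x) /\ forall tau, 0 < dot (a tau) x.

Hypothesis symS : forall k, (S k)^T = S k.
Hypothesis injS : forall u, pencil u = 0 -> u = 0.
Hypotheses (lam0 : 0 < lam).

Lemma pencilD x y : pencil (x + y) = pencil x + pencil y.
Proof.
by rewrite -big_split; apply: eq_bigr => k _; rewrite mxE scalerDl.
Qed.

Lemma pencilZ c x : pencil (c *: x) = c *: pencil x.
Proof.
by rewrite scaler_sumr; apply: eq_bigr => k _; rewrite mxE scalerA.
Qed.

Lemma pencilB x y : pencil (x - y) = pencil x - pencil y.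
Proof. by rewrite pencilD -scaleN1r pencilZ scaleN1r. Qed.

Lemma pencil_sym x : (pencil x)^T = pencil x.
Proof.
by rewrite linear_sum; apply: eq_bigr => k _; rewrite linearZ/= symS.
Qed.

Lemma mul_pencil m q (A : 'M[R]_(m, p)) (B : 'M[R]_(p, q)) x :
  A *m pencil x *m B = \sum_k x 0 k *: (A *m S k *m B).
Proof.
rewrite mulmx_sumr mulmx_suml; apply: eq_bigr => k _.
by rewrite -scalemxAr -scalemxAl.
Qed.

Lemma mxtrace_pencil (M : 'M[R]_p) x :
  \tr (pencil x *m M) = \sum_k \tr (S k *m M) * x 0 k.
Proof.
rewrite mulmx_suml raddf_sum; apply: eq_bigr => k _.
by rewrite -scalemxAl /= mxtraceZ mulrC.
Qed.

Lemma dot_grad_log x u : dot (grad_log x) u =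
  - (\sum_tau dot (a tau) u / dot (a tau) x)
  - lam / 2 * \tr (invmx (pencil x) *m pencil u).
Proof.
rewrite mxtrace_mulC mxtrace_pencil dotE.
under eq_bigr do rewrite mxE mulrBl mulNr mulr_suml -[lam / 2 * _ * _]mulrA (mxtrace_mulC _ (S _)).
rewrite sumrB sumrN -mulr_sumr exchange_big/=; congr (- _ - _).
by apply: eq_bigr => tau _; rewrite (dotE _ u) mulr_suml; apply: eq_bigr => k _; rewrite mulrAC.
Qed.

Lemma dot_grad_vol x u : let X := invmx (pencil x) in dot (grad_vol x) u =
  - (\sum_tau dot (a tau *m invmx (hess_mx x)) (a tau) * dot (a tau) u
       / dot (a tau) x ^+ 3)
  - lam / 2 * \tr (pencil u *m (X *m vol_weight x *m X)).
Proof.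
rewrite /= mxtrace_pencil dotE /grad_vol.
under [LHS]eq_bigr do rewrite mxE mulrBl mulNr mulr_suml -[lam / 2 * _ * _]mulrA.
rewrite sumrB sumrN -mulr_sumr exchange_big/=; congr (- _ - _).
apply: eq_bigr => tau _; rewrite (dotE (a tau) u) mulr_sumr mulr_suml.
by apply: eq_bigr => k _; rewrite mulrAC mulrA.
Qed.

(* [invmx (pencil x) = P^T diag(e) P] turns the Hessian into a sum of
   rank-one matrices. *)
Definition hess_dir (P : 'M[R]_p) (i : 'I_t + 'I_p * 'I_p) : 'rV[R]_n :=
  match i with
  | inl tau => a tau
  | inr ij => \row_k (P *m S k *m P^T) ij.1 ij.2
  end.

Definition hess_wgt x (e : 'rV[R]_p) (i : 'I_t + 'I_p * 'I_p) : R :=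
  match i with
  | inl tau => (dot (a tau) x ^+ 2)^-1
  | inr ij => lam / 2 * (e 0 ij.1 * e 0 ij.2)
  end.

Lemma outerE (v : 'rV[R]_n) k l : (v^T *m v) k l = v 0 k * v 0 l.
Proof. by rewrite mxE big_ord1 mxE. Qed.

Lemma hess_dir_pair P i j k :
  hess_dir P (inr (i, j)) 0 k = (P *m S k *m P^T) i j.
Proof. by rewrite mxE. Qed.

Lemma hess_dir_sym P i j : hess_dir P (inr (i, j)) = hess_dir P (inr (j, i)).
Proof.
apply/rowP => k; rewrite !hess_dir_pair.
have {1}-> : P *m S k *m P^T = (P *m S k *m P^T)^T.
  by rewrite !trmx_mul trmxK symS mulmxA.
by rewrite mxE.
Qed.

Lemma hess_mx_rank1 x P (e : 'rV[R]_p) :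
  invmx (pencil x) = P^T *m diag_mx e *m P ->
  hess_mx x = \sum_i hess_wgt x e i *: ((hess_dir P i)^T *m hess_dir P i).
Proof.
move=> XE; apply/matrixP => k l; rewrite mxE summxE big_sumType; congr (_ + _).
  by apply: eq_bigr => tau _; rewrite [RHS]mxE outerE mulrC.
rewrite XE; set N := fun k => P *m S k *m P^T.
have -> : \tr (P^T *m diag_mx e *m P *m S k *m (P^T *m diag_mx e *m P *m S l)) =
    \tr (diag_mx e *m N k *m (diag_mx e *m N l)).
  by rewrite -!(mulmxA P^T) mxtrace_mulC /N !mulmxA.
rewrite mxtrace_diag2 mulr_sumr; under [LHS]eq_bigr do rewrite mulr_sumr.
rewrite pair_bigA; apply: eq_bigr => -[i j] _.
rewrite [RHS]mxE outerE !hess_dir_pair -/(N k) -/(N l) /= mulrA; congr (_ * (_ * _)).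
have {1}-> : N l = (N l)^T by rewrite !trmx_mul trmxK symS mulmxA.
by rewrite mxE.
Qed.

Lemma dot_sum_rank1 (I : finType) (w : I -> R) (b : I -> 'rV[R]_n) u :
  dot (u *m (\sum_i w i *: ((b i)^T *m b i))) u = \sum_i w i * dot u (b i) ^+ 2.
Proof.
rewrite mulmx_sumr /dot mulmx_suml summxE; apply: eq_bigr => i _.
rewrite -scalemxAr -scalemxAl mxE; congr (_ * _).
rewrite mulmxA -(mulmxA _ (b i)) mxE big_ord1 expr2; congr (_ * _).
by rewrite -/(dot _ _) dotC.
Qed.

Lemma hess_dirE P u i j :
  dot u (hess_dir P (inr (i, j))) = (P *m pencil u *m P^T) i j.
Proof.
by rewrite dotE mul_pencil summxE; apply: eq_bigr => k _; rewrite hess_dir_pair [RHS]mxE.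
Qed.

(** The log-determinant part alone is definite: all its weights are positive, and if every term
    vanishes at [u] then [P *m pencil u *m P^T = 0], hence [pencil u = 0]. *)
Lemma posdef_hess x : feasible x -> posdef (hess_mx x).
Proof.
move=> [pS l0]; have [P [m [[P0 _ _ uP] [XE _ _]]]] := posdef_pair_diag pS pS.
have {}XE : invmx (pencil x) = P^T *m diag_mx (const_mx 1) *m P.
  by rewrite diag_const_mx mulmx1.
have w0 i : 0 < hess_wgt x (const_mx 1) i.
  case: i => [tau|[i j]] /=; first by rewrite invr_gt0 exprn_gt0.
  by rewrite !mxE !mulr1 divr_gt0.
rewrite (hess_mx_rank1 XE); split.
  rewrite linear_sum; apply: eq_bigr => i _.
  by rewrite linearZ/= trmx_mul trmxK.
move=> u u0; rewrite dot_sum_rank1 lt_def sumr_ge0 ?andbT; last first.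
  by move=> i _; rewrite mulr_ge0 ?sqr_ge0// ltW.
apply: contra_neq u0 => e0; apply: injS.
suff N0 : P *m pencil u *m P^T = 0.
  have uPT : P^T \in unitmx by rewrite unitmx_tr.
  by rewrite -[pencil u](mulKmx uP) -[P *m _](mulmxK uPT) N0 mul0mx mulmx0.
apply/matrixP => i j; rewrite -hess_dirE mxE.
have /eqP := e0; rewrite psumr_eq0 => [/allP/(_ (inr (i, j)))|k _].
  rewrite mem_index_enum => /(_ isT); rewrite implyTb mulf_eq0 (gt_eqF (w0 _)) sqrf_eq0.
  by move/eqP.
by rewrite mulr_ge0 ?sqr_ge0// ltW.
Qed.

(** With [m] the eigenvalues of [S(y)] relative to [S(x)], the log-determinants differ by the sum of
    the [ln (m 0 i)], while [\tr (S(x)^-1 S(y - x))] is the sum of the [m 0 i - 1]. The inequality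
    [ln z <= z - 1] compares them, and the losses in the same way. *)
Lemma log_barrier_tangent x y : feasible x -> feasible y ->
  dot (grad_log x) (y - x) <= log_barrier y - log_barrier x.
Proof.
move=> [px lx] [py ly].
have [P [m [[P0 P1 m0 uP] [XE _ dE]]]] := posdef_pair_diag px py.
have hS : ln (\det (pencil y)) - ln (\det (pencil x)) <=
    \tr (invmx (pencil x) *m pencil (y - x)).
  rewrite dE XE -mulmxA mxtrace_mulC pencilB mulmxBr mulmxBl P0 P1.
  rewrite linearB/= mxtrace1 mxtrace_diag -[X in _ - X%:R]card_ord -sumr_const -sumrB.
  by apply: ler_sum => i _; have := ln_le_tangent (m0 i) ltr01; rewrite ln1 add0r divr1.
have hl : \sum_tau ln (dot (a tau) y) - \sum_tau ln (dot (a tau) x) <=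
    \sum_tau dot (a tau) (y - x) / dot (a tau) x.
  rewrite -sumrB; apply: ler_sum => tau _; rewrite lerBlDl.
  rewrite (le_trans (ln_le_tangent (ly tau) (lx tau)))// lerD2l dotDr dotNr.
  by rewrite mulrBl divff// gt_eqF.
rewrite dot_grad_log /log_barrier.
have : 0 <= lam / 2 by rewrite divr_ge0// ltW.
move: hS hl; move: (\sum__ _) (\sum__ _) (\sum__ _) (ln _) (ln _) (\tr _) (lam / 2).
by move=> A B C D E F l h1 h2 l0; have := ler_wpM2l l0 h1; lra.
Qed.

(** The common congruence gives [H(x)] and [H(y)] the same directions [b], with weights [w] and
    [w * r], so [ln_det_jensen] applies. Bounding each [ln (r i)] below by [- y' i], which is linear
    in [y - x], turns the Jensen bound into twice the pairing with [grad_vol x]. *)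
Lemma vol_barrier_tangent x y : feasible x -> feasible y ->
  dot (grad_vol x) (y - x) <= vol_barrier y - vol_barrier x.
Proof.
move=> fx fy; have [px lx] := fx; have [py ly] := fy.
have [P [m [[P0 P1 m0 uP] [XE YE dE]]]] := posdef_pair_diag px py.
have XE' : invmx (pencil x) = P^T *m diag_mx (const_mx 1) *m P.
  by rewrite diag_const_mx mulmx1.
have hx := posdef_hess fx; have hy := posdef_hess fy.
pose w := hess_wgt x (const_mx 1 : 'rV[R]_p); pose b := hess_dir P.
pose r (i : 'I_t + 'I_p * 'I_p) : R := match i with
  | inl tau => (dot (a tau) x / dot (a tau) y) ^+ 2
  | inr ij => (m 0 ij.1 * m 0 ij.2)^-1 end.
have HX : hess_mx x = \sum_i w i *: ((b i)^T *m b i) by exact: hess_mx_rank1.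
have HY : hess_mx y = \sum_i (w i * r i) *: ((b i)^T *m b i).
  rewrite (hess_mx_rank1 YE); apply: eq_bigr => -[tau|[i j]] _; congr (_ *: _) => /=.
    rewrite expr_div_n mulrA mulVf ?mul1r// gt_eqF// exprn_gt0//.
  by rewrite !mxE !mulr1 invfM.
have w0 i : 0 <= w i.
  case: i => [tau|[i j]] /=; first by rewrite invr_ge0 exprn_ge0// ltW.
  by rewrite !mxE !mulr1 divr_ge0// ltW.
have r0 i : 0 < r i.
  case: i => [tau|[i j]] /=; first by rewrite exprn_gt0// divr_gt0.
  by rewrite invr_gt0 mulr_gt0.
have := @ln_det_jensen _ _ _ w r b w0 r0; rewrite -HX -HY => /(_ hx hy) J.
pose Q i := dot (b i *m invmx (hess_mx x)) (b i).
have Q0 i : 0 <= Q i by apply: posdef_ge0; exact: posdef_inv.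
(* The linearization of [- ln (r i)] at [y = x]: the exponent 2 gives the factor 2 for the losses,
   and a product of two eigenvalues gives two summands. *)
pose y' (i : 'I_t + 'I_p * 'I_p) : R := match i with
  | inl tau => 2 * (dot (a tau) (y - x) / dot (a tau) x)
  | inr ij => (m 0 ij.1 - 1) + (m 0 ij.2 - 1) end.
have lnr i : - y' i <= ln (r i).
  have ln1 (z : R) : 0 < z -> ln z <= z - 1.
    by move=> z0; have := ln_le_tangent z0 ltr01; rewrite ln1 add0r divr1.
  case: i => [tau|[i j]] /=.
    rewrite lnXn ?divr_gt0// -(invf_div (dot (a tau) y) (dot (a tau) x)).
    rewrite lnV ?posrE ?divr_gt0// mulNrn lerN2 -[ln _ *+ 2]mulr_natl ler_wpM2l//.
    rewrite (le_trans (ln1 _ (divr_gt0 (ly tau) (lx tau))))// dotDr dotNr mulrBl.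
    by rewrite divff// gt_eqF.
  rewrite lnV ?posrE ?mulr_gt0// lerN2 lnM ?posrE//.
  by rewrite lerD// ln1.
have {}J : - \sum_i w i * y' i * Q i <= ln (\det (hess_mx y)) - ln (\det (hess_mx x)).
  apply: le_trans J; rewrite -sumrN; apply: ler_sum => i _.
  by rewrite -mulNr -mulrN ler_wpM2r// ler_wpM2l.
suff -> : dot (grad_vol x) (y - x) = 2^-1 * (- \sum_i w i * y' i * Q i).
  by rewrite /vol_barrier -mulrBr ler_wpM2l.
rewrite dot_grad_vol big_sumType/= opprD mulrDr; congr (_ + _).
  rewrite mulrN -mulNr mulr_sumr -sumrN; apply: eq_bigr => tau _.
  rewrite /Q /=; set q := dot (_ *m _) _; set z := dot _ (y - x).
  by have := lx tau; move: (dot _ x) => l l0; field; rewrite gt_eqF.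
(* In the diagonalizing coordinates [pencil (y - x)] is [diag_mx (m - const_mx 1)]. *)
have trE : \tr (pencil (y - x) *m (invmx (pencil x) *m vol_weight x *m invmx (pencil x))) =
    \sum_i \sum_j (m 0 i - 1) * Q (inr (i, j)).
  pose N k := P *m S k *m P^T.
  have NE k l : \tr (pencil (y - x) *m (invmx (pencil x) *m (S k *m invmx (pencil x) *m S l) *m invmx (pencil x))) =
      \sum_i \sum_j (m 0 i - 1) * (N k i j * N l i j).
    rewrite XE -!(mulmxA P^T) mulmxA mxtrace_mulC !mulmxA.
    have dE' : P *m pencil (y - x) *m P^T = diag_mx (m - const_mx 1).
      by rewrite pencilB mulmxBr mulmxBl P0 P1 linearB/= diag_const_mx.
    have -> : P *m S k *m P^T *m P *m S l *m P^T *m P *m pencil (y - x) *m P^T =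
        N k *m N l *m (P *m pencil (y - x) *m P^T) by rewrite !mulmxA.
    rewrite mxtrace_mulC dE' mulmxA.
    have := mxtrace_diag2 (m - const_mx 1) (const_mx 1) (N k) (N l).
    rewrite diag_const_mx mul1mx => ->.
    apply: eq_bigr => i _; apply: eq_bigr => j _.
    have -> : (m - const_mx 1) 0 i * (const_mx 1 : 'rV[R]_p) 0 j = m 0 i - 1.
      by rewrite !mxE mulr1.
    congr (_ * (_ * _)).
    have {1}-> : N l = (N l)^T by rewrite !trmx_mul trmxK symS mulmxA.
    by rewrite mxE.
  have -> : \tr (pencil (y - x) *m (invmx (pencil x) *m vol_weight x *m invmx (pencil x))) =
     \sum_k \sum_l invmx (hess_mx x) k l * \sum_i \sum_j (m 0 i - 1) * (N k i j * N l i j).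
    rewrite mulmx_sumr mulmx_suml mulmx_sumr raddf_sum; apply: eq_bigr => k _.
    rewrite mulmx_sumr mulmx_suml mulmx_sumr raddf_sum; apply: eq_bigr => l _.
    by rewrite -scalemxAr -scalemxAl -scalemxAr /= mxtraceZ NE.
  under eq_bigr do under eq_bigr do rewrite mulr_sumr.
  under eq_bigr do rewrite exchange_big.
  rewrite exchange_big/=; apply: eq_bigr => i _.
  under eq_bigr do under eq_bigr do rewrite mulr_sumr.
  under eq_bigr do rewrite exchange_big.
  rewrite exchange_big/=; apply: eq_bigr => j _.
  rewrite /Q dotE mulr_sumr exchange_big/=; apply: eq_bigr => l _.
  rewrite [(_ *m invmx _) 0 l]mxE mulr_suml mulr_sumr; apply: eq_bigr => k _.
  by rewrite [(\row_k0 _) 0 k]mxE [(\row_k0 _) 0 l]mxE -/(N k) -/(N l); ring.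
rewrite trE -[\sum_(i : 'I_p * 'I_p) _](pair_bigA _ (fun i j => w (inr (i, j)) * y' (inr (i, j)) * Q (inr (i, j)))) /=.
(* [Q (inr (i, j))] is symmetric in [i] and [j], so the two summands of [y'] contribute equally, and
   [lam / 2] becomes [lam]. *)
have -> : \sum_i \sum_j w (inr (i, j)) * y' (inr (i, j)) * Q (inr (i, j)) =
    lam * \sum_i \sum_j (m 0 i - 1) * Q (inr (i, j)).
  have -> : \sum_i \sum_j w (inr (i, j)) * y' (inr (i, j)) * Q (inr (i, j)) =
     lam / 2 * (\sum_i \sum_j (m 0 i - 1) * Q (inr (i, j)) +
                \sum_i \sum_j (m 0 j - 1) * Q (inr (i, j))).
    rewrite -big_split mulr_sumr; apply: eq_bigr => i _.
    rewrite -big_split mulr_sumr; apply: eq_bigr => j _ /=.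
    by rewrite !mxE; ring.
  have -> : \sum_i \sum_j (m 0 j - 1) * Q (inr (i, j)) =
            \sum_i \sum_j (m 0 i - 1) * Q (inr (i, j)).
    rewrite exchange_big; apply: eq_bigr => i _; apply: eq_bigr => j _.
    by rewrite /Q /b hess_dir_sym.
  by field.
by field.
Qed.

End LinearMatrixModel.

(** * Real representation of Hermitian matrices *)

Section RealRepresentation.
Context {R : realType}.

Lemma conjCE (x y : R) : Num.conj (x +i* y) = x -i* y.
Proof. by []. Qed.

Lemma ReM (x y : R[i]) :
  complex.Re (x * y) = complex.Re x * complex.Re y - complex.Im x * complex.Im y.
Proof. by case: x y => [a b] [c d]. Qed.

Lemma ImM (x y : R[i]) :
  complex.Im (x * y) = complex.Re x * complex.Im y + complex.Im x * complex.Re y.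
Proof. by case: x y => [a b] [c d]. Qed.

Lemma complex_ext (x y : R[i]) :
  complex.Re x = complex.Re y -> complex.Im x = complex.Im y -> x = y.
Proof. by case: x y => [a b] [c d] /= -> ->. Qed.

Lemma conj_Im0 (z : R[i]) : z = Num.conj z -> complex.Im z = 0.
Proof.
by case: z => a b [] /eqP; rewrite -addr_eq0 -mulr2n mulrn_eq0/= => /eqP.
Qed.

Definition remx m n (M : 'M[R[i]]_(m, n)) := map_mx (@complex.Re R) M.
Definition immx m n (M : 'M[R[i]]_(m, n)) := map_mx (@complex.Im R) M.

Lemma remxM m n q (M : 'M[R[i]]_(m, n)) (N : 'M[R[i]]_(n, q)) :
  remx (M *m N) = remx M *m remx N - immx M *m immx N.
Proof.
apply/matrixP => i j; rewrite !mxE raddf_sum -sumrB; apply: eq_bigr => k _.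
by rewrite !mxE /= ReM.
Qed.

Lemma immxM m n q (M : 'M[R[i]]_(m, n)) (N : 'M[R[i]]_(n, q)) :
  immx (M *m N) = remx M *m immx N + immx M *m remx N.
Proof.
apply/matrixP => i j; rewrite !mxE raddf_sum -big_split; apply: eq_bigr => k _.
by rewrite !mxE /= ImM.
Qed.

Context {d : nat}.
Implicit Types M N : 'M[R[i]]_d.

Definition rep M : 'M[R]_(d + d) :=
  block_mx (remx M) (- immx M) (immx M) (remx M).

Lemma rep_inj M N : rep M = rep N -> M = N.
Proof.
move=> /eq_block_mx[e1 _ e2 _]; apply/matrixP => i j; apply: complex_ext.
  by move/matrixP/(_ i j): e1; rewrite !mxE.
by move/matrixP/(_ i j): e2; rewrite !mxE.
Qed.

Lemma repM M N : rep (M *m N) = rep M *m rep N.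
Proof.
rewrite /rep mulmx_block !remxM !immxM !mulNmx !mulmxN opprD.
by congr block_mx => //; rewrite addrC.
Qed.

Lemma hermitianP M : M \is hermsymmx <-> forall i j, M i j = (M j i)^*.
Proof.
split=> [/is_hermitianmxP|] e.
  by move=> i j; rewrite {1}e expr0 scale1r !mxE.
apply/is_hermitianmxP/matrixP => i j; rewrite expr0 scale1r !mxE.
exact: e.
Qed.

Lemma rep_sym M : M \is hermsymmx -> (rep M)^T = rep M.
Proof.
move=> /hermitianP h; rewrite /rep tr_block_mx.
by congr block_mx; apply/matrixP => i j; rewrite !mxE (h i j); case: (M j i) => ? ? //=; rewrite opprK.
Qed.

Lemma rep_tr M : \tr (rep M) = 2 * complex.Re (\tr M).
Proof.
rewrite /rep mxtrace_block [RHS]mulr_natl mulr2n.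
suff -> : \tr (remx M) = complex.Re (\tr M) by [].
by rewrite raddf_sum; apply: eq_bigr => i _; rewrite mxE.
Qed.

(** Conjugation by a unipotent block matrix with off-diagonal block ['i%:M] makes the representation
    block triangular, with [M] and its entrywise conjugate on the diagonal. *)
Lemma rep_det M : (\det (rep M))%:C = \det M * Num.conj (\det M).
Proof.
pose C := map_mx (real_complex R).
pose A := C _ _ (remx M); pose B := C _ _ (immx M).
have ME : M = A + 'i *: B.
  apply/matrixP => i j; rewrite !mxE; case: (M i j) => a b /=.
  by apply: complex_ext; rewrite /= !(mul0r, mulr0, mul1r, subr0, addr0, add0r).
have MjE : map_mx Num.conj M = A - 'i *: B.
  apply/matrixP => i j; rewrite !mxE; case: (M i j) => a b.
  by rewrite conjCE; apply: complex_ext; rewrite /= !(mul0r, mulr0, mul1r, subr0, addr0, add0r, oppr0).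
have CE : map_mx (real_complex R) (rep M) = block_mx A (- B) B A.
  by rewrite map_block_mx map_mxN.
have -> : (\det (rep M))%:C = \det (map_mx (real_complex R) (rep M)).
  by rewrite det_map_mx.
rewrite CE -det_map_mx MjE ME.
have ii : ('i : R[i]) * 'i = -1 by rewrite -expr2 sqr_i.
have -> : \det (block_mx A (- B) B A) =
    \det (block_mx 1%:M 0 'i%:M 1%:M *m (block_mx A (- B) B A *m
          block_mx 1%:M 0 (- 'i%:M) 1%:M)).
  by rewrite !det_mulmx !det_lblock !det1 !mul1r mulr1.
rewrite !mulmx_block !mulmx1 !mulmx0 !mul1mx !mul0mx !add0r !addr0.
rewrite !mulmxN !mulNmx opprK !mul_mx_scalar !mul_scalar_mx.
rewrite scalerDr !scalerA ii scaleN1r.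
have -> : 'i *: A - B + (B - 'i *: A) = 0.
  by rewrite addrA subrK subrr.
by rewrite det_ublock [- _ + A]addrC.
Qed.

Lemma det_hermitian_real M : M \is hermsymmx -> complex.Im (\det M) = 0.
Proof.
move=> /is_hermitianmxP e.
by apply: conj_Im0; rewrite {1}e expr0 scale1r det_map_mx det_tr.
Qed.

Lemma rep_det_hermitian M : M \is hermsymmx ->
  \det (rep M) = complex.Re (\det M) ^+ 2.
Proof.
move=> h; have := congr1 (@complex.Re R) (rep_det M); rewrite /= => ->.
have := det_hermitian_real h; case: (\det M) => a b /= ->.
by rewrite /= oppr0 mulr0 subr0 expr2.
Qed.

Lemma quad_rep M (v : 'cV[R[i]]_d) :
  let w := row_mx (remx v)^T (immx v)^T in
  complex.Re ((v^t* *m M *m v) 0 0) = dot (w *m rep M) w.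
Proof.
have ReE (N : 'M[R[i]]_1) : complex.Re (N 0 0) = (remx N) 0 0 by rewrite mxE.
have reJ : remx (v^t*) = (remx v)^T.
  by apply/matrixP => i j; rewrite !mxE; case: (v _ _).
have imJ : immx (v^t*) = - (immx v)^T.
  by apply/matrixP => i j; rewrite !mxE; case: (v _ _).
rewrite /= ReE (remxM (v^t* *m M)) remxM immxM reJ imJ mul_row_block dot_row_mx.
have mxB (U V : 'M[R]_1) : (U - V) 0 0 = U 0 0 - V 0 0 by rewrite !mxE.
have mxN (U : 'M[R]_1) : (- U) 0 0 = - U 0 0 by rewrite !mxE.
rewrite /dot !trmxK mxB !mulNmx opprK mulmxN.
set P := _ - (immx v)^T *m remx M.
have -> : - ((remx v)^T *m immx M) + (immx v)^T *m remx M = - P.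
  by rewrite opprB addrC.
by rewrite mulNmx mxN.
Qed.

End RealRepresentation.

(** * Semidefinite real matrices *)

Section Semidefinite.
Context {R : realType}.

Definition semidef {n} (M : 'M[R]_n) :=
  M^T = M /\ forall u : 'rV[R]_n, 0 <= dot (u *m M) u.

Lemma semidef_unit_posdef n (M : 'M[R]_n) :
  semidef M -> M \in unitmx -> posdef M.
Proof.
move=> [sM M0] uM; split=> // u u0; rewrite lt_def M0 andbT.
apply: contra_neq u0 => qu; set v := u *m M.
suff v0 : v = 0 by rewrite -(mulmxK uM u) -/v v0 mul0mx.
apply/eqP; rewrite -dot_eq0; apply: contraT => b0.
have {}b0 : 0 < dot v v by rewrite lt_def b0 dot_ge0.
(* If the form vanishes at [u] but [v = u *m M] does not, then at [u - e *: v] the linear term in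
   [e] outweighs the quadratic one for this [e], and the form is negative. *)
pose e := dot v v / (dot (v *m M) v + 1).
have c1 : 0 < dot (v *m M) v + 1 by rewrite ltr_wpDl.
have := M0 (u - e *: v); rewrite mulmxBl dotDl dotNl !dotDr !dotNr -!scalemxAl !dotZl !dotZr.
rewrite qu (dot_sym v u sM) -/v /e.
move: (dot v v) (dot (v *m M) v) b0 c1 => b c b0 c1.
have -> : 0 - b / (c + 1) * b - (b / (c + 1) * b - b / (c + 1) * (b / (c + 1) * c)) =
   - (b ^+ 2 * (c + 2) / (c + 1) ^+ 2) by field; rewrite gt_eqF.
rewrite oppr_ge0 leNgt divr_gt0// ?exprn_gt0// mulr_gt0// ?exprn_gt0//.
by lra.
Qed.

(** Diagonalizing [M] relative to [invmx S] turns the trace into a sum of nonnegative eigenvalues.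
    This makes the loss of a nonzero announced matrix finite at every positive definite state. *)
Lemma mxtrace_semidef_gt0 n (M S : 'M[R]_n) :
  semidef M -> M != 0 -> posdef S -> 0 < \tr (M *m S).
Proof.
move=> [sM M0] Mn0 pS.
have [P [m [P0 P1]]] := simultaneous_diagonalization (posdef_inv pS) sM.
have [uP SE] := congr1_inv P0; rewrite invmxK in SE.
have m0 j : 0 <= m 0 j by rewrite -(diag_congr_entry j P1).
have -> : \tr (M *m S) = \sum_j m 0 j.
  by rewrite SE mulmxA mxtrace_mulC mulmxA P1 mxtrace_diag.
rewrite lt_def sumr_ge0// andbT; apply: contra_neq Mn0 => /eqP.
rewrite psumr_eq0// => /allP e.
have {}m0 : m = 0.
  by apply/rowP => j; rewrite mxE; apply/eqP; apply: e; exact: mem_index_enum.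
have uPT : P^T \in unitmx by rewrite unitmx_tr.
by rewrite -[M](mulKmx uP) -[P *m _](mulmxK uPT) P1 m0 linear0 mul0mx mulmx0.
Qed.

End Semidefinite.

(** * Orthonormal coordinates on Hermitian matrices *)

Section Coordinates.
Context {R : realType} {d : nat}.
Implicit Types (M A : 'M[R[i]]_d) (x y u : 'rV[R]_(d * d)).

Local Notation sq2 := (Num.sqrt 2 : R).

Let sq2_neq0 : sq2 != 0.
Proof. by rewrite gt_eqF// sqrtr_gt0. Qed.

Let sq2E : sq2 * sq2 = 2.
Proof. by rewrite -expr2 sqr_sqrtr. Qed.

Let sq2K (z : R) : sq2 * z / sq2 = z.
Proof. by rewrite mulrAC divff// mul1r. Qed.

Definition coords M : 'rV[R]_(d * d) := mxvec (\matrix_(i, j)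
  if i == j then complex.Re (M i i)
  else if (i < j)%N then sq2 * complex.Re (M i j) else sq2 * complex.Im (M j i)).

Lemma dot_mxvec (X Y : 'M[R]_d) :
  dot (mxvec X) (mxvec Y) = \sum_i \sum_j X i j * Y i j.
Proof.
rewrite dotE pair_bigA (reindex _ (curry_mxvec_bij _ _)) /=.
by apply: eq_bigr => -[i j] _ /=; rewrite !mxvecE.
Qed.

Lemma herm_hermitian x : herm x \is hermsymmx.
Proof.
apply/hermitianP => i j; rewrite !mxE (eq_sym j i); case: eqVneq => [->|ij].
  by rewrite /= oppr0.
by case: ltngtP => [||/val_inj/eqP] //=; rewrite ?opprK// (negPf ij).
Qed.

Lemma coordsK M : M \is hermsymmx -> herm (coords M) = M.
Proof.
move=> /hermitianP h; apply/matrixP => i j; rewrite mxE mxvecK !mxE eqxx.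
case: eqVneq => [<-|ij].
  by have := conj_Im0 (h i i); case: (M i i) => a b /= ->.
case: ltngtP => [ij'|ij'|/val_inj/eqP].
- by rewrite !sq2K; case: (M i j).
- by rewrite !sq2K [RHS]h; case: (M j i).
- by rewrite (negPf ij).
Qed.

Lemma hermK x : coords (herm x) = x.
Proof.
rewrite -[RHS]vec_mxK; congr mxvec; apply/matrixP => i j; rewrite !mxE eqxx.
rewrite (eq_sym j i); case: eqVneq => [->//|ij].
case: ltngtP => [ij'|ij'|/val_inj/eqP] /=.
- by rewrite mulrCA divff// mulr1.
- by rewrite mulrCA divff// mulr1.
- by rewrite (negPf ij).
Qed.

Lemma hermD x y : herm (x + y) = herm x + herm y.
Proof.
apply/matrixP => i j; rewrite !mxE; case: eqVneq => [_|_].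
  by apply: complex_ext; rewrite /= ?addr0.
by case: ifP => _; apply: complex_ext => /=; rewrite mulrDl// opprD.
Qed.

Lemma hermZ (a : R) x : herm (a *: x) = a%:C *: herm x.
Proof.
apply/matrixP => i j; rewrite !mxE; case: eqVneq => [_|_].
  by apply: complex_ext; rewrite /= ?mul0r ?mulr0 ?subr0 ?addr0.
by case: ifP => _; apply: complex_ext => /=; rewrite !mul0r ?subr0 ?addr0 ?mulrA ?mulrN ?mulrA.
Qed.

(** Real parts are stored above the diagonal and imaginary parts below, so a trace and a pairing of
    coordinates agree only after transposed terms are added. *)
Lemma sum_pair_sym (f g : 'I_d -> 'I_d -> R) :
  (forall i j, f i j + f j i = g i j + g j i) ->
  \sum_i \sum_j f i j = \sum_i \sum_j g i j.
Proof.
move=> fg.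
have dbl (h : 'I_d -> 'I_d -> R) :
    \sum_i \sum_j h i j = 2^-1 * \sum_i \sum_j (h i j + h j i).
  have -> : \sum_i \sum_j (h i j + h j i) = \sum_i \sum_j h i j + \sum_i \sum_j h j i.
    by rewrite -big_split; apply: eq_bigr => i _; rewrite big_split.
  by rewrite [X in _ * (_ + X)]exchange_big/=; field.
rewrite dbl [RHS]dbl; congr (_ * _).
by apply: eq_bigr => i _; apply: eq_bigr => j _; exact: fg.
Qed.

Lemma re_trace_herm A x : A \is hermsymmx ->
  complex.Re (\tr (A *m herm x)) = dot (coords A) x.
Proof.
move=> /hermitianP hA; rewrite -[in RHS](vec_mxK x) dot_mxvec.
rewrite raddf_sum; under eq_bigr do rewrite mxE raddf_sum.
apply: sum_pair_sym => i j; rewrite /= !ReM !mxE (eq_sym j i).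
case: eqVneq => [->|ij] /=; first by rewrite mulr0 subr0.
rewrite (hA j i); case: (A i j) => a b /=.
have hv : sq2^-1 = sq2 / 2.
  by apply: (mulfI sq2_neq0); rewrite mulrA sq2E !divff.
case: ltngtP => [ij'|ij'|/val_inj e] /=; last by rewrite e eqxx in ij.
  by rewrite hv; field.
by rewrite hv; field.
Qed.

Lemma im_trace_hermitian A M : A \is hermsymmx -> M \is hermsymmx ->
  complex.Im (\tr (A *m M)) = 0.
Proof.
move=> /hermitianP hA /hermitianP hM.
apply: conj_Im0.
rewrite /mxtrace rmorph_sum; under [RHS]eq_bigr do rewrite mxE rmorph_sum.
under [LHS]eq_bigr do rewrite mxE.
rewrite [RHS]exchange_big; apply: eq_bigr => i _; apply: eq_bigr => j _.
rewrite (hA i j) (hM j i); case: (A j i) (M i j) => [a b] [a' b'].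
by apply: complex_ext; rewrite /=; ring.
Qed.

Lemma rep_herm_pencil x :
  pencil (fun k => rep (herm (delta_mx 0 k))) x = rep (herm x).
Proof.
have repD M N : rep (M + N) = rep M + rep N.
  rewrite /rep add_block_mx -opprD; congr block_mx; try congr (- _);
  by apply/matrixP => i j; rewrite !mxE raddfD.
have repZ (a : R) M : rep (a%:C *: M) = a *: rep M.
  rewrite /rep scale_block_mx scalerN; congr block_mx; try congr (- _);
  by apply/matrixP => i j; rewrite !mxE; case: (M i j) => ? ? /=; rewrite !mul0r ?subr0 ?addr0.
have rep0 : rep (herm (0 : 'rV[R]_(d * d))) = 0.
  by rewrite -(scale0r (0 : 'rV_(d * d))) hermZ repZ scale0r.
rewrite [in RHS](row_sum_delta x) /pencil.
elim/big_rec2: _ => [|k y1 y2 _ ->]; first by rewrite rep0.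
by rewrite hermD hermZ repD repZ.
Qed.

Lemma psd_rep M : psd M <-> M \is hermsymmx /\ semidef (rep M).
Proof.
split=> [[hM M0]|[hM [_ M0]]]; split=> //.
  split=> [|u]; first exact: rep_sym.
  pose v : 'cV[R[i]]_d := \col_i (lsubmx u 0 i +i* rsubmx u 0 i).
  have uE : u = row_mx (remx v)^T (immx v)^T.
    by rewrite -[LHS]hsubmxK; congr row_mx; apply/rowP => i; rewrite !mxE.
  by rewrite uE -quad_rep; have := M0 v; rewrite lecE => /andP[_].
move=> v; rewrite lecE quad_rep M0 andbT.
suff /conj_Im0 -> : (v^t* *m M *m v) 0 0 = Num.conj ((v^t* *m M *m v) 0 0).
  by [].
have -> : Num.conj ((v^t* *m M *m v) 0 0) = ((v^t* *m M *m v)^t* ) 0 0.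
  by rewrite !mxE.
rewrite !trmx_mul !map_mxM trmxCK mulmxA; congr ((_ *m _ *m _) 0 0).
by have /is_hermitianmxP := hM; rewrite expr0 scale1r.
Qed.

Lemma psd_spectral M : psd M -> exists (U : 'M[R[i]]_d) (D : 'rV[R[i]]_d),
  [/\ U \in unitmx, M = invmx U *m diag_mx D *m U & forall i, 0 <= D 0 i].
Proof.
move=> [hM M0]; have /orthomx_spectralP eM := hermitian_normalmx hM.
exists (spectralmx M), (spectral_diag M); split=> //; first exact: spectral_unit.
move=> i; have := M0 ((row i (spectralmx M))^t*).
have uU := spectral_unitarymx M.
rewrite trmxCK.
suff -> : (row i (spectralmx M) *m M *m (row i (spectralmx M)) ^t*) 0 0 = spectral_diag M 0 i by [].
have -> : row i (spectralmx M) *m M *m (row i (spectralmx M)) ^t* = row i (spectralmx M *m M) *m (row i (spectralmx M)) ^t*.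
  by rewrite row_mul.
have -> : spectralmx M *m M = diag_mx (spectral_diag M) *m spectralmx M.
  by rewrite {2}eM !mulmxA mulmxV ?spectral_unit// mul1mx.
have -> : row i (diag_mx (spectral_diag M) *m spectralmx M) =
    spectral_diag M 0 i *: row i (spectralmx M).
  by rewrite mul_diag_mx; apply/rowP => k; rewrite !mxE.
rewrite -scalemxAl mxE.
have -> : (row i (spectralmx M) *m (row i (spectralmx M)) ^t*) 0 0 = 1.
  have /unitarymxP/matrixP/(_ i i) := uU; rewrite mxE [RHS]mxE eqxx mulr1n => <-.
  by rewrite mxE; apply: eq_bigr => k _; rewrite !mxE.
by rewrite mulr1.
Qed.

Lemma psd_det_ge0 M : psd M -> 0 <= complex.Re (\det M).
Proof.
move=> /psd_spectral[U [D [uU -> D0]]].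
have : 0 <= \det (invmx U *m diag_mx D *m U).
  rewrite !det_mulmx mulrC mulrA -det_mulmx mulmxV// det1 mul1r det_diag.
  by apply: prodr_ge0.
by rewrite lecE => /andP[_].
Qed.

(** The squared norm is the sum of the squared eigenvalues, which are nonnegative and sum to 1. *)
Lemma density_dot_le1 x : density (herm x) -> dot x x <= 1.
Proof.
move=> [pM]; have [U [D [uU eM D0]]] := psd_spectral pM => tr1.
rewrite -{1}(hermK x) -re_trace_herm ?herm_hermitian//.
have D1 : \sum_i D 0 i = 1.
  by rewrite -tr1 eM -mulmxA mxtrace_mulC -mulmxA mulmxV// mulmx1 mxtrace_diag.
have -> : \tr (herm x *m herm x) = \sum_i D 0 i * D 0 i.
  rewrite eM -!mulmxA mxtrace_mulC -!mulmxA mulmxV// mulmx1 (mulmxA U) mulmxV// mul1mx.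
  rewrite mulmx_diag mxtrace_diag.
  by apply: eq_bigr => i _; rewrite mxE.
have : \sum_i D 0 i * D 0 i <= \sum_i D 0 i.
  apply: ler_sum => i _; rewrite ler_piMl// -D1 (bigD1 i)//= lerDl.
  by rewrite sumr_ge0.
by rewrite D1 lecE /= => /andP[_].
Qed.

End Coordinates.

(** * Derivatives *)

Section EntrywiseLimits.
Context {R : realType} {T : Type} {F : set_system T} {FF : Filter F}.

(** Convergence is entrywise and along an arbitrary filter, so that the same rules serve full and
    punctured neighborhoods and neighborhoods within a set. *)
Definition mcvg m n (f : T -> 'M[R]_(m, n)) (L : 'M[R]_(m, n)) :=
  forall i j, f t i j @[t --> F] --> L i j.

Lemma cvg_sumr (I : Type) (r : seq I) (P : pred I) (f : I -> T -> R) (l : I -> R) :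
  (forall i, f i t @[t --> F] --> l i) ->
  \sum_(i <- r | P i) f i t @[t --> F] --> \sum_(i <- r | P i) l i.
Proof.
move=> fl; elim: r => [|i r IH].
  rewrite big_nil; under eq_cvg do rewrite big_nil; exact: cvg_cst.
rewrite big_cons; under eq_cvg do rewrite big_cons.
by case: ifP => // _; apply: cvgD.
Qed.

Lemma cvg_prodr (I : Type) (r : seq I) (P : pred I) (f : I -> T -> R) (l : I -> R) :
  (forall i, f i t @[t --> F] --> l i) ->
  \prod_(i <- r | P i) f i t @[t --> F] --> \prod_(i <- r | P i) l i.
Proof.
move=> fl; elim: r => [|i r IH].
  rewrite big_nil; under eq_cvg do rewrite big_nil; exact: cvg_cst.
rewrite big_cons; under eq_cvg do rewrite big_cons.
by case: ifP => // _; apply: cvgM.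
Qed.

Lemma mcvg_cst m n (L : 'M[R]_(m, n)) : mcvg (fun=> L) L.
Proof. by move=> i j; exact: cvg_cst. Qed.

Lemma mcvgM m n p (f : T -> 'M[R]_(m, n)) (g : T -> 'M[R]_(n, p)) L K :
  mcvg f L -> mcvg g K -> mcvg (fun t => f t *m g t) (L *m K).
Proof.
move=> fL gK i j; rewrite mxE; under eq_cvg do rewrite mxE.
by apply: cvg_sumr => k; apply: cvgM.
Qed.

Lemma mcvgZ m n (a : T -> R) (b : R) (f : T -> 'M[R]_(m, n)) L :
  a t @[t --> F] --> b -> mcvg f L -> mcvg (fun t => a t *: f t) (b *: L).
Proof.
by move=> ab fL i j; rewrite mxE; under eq_cvg do rewrite mxE; apply: cvgM.
Qed.

Lemma mcvg_sum m n (I : finType) (f : I -> T -> 'M[R]_(m, n)) L :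
  (forall i, mcvg (f i) (L i)) -> mcvg (fun t => \sum_i f i t) (\sum_i L i).
Proof.
move=> fL i j; rewrite summxE; under eq_cvg do rewrite summxE.
by apply: cvg_sumr => k; exact: fL.
Qed.

Lemma mcvg_tr n (f : T -> 'M[R]_n) L :
  mcvg f L -> \tr (f t) @[t --> F] --> \tr L.
Proof. by move=> fL; apply: cvg_sumr => k; exact: fL. Qed.

Lemma mcvg_dot n (f g : T -> 'rV[R]_n) L K :
  mcvg f L -> mcvg g K -> dot (f t) (g t) @[t --> F] --> dot L K.
Proof.
move=> fL gK; rewrite dotE; under eq_cvg do rewrite dotE.
by apply: cvg_sumr => k; apply: cvgM.
Qed.

Lemma mcvg_det n (f : T -> 'M[R]_n) L :
  mcvg f L -> \det (f t) @[t --> F] --> \det L.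
Proof.
move=> fL; apply: cvg_sumr => s; apply: cvgMl_tmp.
by apply: cvg_prodr => i; exact: fL.
Qed.

(** Cramer's formula; [invmx] agrees with it only on invertible matrices, hence the eventual
    invertibility. *)
Lemma mcvg_inv n (f : T -> 'M[R]_n) L : mcvg f L -> L \in unitmx ->
  (\forall t \near F, f t \in unitmx) ->
  mcvg (fun t => invmx (f t)) (invmx L).
Proof.
move=> fL uL uf i j; rewrite /invmx uL !mxE.
apply: (@cvg_trans _ (((\det (f t))^-1 * cofactor (f t) j i) @[t --> F])).
  by apply: near_eq_cvg; near do rewrite ifT ?mxE//.
apply: cvgM.
  by apply: cvgV; [rewrite -unitfE -unitmxE | exact: mcvg_det].
apply: cvgMl_tmp; apply: mcvg_det => k l; rewrite !mxE.
by under eq_cvg do rewrite !mxE; exact: fL.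
Unshelve. all: by end_near. Qed.

End EntrywiseLimits.

(** * Continuity and derivatives from tangent inequalities *)

Section TangentSqueeze.
Context {R : realType} {n : nat}.
Variables (dom : 'rV[R]_n -> Prop) (f : 'rV[R]_n -> R) (g : 'rV[R]_n -> 'rV[R]_n).
Hypothesis tangent : forall x y, dom x -> dom y -> dot (g x) (y - x) <= f y - f x.

(** The increment of [f] lies between the pairings of [xs t - x] with [g x] and with [g (xs t)], and
    both tend to 0. *)
Lemma tangent_cvg {T : Type} {F : set_system T} {FF : Filter F}
    (xs : T -> 'rV[R]_n) x : mcvg (F := F) xs x ->
  mcvg (F := F) (fun t => g (xs t)) (g x) -> dom x ->
  (\forall t \near F, dom (xs t)) -> f (xs t) @[t --> F] --> f x.
Proof.
move=> xsx gx dx dxs.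
have d0 : mcvg (F := F) (fun t => xs t - x) 0.
  move=> i j; rewrite -[0](subrr x) !mxE; under eq_cvg do rewrite !mxE.
  by apply: cvgB => //; exact: cvg_cst.
have -> : f x = f x + 0 by rewrite addr0.
have -> : (fun t => f (xs t)) = (fun t => f x + (f (xs t) - f x)).
  by apply/funext => t; rewrite addrCA subrr addr0.
apply: cvgD; first exact: cvg_cst.
apply: (squeeze_cvgr (f := fun t => dot (g x) (xs t - x))
                     (h := fun t => dot (g (xs t)) (xs t - x))).
- near=> t; have dt : dom (xs t) by near: t.
  rewrite tangent//= -lerN2 opprB -dotNr opprB.
  exact: tangent.
- by rewrite -(dot0r (g x)); apply: mcvg_dot => //; exact: mcvg_cst.
- by rewrite -(dot0r (g x)); exact: mcvg_dot.
Unshelve. all: by end_near. Qed.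

Lemma is_derive0_cvg (h : R -> R) (l : R) :
  (s^-1 * (h s - h 0)) @[s --> 0^'] --> l -> is_derive (0 : R) 1 h l.
Proof.
move=> hl; have e : (fun s : R => s^-1 *: ((h \o shift 0) (s *: 1) - h 0)) =
    (fun s => s^-1 * (h s - h 0)).
  by apply/funext => s /=; rewrite addr0 /GRing.scale/= mulr1.
apply: DeriveDef; first by rewrite /derivable e; apply/cvg_ex; exists l.
by rewrite /derive e; apply/cvg_lim.
Qed.

Lemma tangent_derive x u : dom x -> (\forall s \near (0 : R), dom (x + s *: u)) ->
  mcvg (F := (0 : R)^') (fun s => g (x + s *: u)) (g x) ->
  is_derive (0 : R) 1 (fun s : R => f (x + s *: u)) (dot (g x) u).
Proof.
move=> dx ds gs; apply: is_derive0_cvg; apply/cvgrPdist_le => e e0.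
have ge : dot (g (x + s *: u)) u @[s --> (0 : R)^'] --> dot (g x) u.
  by apply: mcvg_dot => //; exact: mcvg_cst.
move/cvgrPdist_le/(_ _ e0): ge => ge.
have ds' : \forall s \near (0 : R)^', dom (x + s *: u) by exact: nbhs_dnbhs.
near=> s; have dxs : dom (x + s *: u) by near: s.
have s0 : s != 0 by near: s; exact: nbhs_dnbhs_neq.
apply: (@le_trans _ _ `|dot (g x) u - dot (g (x + s *: u)) u|); last by near: s.
rewrite scale0r addr0.
have h1 := tangent dx dxs; have := tangent dxs dx.
rewrite opprD addrA addrN sub0r dotNr -opprB lerN2 dotZr => h2.
move: h1; rewrite [x + _]addrC addrK dotZr => h1.
rewrite [x + _]addrC in h2 *.
set q := f (s *: u + x) - f x in h1 h2 *.
set b := dot (g (s *: u + x)) u in h1 h2 *; set a := dot (g x) u in h1 h2 *.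
move: s0; rewrite neq_lt => /orP[s0|s0].
  have q1 : b <= s^-1 * q by rewrite mulrC ler_ndivlMr// mulrC.
  have q2 : s^-1 * q <= a by rewrite mulrC ler_ndivrMr// mulrC.
  by rewrite !ger0_norm ?subr_ge0// ?(le_trans q1)// lerD2l lerN2.
have q1 : a <= s^-1 * q by rewrite mulrC ler_pdivlMr// mulrC.
have q2 : s^-1 * q <= b by rewrite mulrC ler_pdivrMr// mulrC.
by rewrite !ler0_norm ?subr_le0// ?(le_trans q1)// lerN2 lerD2l lerN2.
Unshelve. all: by end_near. Qed.

End TangentSqueeze.

Lemma cvg_affine0 (R : realType) (b c : R) : b + s * c @[s --> (0 : R)] --> b.
Proof.
have {2}-> : b = b + 0 * c by rewrite mul0r addr0.
by apply: cvgD; [exact: cvg_cst | apply: cvgMr_tmp; exact: cvg_id].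
Qed.

Section ModelLimits.
Context {R : realType} {n p t : nat}.
Variables (S : 'I_n -> 'M[R]_p) (a : 'I_t -> 'rV[R]_n) (lam mu : R).
Hypothesis symS : forall k, (S k)^T = S k.
Hypothesis injS : forall u, pencil S u = 0 -> u = 0.
Hypothesis lam0 : 0 < lam.

Section Limits.
Context {T : Type} {F : set_system T} {FF : Filter F}.
Variables (xs : T -> 'rV[R]_n) (x : 'rV[R]_n).
Hypotheses (xsx : mcvg (F := F) xs x) (fx : feasible S a x).
Hypothesis fxs : \forall t \near F, feasible S a (xs t).

Local Notation mcvg := (mcvg (F := F)).

Lemma mcvg_pencil : mcvg (fun t => pencil S (xs t)) (pencil S x).
Proof.
by apply: mcvg_sum => k; apply: mcvgZ; [exact: xsx | exact: mcvg_cst].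
Qed.

Lemma mcvg_pencil_inv : mcvg (fun t => invmx (pencil S (xs t))) (invmx (pencil S x)).
Proof.
apply: mcvg_inv; first exact: mcvg_pencil.
  by apply: posdef_unit; exact: fx.1.
by apply: filterS fxs => y [py _]; exact: posdef_unit.
Qed.

Lemma cvg_dot_inv (b : R) (c : T -> R) tau k :
  c t @[t --> F] --> b ->
  c t / dot (a tau) (xs t) ^+ k @[t --> F] --> b / dot (a tau) x ^+ k.
Proof.
move=> cb; apply: cvgM => //.
have := fx.2 tau => l0; apply: cvgV; first by rewrite expf_neq0// gt_eqF.
elim: k => [|k IH]; first by rewrite expr0; under eq_cvg do rewrite expr0; exact: cvg_cst.
rewrite exprS; under eq_cvg do rewrite exprS; apply: cvgM => //.
by apply: mcvg_dot => //; exact: mcvg_cst.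
Qed.

Lemma mcvg_hess : mcvg (fun t => hess_mx S a lam (xs t)) (hess_mx S a lam x).
Proof.
move=> k l; rewrite mxE; under eq_cvg do rewrite mxE.
apply: cvgD.
  by apply: cvg_sumr => tau; apply: cvg_dot_inv; exact: cvg_cst.
apply: cvgMl_tmp; apply: mcvg_tr.
by apply: mcvgM; (apply: mcvgM; [exact: mcvg_pencil_inv | exact: mcvg_cst]).
Qed.

Lemma mcvg_hess_inv :
  mcvg (fun t => invmx (hess_mx S a lam (xs t))) (invmx (hess_mx S a lam x)).
Proof.
apply: mcvg_inv; first exact: mcvg_hess.
  by apply: posdef_unit; exact: posdef_hess.
by apply: filterS fxs => y fy; apply: posdef_unit; exact: posdef_hess.
Qed.

Lemma mcvg_grad_log : mcvg (fun t => grad_log S a lam (xs t)) (grad_log S a lam x).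
Proof.
move=> i k; rewrite mxE; under eq_cvg do rewrite mxE.
apply: cvgB; first apply: cvgN.
  apply: cvg_sumr => tau; rewrite -[dot _ x]expr1.
  under eq_cvg do rewrite -[dot _ (xs _)]expr1.
  by apply: cvg_dot_inv; exact: cvg_cst.
apply: cvgMl_tmp; apply: mcvg_tr.
by apply: mcvgM; [exact: mcvg_pencil_inv | exact: mcvg_cst].
Qed.

Lemma mcvg_vol_weight : mcvg (fun t => vol_weight S a lam (xs t)) (vol_weight S a lam x).
Proof.
apply: mcvg_sum => k; apply: mcvg_sum => l; apply: mcvgZ.
  exact: mcvg_hess_inv.
apply: mcvgM; last exact: mcvg_cst.
by apply: mcvgM; [exact: mcvg_cst | exact: mcvg_pencil_inv].
Qed.

Lemma mcvg_grad_vol : mcvg (fun t => grad_vol S a lam (xs t)) (grad_vol S a lam x).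
Proof.
move=> i k; rewrite mxE; under eq_cvg do rewrite mxE.
apply: cvgB; first apply: cvgN.
  apply: cvg_sumr => tau; apply: cvg_dot_inv; apply: cvgMr_tmp.
  apply: mcvg_dot; last exact: mcvg_cst.
  by apply: mcvgM; [exact: mcvg_cst | exact: mcvg_hess_inv].
apply: cvgMl_tmp; apply: mcvg_tr; apply: mcvgM; first exact: mcvg_cst.
apply: mcvgM; last exact: mcvg_pencil_inv.
by apply: mcvgM; [exact: mcvg_pencil_inv | exact: mcvg_vol_weight].
Qed.

End Limits.

(** Diagonalizing [S(u)] relative to [S(x)] makes [S(x + s u)] congruent to the diagonal matrix with
    entries [1 + s * m 0 i], which are positive for small [s]. *)
Lemma feasible_near x u : feasible S a x ->
  \forall s \near (0 : R), feasible S a (x + s *: u).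
Proof.
move=> [px lx]; have [P [m [P0 P1]]] := simultaneous_diagonalization px (pencil_sym symS u).
have [uP _] : P \in unitmx /\ (pencil S x *m P^T) \in unitmx.
  by apply: mulmx1_unit; rewrite mulmxA.
have near_pos (b c : R) : 0 < b -> \forall s \near (0 : R), 0 < b + s * c.
  by move=> b0; have /cvgr_gt/(_ _ b0) := @cvg_affine0 R b c.
have near_all (I : finType) (b c : I -> R) : (forall i, 0 < b i) ->
    \forall s \near (0 : R), forall i, 0 < b i + s * c i.
  move=> b0; refine (@filter_forall R I (fun i s => 0 < b i + s * c i) _ (nbhs_filter (0 : R)) _) => i.
  exact: near_pos.
have n1 := near_all _ (fun=> 1) (fun i => m 0 i) (fun=> ltr01).
have n2 := near_all _ _ (fun tau => dot (a tau) u) lx.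
near=> s.
have ls : forall tau, 0 < dot (a tau) x + s * dot (a tau) u by near: s.
split; last by move=> tau; rewrite dotDr dotZr.
have m0 : forall i, 0 < 1 + s * m 0 i by near: s.
have -> : pencil S (x + s *: u) =
    invmx P *m diag_mx (const_mx 1 + s *: m) *m (invmx P)^T.
  rewrite linearD linearZ/= -P1 diag_const_mx -P0 pencilD pencilZ.
  have cong M : invmx P *m (P *m M *m P^T) *m invmx P^T = M.
    by rewrite -(mulmxA P) mulKmx// mulmxK ?unitmx_tr.
  by rewrite trmx_inv mulmxDr mulmxDl -scalemxAr -scalemxAl !cong.
apply: posdef_congr; last by rewrite row_free_unit unitmx_inv.
split; first by rewrite tr_diag_mx.
move=> v v0; rewrite mul_mx_diag dotE.
under eq_bigr do rewrite !mxE mulrAC -expr2.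
rewrite lt_def sumr_ge0 ?andbT; last first.
  by move=> i _; rewrite mulr_ge0 ?sqr_ge0// ltW.
apply: contra_neq v0 => /eqP; rewrite psumr_eq0; last first.
  by move=> i _; rewrite mulr_ge0 ?sqr_ge0// ltW.
move=> /allP e; apply/rowP => i; rewrite mxE; apply/eqP.
have := e i (mem_index_enum _); rewrite implyTb mulf_eq0 sqrf_eq0 => /orP[//|].
by rewrite gt_eqF.
Unshelve. all: by end_near. Qed.

Lemma mcvg_line (x u : 'rV[R]_n) : mcvg (F := (0 : R)^') (fun s => x + s *: u) x.
Proof.
move=> i j; under eq_cvg do rewrite !mxE.
by apply: cvg_within_filter; exact: cvg_affine0.
Qed.

Lemma feasible_line x u : feasible S a x ->
  \forall s \near (0 : R)^', feasible S a (x + s *: u).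
Proof. by move=> fx; apply: nbhs_dnbhs; exact: feasible_near. Qed.

Lemma dot_suml (I : finType) (f : I -> 'rV[R]_n) (u : 'rV[R]_n) :
  dot (\sum_i f i) u = \sum_i dot (f i) u.
Proof. by rewrite /dot mulmx_suml summxE. Qed.

Lemma is_derive_log_barrier x u : feasible S a x ->
  is_derive (0 : R) 1 (fun s : R => log_barrier S a lam (x + s *: u))
    (dot (grad_log S a lam x) u).
Proof.
move=> fx; apply: (tangent_derive (@log_barrier_tangent _ _ _ _ S a lam lam0)) => //.
  exact: feasible_near.
by apply: mcvg_grad_log => //; [exact: mcvg_line | exact: feasible_line].
Qed.

Lemma is_derive_vol_barrier x u : feasible S a x ->
  is_derive (0 : R) 1 (fun s : R => vol_barrier S a lam (x + s *: u))
    (dot (grad_vol S a lam x) u).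
Proof.
move=> fx; apply: (tangent_derive (vol_barrier_tangent symS injS lam0)) => //.
  exact: feasible_near.
by apply: mcvg_grad_vol => //; [exact: mcvg_line | exact: feasible_line].
Qed.

Lemma dot_hess_mx x u v : dot (v *m hess_mx S a lam x) u =
  \sum_tau dot (a tau) u * dot (a tau) v / dot (a tau) x ^+ 2
  + lam / 2 * \tr (invmx (pencil S x) *m pencil S v *m
                   (invmx (pencil S x) *m pencil S u)).
Proof.
have -> : hess_mx S a lam x =
    \sum_tau (dot (a tau) x ^+ 2)^-1 *: ((a tau)^T *m a tau) +
    \matrix_(k, l) (lam / 2 * \tr (invmx (pencil S x) *m S k *m (invmx (pencil S x) *m S l))).
  apply/matrixP => k l; rewrite !mxE summxE; congr (_ + _).
  by apply: eq_bigr => tau _; rewrite [RHS]mxE outerE mulrC.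
rewrite mulmxDr dotDl; congr (_ + _).
  rewrite mulmx_sumr dot_suml; apply: eq_bigr => tau _.
  rewrite -scalemxAr dotZl mulmxA; have -> : v *m (a tau)^T = (dot (a tau) v)%:M.
    by rewrite dotC; apply/matrixP => i j; rewrite !ord1 [RHS]mxE eqxx mulr1n.
  by rewrite mul_scalar_mx dotZl mulrC (mulrC (dot _ v)).
rewrite dotE; set X := invmx _.
have -> : X *m pencil S v *m (X *m pencil S u) =
    \sum_k \sum_l (v 0 k * u 0 l) *: (X *m S k *m (X *m S l)).
  rewrite mul_pencil; apply: eq_bigr => k _.
  rewrite mulmxA -[_ *m pencil S u]mulmx1 mul_pencil scaler_sumr.
  by apply: eq_bigr => l _; rewrite mulmx1 scalerA -mulmxA.
rewrite raddf_sum mulr_sumr; under [LHS]eq_bigr do rewrite mxE mulr_suml.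
rewrite exchange_big; apply: eq_bigr => k _ /=.
rewrite raddf_sum mulr_sumr; apply: eq_bigr => l _ /=.
by rewrite mxtraceZ mxE; ring.
Qed.

(** The resolvent identity [X s - X 0 = - s (X s) S(v) (X 0)] makes the difference quotient equal to
    the explicit expression [q s] for [s != 0], so only the continuity of the inverse is
    required. *)
Lemma is_derive_grad_log x u v : feasible S a x ->
  is_derive (0 : R) 1 (fun s : R => dot (grad_log S a lam (x + s *: v)) u)
    (dot (v *m hess_mx S a lam x) u).
Proof.
move=> fx; apply: is_derive0_cvg.
pose X s := invmx (pencil S (x + s *: v)).
pose q (s : R) := \sum_tau dot (a tau) u * dot (a tau) v / dot (a tau) x
    / dot (a tau) (x + s *: v) ^+ 1
  + lam / 2 * \tr (X s *m pencil S v *m (invmx (pencil S x) *m pencil S u)).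
have fl := feasible_line v fx.
apply: (@cvg_trans _ (q s @[s --> (0 : R)^'])).
  apply: near_eq_cvg; near=> s.
  have fs : feasible S a (x + s *: v) by near: s.
  have s0 : s != 0 by near: s; exact: nbhs_dnbhs_neq.
  rewrite scale0r addr0 !dot_grad_log -/(X s) /q.
  have XE : X s - invmx (pencil S x) = - (s *: (X s *m pencil S v *m invmx (pencil S x))).
    have us := posdef_unit fs.1; have ux := posdef_unit fx.1.
    rewrite -[X s in LHS](mulmxK ux) -[X in _ - X]mul1mx -(mulVmx us) -mulmxBl -/(X s).
    rewrite -mulmxBr -pencilB opprD addrA addrN sub0r -scaleN1r scalerA pencilZ.
    by rewrite -scalemxAr -scalemxAl mulN1r scaleNr.
  have trE : \tr (X s *m pencil S u) - \tr (invmx (pencil S x) *m pencil S u) =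
      - (s * \tr (X s *m pencil S v *m (invmx (pencil S x) *m pencil S u))).
    rewrite -linearB/= -mulmxBl XE mulNmx linearN/= -scalemxAl mxtraceZ.
    by rewrite -!mulmxA.
  have sE : \sum_tau dot (a tau) u / dot (a tau) (x + s *: v) -
      \sum_tau dot (a tau) u / dot (a tau) x =
      - (s * \sum_tau dot (a tau) u * dot (a tau) v / dot (a tau) x /
               dot (a tau) (x + s *: v) ^+ 1).
    rewrite mulr_sumr -sumrB -sumrN; apply: eq_bigr => tau _.
    have := fs.2 tau; have := fx.2 tau; rewrite expr1 dotDr dotZr.
    move: (dot _ x) (dot _ v) (dot _ u) => l b c l0 ls.
    by field; rewrite !gt_eqF.
  apply: (mulfI s0); rewrite mulVKf// mulrDr.
  move: trE sE; set A := \tr (X s *m pencil S v *m _); set B := \tr (X s *m _).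
  set C := \tr (_ *m _); set D := \sum_tau _; set E := \sum_tau _.
  set G := \sum_tau _ => trE sE.
  have -> : - D - lam / 2 * B - (- E - lam / 2 * C) = - (D - E) - lam / 2 * (B - C).
    by ring.
  by rewrite trE sE; ring.
rewrite dot_hess_mx /q; apply: cvgD.
  apply: cvg_sumr => tau; rewrite expr2 invfM mulrA.
  rewrite -[X in _ / _ / X]expr1.
  by apply: cvg_dot_inv => //; [exact: mcvg_line | exact: cvg_cst].
apply: cvgMl_tmp; apply: mcvg_tr; apply: mcvgM; last exact: mcvg_cst.
apply: mcvgM; last exact: mcvg_cst.
by apply: mcvg_pencil_inv => //; exact: mcvg_line.
Unshelve. all: by end_near. Qed.

End ModelLimits.

(** * The objective on Hermitian matrices *)

Section HermitianModel.
Context {R : realType} {d : nat}.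
Implicit Types (x u v : 'rV[R]_(d * d)).

Definition herm_basis (k : 'I_(d * d)) : 'M[R]_(d + d) :=
  rep (herm (delta_mx 0 k : 'rV[R]_(d * d))).

Lemma herm_basis_sym k : (herm_basis k)^T = herm_basis k.
Proof. exact/rep_sym/herm_hermitian. Qed.

Lemma pencil_herm x : pencil herm_basis x = rep (herm x).
Proof. exact: rep_herm_pencil. Qed.

Lemma herm0 : herm (0 : 'rV[R]_(d * d)) = 0 :> 'M[R[i]]_d.
Proof. by rewrite -(scale0r (0 : 'rV[R]_(d * d))) hermZ scale0r. Qed.

Lemma rep0 : rep (0 : 'M[R[i]]_d) = 0.
Proof.
have z : remx (0 : 'M[R[i]]_d) = 0 by apply/matrixP => i j; rewrite !mxE.
have z' : immx (0 : 'M[R[i]]_d) = 0 by apply/matrixP => i j; rewrite !mxE.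
by rewrite /rep z z' oppr0 block_mx0.
Qed.

Lemma herm_basis_inj x : pencil herm_basis x = 0 -> x = 0.
Proof.
rewrite pencil_herm => e.
have : herm x = 0 by apply: rep_inj; rewrite e rep0.
by rewrite -herm0 => /(congr1 coords); rewrite !hermK.
Qed.

Lemma vec_dot x y :
  ((vec (herm x))^t* *m vec (herm y)) 0 0 = (dot x y)%:C :> R[i].
Proof.
have hx := herm_hermitian x; have hy := herm_hermitian y.
have -> : ((vec (herm x))^t* *m vec (herm y)) 0 0 = \tr (herm x *m herm y).
  move: (herm x) (herm y) hx => M N hM.
  rewrite mxE (reindex _ (curry_mxvec_bij _ _)) /=.
  rewrite /mxtrace; under [RHS]eq_bigr do rewrite mxE.
  rewrite pair_bigA; apply: eq_bigr => -[i j] _ /=.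
  by have /hermitianP/(_ i j) -> := hM; rewrite /vec !mxE !mxvecE !mxE.
apply: complex_ext; last exact: im_trace_hermitian.
by rewrite re_trace_herm// hermK.
Qed.

Definition basis_mx : 'M[R[i]]_(d * d) :=
  \matrix_(r, k) vec (herm (delta_mx 0 k : 'rV[R]_(d * d))) r 0.

Local Notation toC := (map_mx (real_complex R)).

Lemma vec_hermE x : vec (herm x) = basis_mx *m toC x^T.
Proof.
have vecD (M N : 'M[R[i]]_d) : vec (M + N) = vec M + vec N.
  by rewrite /vec !linearD.
have vecZ (a : R[i]) (M : 'M[R[i]]_d) : vec (a *: M) = a *: vec M.
  by rewrite /vec !linearZ.
have -> : herm x = \sum_k (x 0 k)%:C *: herm (delta_mx 0 k : 'rV[R]_(d * d)).
  rewrite [in LHS](row_sum_delta x).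
  by elim/big_rec2: _ => [|k y1 y2 _ <-]; rewrite ?herm0// hermD hermZ.
apply/colP => r; rewrite [RHS]mxE.
have -> : vec (\sum_k (x 0 k)%:C *: herm (delta_mx 0 k : 'rV[R]_(d * d))) =
    \sum_k (x 0 k)%:C *: vec (herm (delta_mx 0 k : 'rV[R]_(d * d))).
  elim/big_rec2: _ => [|k y1 y2 _ <-]; last by rewrite vecD vecZ.
  by rewrite -(scale0r (0 : 'M[R[i]]_d)) vecZ scale0r.
rewrite summxE; apply: eq_bigr => k _; rewrite mxE mulrC; congr (_ * _).
  by rewrite [RHS]mxE.
by rewrite !mxE.
Qed.

Lemma basis_mx_unitary : basis_mx^t* *m basis_mx = 1%:M.
Proof.
apply/matrixP => k l; rewrite [RHS]mxE.
have -> : (basis_mx^t* *m basis_mx) k l =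
    ((vec (herm (delta_mx 0 k : 'rV[R]_(d * d))))^t* *m vec (herm (delta_mx 0 l))) 0 0.
  by rewrite !mxE; apply: eq_bigr => r _; rewrite !mxE.
by rewrite vec_dot dot_delta mxE eqxx /= eq_sym; case: eqP.
Qed.

(** As [hessian] is a choice, existence and uniqueness are both proved. The vectorized basis
    matrices form a unitary matrix, so the real matrix [H] transports to a solution, and testing any
    solution on the basis recovers [H]. *)
Lemma hessian_herm (F : 'M[R[i]]_d -> R) rho (H : 'M[R]_(d * d)) :
  (forall v u, D2 F rho (herm v) (herm u) = dot (v *m H) u) ->
  hessian F rho = basis_mx *m toC H *m basis_mx^t*.
Proof.
move=> FH.
have quad (K : 'M[R[i]]_(d * d)) v u :
    (vec (herm v))^t* *m K *m vec (herm u) =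
    toC v *m (basis_mx^t* *m K *m basis_mx) *m toC u^T.
  rewrite !vec_hermE trmx_mul map_mxM.
  have -> : (toC v^T)^t* = toC v.
    by apply/matrixP => i j; rewrite !mxE; exact: conjc_real.
  by rewrite !mulmxA.
have dotC (M : 'M[R]_(d * d)) v u : (dot (v *m M) u)%:C = (toC v *m toC M *m toC u^T) 0 0.
  by rewrite -!map_mxM mxE.
apply: xget_unique => [V U hV hU|K HK].
  rewrite -(coordsK hV) -(coordsK hU) FH quad dotC.
  suff -> : basis_mx^t* *m (basis_mx *m toC H *m basis_mx^t*) *m basis_mx = toC H by [].
  by rewrite !mulmxA basis_mx_unitary mul1mx -mulmxA basis_mx_unitary mulmx1.
suff <- : basis_mx^t* *m K *m basis_mx = toC H.
  rewrite !mulmxA (mulmx1C basis_mx_unitary) mul1mx -mulmxA.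
  by rewrite (mulmx1C basis_mx_unitary) mulmx1.
apply/matrixP => k l.
have := HK _ _ (herm_hermitian (delta_mx 0 k)) (herm_hermitian (delta_mx 0 l)).
rewrite FH quad dotC.
have dE (M : 'M[R[i]]_(d * d)) : (toC (delta_mx 0 k : 'rV[R]_(d * d)) *m M *m
    toC (delta_mx 0 l : 'rV[R]_(d * d))^T) 0 0 = M k l.
  by rewrite trmx_delta !map_delta_mx -rowE -colE !mxE.
by rewrite !dE => ->.
Qed.

Lemma det_hessian_herm (F : 'M[R[i]]_d -> R) rho (H : 'M[R]_(d * d)) :
  (forall v u, D2 F rho (herm v) (herm u) = dot (v *m H) u) ->
  complex.Re (\det (hessian F rho)) = \det H.
Proof.
move=> /hessian_herm ->; rewrite !det_mulmx mulrC mulrA -det_mulmx.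
by rewrite basis_mx_unitary det1 mul1r det_map_mx.
Qed.

End HermitianModel.

(** * The extended-real objective and its gradient *)

Section Objective.
Context {R : realType} {d : nat}.
Variables (lam mu : R) (A : nat -> 'M[R[i]]_d) (t : nat).
Hypotheses (d0 : (0 < d)%N) (lam0 : 0 < lam) (mu0 : 0 < mu).
Hypothesis psdA : forall tau, (tau < t)%N -> psd (A tau).
Implicit Types (x u v : 'rV[R]_(d * d)).

Definition loss_coords (tau : 'I_t) : 'rV[R]_(d * d) := coords (A tau).

Local Notation S := (@herm_basis R d).
Local Notation a := loss_coords.
Local Notation feas := (feasible S a).

Definition objective x : R := log_barrier S a lam x + mu * vol_barrier S a lam x.

Definition grad_objective x := grad_log S a lam x + mu *: grad_vol S a lam x.

Lemma re_loss (tau : 'I_t) x :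
  complex.Re (\tr (A tau *m herm x)) = dot (a tau) x.
Proof. by rewrite re_trace_herm//; have [] := psdA (ltn_ord tau). Qed.

Lemma posdef_det_herm x : posdef (pencil S x) ->
  0 < complex.Re (\det (herm x)) /\
  \det (pencil S x) = complex.Re (\det (herm x)) ^+ 2.
Proof.
move=> pS; have hx := herm_hermitian x.
have dE : \det (pencil S x) = complex.Re (\det (herm x)) ^+ 2.
  by rewrite pencil_herm rep_det_hermitian.
split=> //; have := posdef_det_gt0 pS; rewrite dE.
have : 0 <= complex.Re (\det (herm x)).
  apply: psd_det_ge0; apply/psd_rep; split=> //; rewrite -pencil_herm.
  by split; [exact: pS.1 | move=> w; exact: posdef_ge0].
by rewrite le_eqVlt => /predU1P[<-|//]; rewrite expr0n ltxx.
Qed.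

Lemma Lt_feasible x : feas x -> Lt lam A t (herm x) = (log_barrier S a lam x)%:E.
Proof.
move=> [pS l0]; have [D0 DE] := posdef_det_herm pS.
rewrite /Lt /log_barrier DE lne_EFin// lnXn//.
have -> : (\sum_(tau < t) loss (A tau) (herm x))%E =
    (- \sum_tau ln (dot (a tau) x))%:E.
  rewrite -sumrN -sumEFin; apply: eq_bigr => tau _.
  by rewrite /loss re_loss lne_EFin.
by rewrite -EFinM -EFinB; congr (_%:E); rewrite -mulr_natr; field.
Qed.

Lemma loss_neqNy (tau : 'I_t) rho : loss (A tau) rho != -oo%E.
Proof. by rewrite /loss /lne; case: ifP. Qed.

Lemma sum_loss_neqNy rho : (\sum_(tau < t) loss (A tau) rho)%E != -oo%E.
Proof.
elim/big_ind: _ => // [x y x0 y0|tau _]; last exact: loss_neqNy.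
by rewrite adde_eq_ninfty negb_or x0.
Qed.

(** A semidefinite representation that is not positive definite is singular, so the log-determinant
    term is [+oo]; no loss is [-oo], so the sum is [+oo] too. *)
Lemma Lt_singular x : density (herm x) -> ~ posdef (pencil S x) ->
  Lt lam A t (herm x) = +oo%E.
Proof.
move=> [pM _] npS; have [hM sM] := (psd_rep _).1 pM.
have D0 : complex.Re (\det (herm x)) = 0.
  apply/eqP/negPn/negP => D0; apply: npS; rewrite pencil_herm.
  apply: semidef_unit_posdef => //.
  by rewrite unitmxE unitfE rep_det_hermitian// expf_neq0.
rewrite /Lt D0 le0_lneNy// gt0_muleNy ?lte_fin//= addey//.
exact: sum_loss_neqNy.
Qed.

Lemma Lt_zero_loss (tau : 'I_t) rho : A tau = 0 -> Lt lam A t rho = +oo%E.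
Proof.
move=> A0; rewrite /Lt; have -> : (\sum_(tau < t) loss (A tau) rho)%E = +oo%E.
  apply/eqP; rewrite esum_eqy => [|tau' _]; last exact: loss_neqNy.
  by apply/existsP; exists tau; rewrite /loss A0 mul0mx mxtrace0 /= lexx.
rewrite addye// /lne; case: ifP => _; first by rewrite gt0_muleNy ?lte_fin.
by rewrite -EFinM.
Qed.

(** The iterated derivative looks at [Lt] only near [herm x] along Hermitian directions, where
    feasibility persists: the inner derivative is [grad_log] there, and the outer one its
    derivative. *)
Lemma D2_Lt x v u : feas x ->
  D2 (fun X => fine (Lt lam A t X)) (herm x) (herm v) (herm u) =
  dot (v *m hess_mx S a lam x) u.
Proof.
move=> fx; rewrite /D2 derive1E.
have inner y : feas y ->
    derive1 (fun r : R => fine (Lt lam A t (herm y + r%:C *: herm u))) 0 =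
    dot (grad_log S a lam y) u.
  move=> fy; rewrite derive1E.
  have dy := is_derive_log_barrier herm_basis_sym lam0 u fy.
  rewrite -(@derive_val _ _ _ _ _ _ _ dy); apply: near_eq_derive.
  have := feasible_near herm_basis_sym u fy; apply: filterS => r fr.
  by rewrite -hermZ -hermD Lt_feasible.
have dx := is_derive_grad_log lam herm_basis_sym u v fx.
rewrite -(@derive_val _ _ _ _ _ _ _ dx); apply: near_eq_derive.
have := feasible_near herm_basis_sym v fx; apply: filterS => s fs.
by rewrite -hermZ -hermD inner.
Qed.

Lemma Vt_feasible x : feas x -> Vt lam A t (herm x) = vol_barrier S a lam x.
Proof.
move=> fx; rewrite /Vt /vol_barrier (@det_hessian_herm _ _ _ _ (hess_mx S a lam x))//.
by move=> v u; rewrite D2_Lt.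
Qed.

Lemma Pt_feasible x : feas x -> Pt lam mu A t (herm x) = (objective x)%:E.
Proof. by move=> fx; rewrite /Pt Lt_feasible// Vt_feasible// -EFinD. Qed.

Lemma objective_tangent x y : feas x -> feas y ->
  dot (grad_objective x) (y - x) <= objective y - objective x.
Proof.
move=> fx fy; rewrite dotDl dotZl.
have h1 := log_barrier_tangent lam0 fx fy.
have h2 := vol_barrier_tangent herm_basis_sym herm_basis_inj lam0 fx fy.
have := ler_wpM2l (ltW mu0) h2; rewrite /objective.
by move: h1; move: (dot _ _) (dot _ _) => p q; lra.
Qed.

Lemma is_derive_Pt x u : feas x ->
  is_derive (0 : R) 1 (fun s : R => fine (Pt lam mu A t (herm (x + s *: u))))
    (dot (grad_objective x) u).
Proof.
move=> fx; apply: (@near_eq_is_derive _ _ _ (fun s : R => objective (x + s *: u))).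
  have := feasible_near herm_basis_sym u fx; apply: filterS => s fs.
  by rewrite Pt_feasible.
rewrite dotDl dotZl.
have h1 := is_derive_log_barrier herm_basis_sym lam0 u fx.
have h2 := is_derive_vol_barrier herm_basis_sym herm_basis_inj lam0 u fx.
exact: is_deriveD.
Qed.

Definition diag_coords : 'rV[R]_(d * d) := mxvec 1%:M.

Lemma hermitian1 : (1%:M : 'M[R[i]]_d) \is hermsymmx.
Proof.
apply/hermitianP => i j; rewrite !mxE (eq_sym j i).
by case: (i == j); rewrite ?conjc1 ?conjc0.
Qed.

Lemma coords1 : coords (1%:M : 'M[R[i]]_d) = diag_coords.
Proof.
congr mxvec; apply/matrixP => i j; rewrite !mxE eqxx (eq_sym j i).
by case: eqVneq => // ij; case: ifP => _ /=; rewrite mulr0.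
Qed.

Lemma trace_herm x : \tr (herm x) = (dot diag_coords x)%:C.
Proof.
apply: complex_ext; rewrite -(mul1mx (herm x)).
  by rewrite re_trace_herm ?hermitian1// coords1.
by rewrite im_trace_hermitian ?hermitian1// herm_hermitian.
Qed.

Lemma densityP x : density (herm x) <->
  semidef (pencil S x) /\ dot diag_coords x = 1.
Proof.
rewrite /density psd_rep -pencil_herm trace_herm; split.
  by move=> [[_ sS] [e]].
by move=> [sS ->]; split=> //; split=> //; exact: herm_hermitian.
Qed.

Lemma posdef_density x : posdef (pencil S x) -> dot diag_coords x = 1 ->
  density (herm x).
Proof.
move=> pS e; apply/densityP; split=> //.
by split; [exact: pS.1 | move=> w; exact: posdef_ge0].
Qed.

Lemma tracelessP u : traceless u <-> dot diag_coords u = 0.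
Proof. by rewrite /traceless trace_herm; split=> [[]|->]. Qed.

Section NonzeroLosses.
Hypothesis A0 : forall tau : 'I_t, A tau != 0.

Lemma posdef_feasible x : posdef (pencil S x) -> feas x.
Proof.
move=> pS; split=> // tau; rewrite -re_loss.
have : 0 < \tr (rep (A tau) *m pencil S x).
  apply: mxtrace_semidef_gt0 => //.
    by have /psd_rep[] := psdA (ltn_ord tau).
  apply: contra_neq (A0 tau) => r0; apply: rep_inj; rewrite r0.
  by rewrite rep0.
by rewrite pencil_herm -repM rep_tr pmulr_rgt0.
Qed.

(** Singular states are excluded by the log-determinant and no others, since nonzero losses are
    finite at positive definite states. The domain is thus the relative interior of the density
    matrices. *)
Lemma in_domainP x : in_domain (Pt lam mu A t) x <->
  posdef (pencil S x) /\ dot diag_coords x = 1.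
Proof.
split=> [[dx Px]|[pS e]].
  split; last by have /densityP[] := dx.
  apply: contrapT => npS; move: Px; rewrite /Pt Lt_singular//.
split; first exact: posdef_density.
by rewrite Pt_feasible ?ltry//; exact: posdef_feasible.
Qed.

Lemma Pt_not_domain x : density (herm x) -> ~ in_domain (Pt lam mu A t) x ->
  Pt lam mu A t (herm x) = +oo%E.
Proof.
move=> dx nx; rewrite /Pt Lt_singular// => pS; apply: nx; apply/in_domainP.
by have /densityP[] := dx.
Qed.

Lemma minimizer_in_domainP x : in_domain (Pt lam mu A t) x ->
  (forall y, in_domain (Pt lam mu A t) y ->
     (Pt lam mu A t (herm x) <= Pt lam mu A t (herm y))%E) ->
  minimizer (Pt lam mu A t) (herm x).
Proof.
move=> [dx _] xmin; split=> [|sigma ds]; first exact: dx.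
have hs : sigma \is hermsymmx by exact: ds.1.1.
rewrite -(coordsK hs) in ds *.
have [idy|/(Pt_not_domain ds) ->] := pselect (in_domain (Pt lam mu A t) (coords sigma)).
  exact: xmin.
by rewrite leey.
Qed.

End NonzeroLosses.

End Objective.

(** * Existence of a minimizer and first-order conditions *)

Section Minimizer.
Context {R : realType} {d : nat}.
Variables (lam mu : R) (A : nat -> 'M[R[i]]_d) (t : nat).
Hypotheses (d0 : (0 < d)%N) (lam0 : 0 < lam) (mu0 : 0 < mu).
Hypothesis psdA : forall tau, (tau < t)%N -> psd (A tau).
Implicit Types (x u v : 'rV[R]_(d * d)).

Local Notation S := (@herm_basis R d).
Local Notation a := (@loss_coords R d A t).
Local Notation feas := (feasible S a).
Local Notation P := (Pt lam mu A t).
Local Notation idv := (@diag_coords R d).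

Definition mixed_state : 'rV[R]_(d * d) := mxvec (d%:R^-1)%:M.

Lemma mixed_stateE : mixed_state = d%:R^-1 *: idv.
Proof. by rewrite /mixed_state /diag_coords -linearZ/= scalemx1. Qed.

Lemma dot_diag_coords : dot idv idv = d%:R :> R.
Proof.
rewrite dot_mxvec (eq_bigr (fun=> 1)) ?sumr_const ?card_ord// => i _.
rewrite (bigD1 i)//= big1 => [|j /negPf ij]; first by rewrite mxE eqxx mulr1 addr0.
by rewrite mxE eq_sym ij mulr0.
Qed.

Lemma dot_mixed_state : dot idv mixed_state = 1 :> R.
Proof. by rewrite mixed_stateE dotZr dot_diag_coords mulVf// pnatr_eq0 -lt0n. Qed.

Lemma pencil_mixed_state : pencil S mixed_state = d%:R^-1 *: 1%:M.
Proof.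
rewrite mixed_stateE pencilZ pencil_herm; congr (_ *: _).
rewrite -coords1 coordsK ?hermitian1// /rep.
have -> : remx (1%:M : 'M[R[i]]_d) = 1%:M.
  by apply/matrixP => i j; rewrite !mxE; case: (i == j).
have -> : immx (1%:M : 'M[R[i]]_d) = 0.
  by apply/matrixP => i j; rewrite !mxE; case: (i == j).
by rewrite oppr0 -scalar_mx_block.
Qed.

Lemma posdef_mixed_state : posdef (pencil S mixed_state).
Proof.
rewrite pencil_mixed_state; apply: posdefZ; last exact: posdef1.
by rewrite invr_gt0 ltr0n.
Qed.

Lemma density_mixed_state : density (herm mixed_state).
Proof. exact: posdef_density posdef_mixed_state dot_mixed_state. Qed.

Lemma dot_le_half n (x y : 'rV[R]_n) : dot x y <= (dot x x + dot y y) / 2.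
Proof.
have := dot_ge0 (x - y); rewrite dotDl dotNl !dotDr !dotNr (dotC y x).
by lra.
Qed.

Lemma density_mixed_ball x : density (herm x) ->
  dot (x - mixed_state) (x - mixed_state) <= 1.
Proof.
move=> dx; have h := density_dot_le1 dx; have [_ e] := (densityP x).1 dx.
rewrite dotDl dotNl !dotDr !dotNr (dotC x mixed_state).
have -> : dot mixed_state x = d%:R^-1 by rewrite mixed_stateE dotZl e mulr1.
have -> : dot mixed_state mixed_state = d%:R^-1.
  by rewrite {1}mixed_stateE dotZl dot_mixed_state mulr1.
have : 0 <= d%:R^-1 :> R by rewrite invr_ge0.
by lra.
Qed.

Hypothesis A0 : forall tau : 'I_t, A tau != 0.

(** On the bounded set of density matrices the losses are bounded below by [ln z <= z - 1], and the
    volume barrier by its tangent at the mixed state. Only the log-determinant is left, which forces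
    the objective to [+oo] at the boundary. *)
Let objective_lower_bound : exists K, forall x, density (herm x) -> feas x ->
  K - lam / 2 * ln (\det (pencil S x)) <= objective lam mu A t x.
Proof.
pose c := mixed_state.
have fc : feas c by apply: posdef_feasible => //; exact: posdef_mixed_state.
pose g := grad_vol S a lam c.
exists (\sum_tau (1 - (dot (a tau) (a tau) + 1) / 2) +
  mu * (vol_barrier S a lam c - (dot g g + 1) / 2)) => x dx fx.
rewrite /objective /log_barrier.
have hl : \sum_tau (1 - (dot (a tau) (a tau) + 1) / 2) <=
    - \sum_tau ln (dot (a tau) x).
  rewrite -sumrN; apply: ler_sum => tau _.
  have := ln_le_tangent (fx.2 tau) ltr01; rewrite ln1 add0r divr1.
  have := dot_le_half (a tau) x; have := density_dot_le1 dx.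
  by lra.
have hv : vol_barrier S a lam c - (dot g g + 1) / 2 <= vol_barrier S a lam x.
  have := vol_barrier_tangent (@herm_basis_sym _ _) (@herm_basis_inj _ _) lam0 fc fx.
  rewrite -/g; have := dot_le_half (- g) (x - c); rewrite dotNl dotNl dotNr opprK.
  have := density_mixed_ball dx; rewrite -/c.
  move: (dot (x - c) _) (dot g (x - c)) (dot g g) (vol_barrier _ _ _ _) (vol_barrier _ _ _ _).
  by move=> X1 X2 X3 X4 X5; lra.
have := ler_wpM2l (ltW mu0) hv; move: hl.
move: (\sum_tau (_ - _)) (- \sum_tau _) (mu * _) (mu * _) (lam / 2 * _).
by move=> X1 X2 X3 X4 X5; lra.
Qed.

Lemma objective_cvg x (D : set 'rV[R]_(d * d)) : feas x ->
  (forall y, D y -> feas y) ->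
  objective lam mu A t y @[y --> within D (nbhs x)] --> objective lam mu A t x.
Proof.
move=> fx Df; have cx : mcvg (F := within D (nbhs x)) id x.
  by move=> i j; apply: cvg_within_filter; exact: coord_continuous.
have nf : \forall y \near within D (nbhs x), feas y.
  by near=> y; apply: Df; near: y; exact: withinT.
apply: (tangent_cvg (dom := feas) (g := grad_objective lam mu A t)) => //.
  by move=> y z; apply: objective_tangent.
move=> i j; rewrite mxE; under eq_cvg do rewrite mxE.
apply: cvgD; first by apply: mcvg_grad_log.
apply: mcvgZ; first exact: cvg_cst.
apply: mcvg_grad_vol => //; first exact: herm_basis_sym.
exact: herm_basis_inj.
Unshelve. all: by end_near. Qed.

(** The feasible density matrices at which [F] does not exceed its value at the mixed state lie in
    [D], where the determinant is bounded away from 0. [D] is compact and the objective is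
    continuous on it. *)
Lemma minimizer_exists : exists2 x, in_domain P x & minimizer P (herm x).
Proof.
have [K HK] := objective_lower_bound.
pose c := mixed_state; pose F := objective lam mu A t.
have fc : feas c by apply: posdef_feasible => //; exact: posdef_mixed_state.
have dc := density_mixed_state.
(* [delta] solves [K - lam / 2 * ln delta = F c]. *)
pose delta := expR (- ((F c - K) * 2 / lam)).
pose D := [set x | density (herm x) /\ delta <= \det (pencil S x)].
have delta0 : 0 < delta by exact: expR_gt0.
have low x : density (herm x) -> feas x -> F x <= F c -> delta <= \det (pencil S x).
  move=> dx fx Fx; have d1 := posdef_det_gt0 fx.1.
  have h := le_trans (HK x dx fx) Fx.
  rewrite /delta -[X in _ <= X]lnK ?posrE// ler_expR -mulNr ler_pdivrMr//.
  by move: h; move: (ln _) (F c) => L f h; lra.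
have Df x : D x -> feas x.
  move=> [dx dx']; apply: posdef_feasible => //; have [sx _] := (densityP x).1 dx.
  apply: semidef_unit_posdef => //.
  by rewrite unitmxE unitfE gt_eqF// (lt_le_trans delta0).
have coordc (x : 'rV[R]_(d * d)) : mcvg (F := nbhs x) id x.
  by move=> i j; exact: coord_continuous.
have clD : closed D.
  have -> : D = (\bigcap_(w in [set: 'rV[R]_(d + d)])
        (fun x => dot (w *m pencil S x) w) @^-1` [set r | 0 <= r]) `&`
      ((fun x => dot idv x) @^-1` [set r | r = 1]) `&`
      ((fun x => \det (pencil S x)) @^-1` [set r | delta <= r]).
    apply/seteqP; split=> x /=.
      move=> [/densityP[[_ sx] ex] dx]; split=> //; split=> // w _.
      exact: sx.
    move=> [[sx ex] dx]; split=> //; apply/densityP; split=> //; split.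
      exact: pencil_sym (@herm_basis_sym _ _) _.
    by move=> w; exact: sx.
  apply: closedI; first apply: closedI.
  - apply: closed_bigI => w _; apply: preimage_closed; last exact: closed_ge.
    move=> x _.
    suff : dot (w *m pencil S y) w @[y --> x] --> dot (w *m pencil S x) w by [].
    apply: (@mcvg_dot R _ (nbhs x) _ _ (fun y => w *m pencil S y) (fun=> w)).
      apply: (@mcvgM R _ (nbhs x) _ _ _ _ (fun=> w) (pencil S)).
        exact: mcvg_cst.
      by apply: mcvg_pencil; exact: coordc.
    exact: mcvg_cst.
  - apply: preimage_closed; last exact: closed_eq.
    move=> x _; suff : dot idv y @[y --> x] --> dot idv x by [].
    apply: (@mcvg_dot R _ (nbhs x) _ _ (fun=> idv) id); last exact: coordc.
    exact: mcvg_cst.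
  - apply: preimage_closed; last exact: closed_ge.
    move=> x _.
    suff : \det (pencil S y) @[y --> x] --> \det (pencil S x) by [].
    apply: (@mcvg_det R _ (nbhs x) _ _ (pencil S)).
    by apply: mcvg_pencil; exact: coordc.
have bD : bounded_set D.
  exists 1; split; first exact: real1.
  move=> M M1 x [dx _]; rewrite /= [leLHS]/Num.norm/= mx_normrE.
  apply: bigmax_le => [|ij _]; first exact: le_trans (ltW M1).
  apply: le_trans (ltW M1); rewrite -(@expr_le1 _ 2)// -normrX ger0_norm ?sqr_ge0//.
  apply: le_trans (density_dot_le1 dx); rewrite dotE (bigD1 ij.2)//= -expr2.
  by rewrite (ord1 ij.1) lerDl sumr_ge0// => k _; rewrite -expr2 sqr_ge0.
have Dc : D c by split=> //; apply: low.
have [||x Dx xmin] := @EVT_min_rV R _ F D _ (bounded_closed_compact bD clD).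
- by exists c.
- apply/subspace_continuousP => x Dx.
  by apply: objective_cvg => //; exact: Df.
move: Dx; rewrite inE => Dx; have fx := Df _ Dx.
have idx : in_domain P x by apply/in_domainP => //; split; [exact: fx.1 | have [/densityP[]] := Dx].
exists x; first exact: idx.
apply: (minimizer_in_domainP lam0 psdA A0 idx) => y idy.
have dy := idy.1.
have fy : feas y by apply: posdef_feasible => //; exact: ((in_domainP mu lam0 psdA A0 y).1 idy).1.
rewrite !Pt_feasible// lee_fin.
have [Fy|/ltW Fy] := leP (F y) (F c).
  by apply: xmin; rewrite inE; split=> //; exact: low.
by apply: le_trans Fy; apply: xmin; rewrite inE.
Qed.

Lemma in_domain_feasible x : in_domain P x -> feas x.
Proof. by move/(in_domainP mu lam0 psdA A0 x) => [pS _]; exact: posdef_feasible. Qed.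

Lemma minimizer_in_domain x : minimizer P (herm x) -> in_domain P x.
Proof.
move=> [dx xmin]; split=> //; apply: le_lt_trans (xmin _ density_mixed_state) _.
rewrite Pt_feasible ?ltry//; apply: posdef_feasible => //.
exact: posdef_mixed_state.
Qed.

Lemma minimizer_gradient c x : in_domain P c -> minimizer P (herm x) ->
  dot (grad_objective lam mu A t c) (x - c) <= 0.
Proof.
move=> dc mx; have fc := in_domain_feasible dc.
have fx := in_domain_feasible (minimizer_in_domain mx).
apply: le_trans (objective_tangent lam0 mu0 fc fx) _.
have := mx.2 _ dc.1; rewrite !Pt_feasible// lee_fin.
by rewrite subr_le0.
Qed.

Lemma stationary_minimizer c : in_domain P c ->
  (forall u, traceless u -> dot (grad_objective lam mu A t c) u = 0) ->
  minimizer P (herm c).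
Proof.
move=> dc g0; have fc := in_domain_feasible dc.
apply: (minimizer_in_domainP lam0 psdA A0 dc) => y idy.
have fy := in_domain_feasible idy.
rewrite !Pt_feasible// lee_fin -subr_ge0.
apply: le_trans (objective_tangent lam0 mu0 fc fy); rewrite g0//.
apply/tracelessP; rewrite dotDr dotNr.
have [_ ->] := (in_domainP mu lam0 psdA A0 y).1 idy.
by have [_ ->] := (in_domainP mu lam0 psdA A0 c).1 dc; rewrite subrr.
Qed.

End Minimizer.

(** * Structured programs *)

Lemma index_allpairs_pair (S T : eqType) (s : seq S) (t : seq T) x y :
  x \in s -> y \in t ->
  index (x, y) [seq (x, y) | x <- s, y <- t] = (index x s * size t + index y t)%N.
Proof.
move=> + yt; elim: s => [//|z s IH]; rewrite inE /= index_cat.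
have inj : injective (pair z : T -> S * T) by move=> ? ? [].
case: (eqVneq z x) => [<- _|zx].
  by rewrite map_f// (index_map inj).
rewrite orFb => /IH ->.
rewrite size_map ifN ?mulSn ?addnA//.
by apply/mapP => -[w _ [xz]]; rewrite xz eqxx in zx.
Qed.

(** Pairs are enumerated lexicographically, so [mxvec] is row-major and matches the addresses
    computed by the programs. *)
Lemma val_mxvec_index m n (i : 'I_m) (j : 'I_n) :
  mxvec_index i j = (i * n + j)%N :> nat.
Proof.
rewrite /mxvec_index /=; set k := enum_rank (i, j).
have -> : k = index (i, j) (enum {: 'I_m * 'I_n}) :> nat.
  rewrite -[(i, j)]enum_rankK -/k (enum_val_nth (i, j)) index_uniq ?enum_uniq//.
  by rewrite -cardE ltn_ord.
have -> : enum {: 'I_m * 'I_n} = [seq (x, y) | x <- enum 'I_m, y <- enum 'I_n].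
  by rewrite enumT unlock.
rewrite index_allpairs_pair ?mem_enum// !index_enum_ord size_enum_ord//.
Qed.

Section StructuredPrograms.

(** Loop bounds depend only on registers 0 and 1, which a well-formed [fcom] never writes. Every
    such program therefore terminates with a cost known in advance; [While] remains for the outer
    loop alone. *)
Inductive bnd : Type := Bd | Bp | Bn | Bt.

Definition bexpr (b : bnd) : iexp :=
  match b with
  | Bd => IVar 0
  | Bp => IAdd (IVar 0) (IVar 0)
  | Bn => IMul (IVar 0) (IVar 0)
  | Bt => IVar 1
  end.

Inductive fcom : Type :=
| FSkip
| FRSet of nat & iexp & rexp
| FSeq of fcom & fcom
| FIf of bexp & fcom & fcom
| FFor of nat & bnd & fcom.

Fixpoint comp (c : fcom) : com :=
  match c with
  | FSkip => Skip
  | FRSet a e r => RSet a e r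
  | FSeq c1 c2 => Seq (comp c1) (comp c2)
  | FIf b c1 c2 => If b (comp c1) (comp c2)
  | FFor v b c => Seq (ISet v (ICst 0))
      (While (BNot (ILe (bexpr b) (IVar v)))
        (Seq (comp c) (ISet v (IAdd (IVar v) (ICst 1)))))
  end.

Fixpoint wregs (c : fcom) : seq nat :=
  match c with
  | FSkip | FRSet _ _ _ => [::]
  | FSeq c1 c2 | FIf _ c1 c2 => wregs c1 ++ wregs c2
  | FFor v _ c => v :: wregs c
  end.

Fixpoint warrs (c : fcom) : seq nat :=
  match c with
  | FSkip => [::]
  | FRSet a _ _ => [:: a]
  | FSeq c1 c2 | FIf _ c1 c2 => warrs c1 ++ warrs c2
  | FFor _ _ c => warrs c
  end.

Fixpoint wf (c : fcom) : bool :=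
  match c with
  | FSkip | FRSet _ _ _ => true
  | FSeq c1 c2 | FIf _ c1 c2 => wf c1 && wf c2
  | FFor v _ c => [&& (1 < v)%N, v \notin wregs c & wf c]
  end.

Definition bval (d t : nat) (b : bnd) : nat :=
  match b with Bd => d | Bp => d + d | Bn => d * d | Bt => t end.

(** A conditional is charged for both branches. In a loop, 11 pays for one guard test and increment,
    with at most 3 for evaluating the bound, and 9 for the initialization and the final test. *)
Fixpoint cst (d t : nat) (c : fcom) : nat :=
  match c with
  | FSkip => 1
  | FRSet _ e r => (icost e + rcost r).+1
  | FSeq c1 c2 => cst d t c1 + cst d t c2
  | FIf b c1 c2 => (bcost b + (cst d t c1 + cst d t c2)).+1
  | FFor _ b c => bval d t b * (cst d t c + 11) + 9
  end.

Definition bdeg (b : bnd) : nat :=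
  match b with Bd | Bp => 1 | Bn => 2 | Bt => 0 end.

Fixpoint deg (c : fcom) : nat :=
  match c with
  | FSkip | FRSet _ _ _ => 0
  | FSeq c1 c2 | FIf _ c1 c2 => maxn (deg c1) (deg c2)
  | FFor _ b c => bdeg b + deg c
  end.

Fixpoint tdeg (c : fcom) : nat :=
  match c with
  | FSkip | FRSet _ _ _ => 0
  | FSeq c1 c2 | FIf _ c1 c2 => maxn (tdeg c1) (tdeg c2)
  | FFor _ b c => (if b is Bt then 1 else 0) + tdeg c
  end.

Lemma cst_monomial c : exists K, forall d t T, (0 < d)%N -> (t <= T)%N -> (0 < T)%N ->
  (cst d t c <= K * (T ^ tdeg c * d ^ deg c))%N.
Proof.
have pos T d x y : (0 < d)%N -> (0 < T)%N -> (0 < T ^ x * d ^ y)%N.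
  by move=> d0 T0; rewrite muln_gt0 !expn_gt0 d0 T0.
elim: c => [|a e r|c1 [K1 H1] c2 [K2 H2]|b c1 [K1 H1] c2 [K2 H2]|v b c [K H]] /=.
- by exists 1%N => d t T d0 tT T0.
- by exists (icost e + rcost r).+1 => d t T d0 tT T0; rewrite muln1.
- exists (K1 + K2)%N => d t T d0 tT T0; rewrite mulnDl leq_add//.
    by rewrite (leq_trans (H1 d t T d0 tT T0))// leq_mul// leq_mul// leq_pexp2l// leq_maxl.
  by rewrite (leq_trans (H2 d t T d0 tT T0))// leq_mul// leq_mul// leq_pexp2l// leq_maxr.
- exists ((bcost b).+1 + (K1 + K2))%N => d t T d0 tT T0.
  rewrite -addSn !mulnDl leq_add ?leq_pmulr ?pos// leq_add//.
    by rewrite (leq_trans (H1 d t T d0 tT T0))// leq_mul// leq_mul// leq_pexp2l// leq_maxl.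
  by rewrite (leq_trans (H2 d t T d0 tT T0))// leq_mul// leq_mul// leq_pexp2l// leq_maxr.
- exists (2 * (K + 11) + 9)%N => d t T d0 tT T0.
  rewrite !expnD mulnACA; set X := (_ ^ _ * d ^ bdeg b)%N; set Y := (_ ^ _ * d ^ deg c)%N.
  have hb : (bval d t b <= 2 * X)%N by rewrite /X; case: b {X} => /=; nia.
  have X0 : (0 < X)%N by exact: pos.
  have Y0 : (0 < Y)%N by exact: pos.
  have hc := H d t T d0 tT T0; rewrite -/Y in hc.
  have h1 : (bval d t b * (cst d t c + 11) <= (2 * X) * ((K + 11) * Y))%N.
    by apply: leq_mul => //; rewrite mulnDl leq_add// leq_pmulr.
  have h2 : (0 < X * Y)%N by rewrite muln_gt0 X0.
  move: h1 h2; move: (_ * (_ + 11))%N; clear; nia.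
Qed.

Definition small (c : fcom) : bool :=
  ((tdeg c == 0) && (deg c <= 8) || (tdeg c <= 1) && (deg c <= 6))%N.

(** The largest degrees in [T] and in [d] may come from different commands, such as [T * d ^ 4] next
    to [d ^ 8]; their combination would exceed the budget. Sequences and conditionals are therefore
    split. *)
Fixpoint cheap (c : fcom) : bool :=
  small c || match c with
             | FSeq c1 c2 | FIf _ c1 c2 => cheap c1 && cheap c2
             | _ => false
             end.

Lemma cst_cheap c : cheap c -> exists K, forall d t T,
  (0 < d)%N -> (t <= T)%N -> (0 < T)%N ->
  (cst d t c <= K * (T * d ^ 6 + d ^ 8))%N.
Proof.
have mono c' : small c' -> exists K, forall d t T, (0 < d)%N -> (t <= T)%N ->
    (0 < T)%N -> (cst d t c' <= K * (T * d ^ 6 + d ^ 8))%N.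
  have [K hK] := cst_monomial c'; move=> h; exists K => d t T d0 tT T0.
  apply: leq_trans (hK d t T d0 tT T0) _; rewrite leq_mul2l; apply/orP; right.
  case/orP: h => /andP[].
    by move=> /eqP -> h; rewrite mul1n (leq_trans _ (leq_addl _ _))// leq_pexp2l.
  move=> h1 h2; rewrite (leq_trans _ (leq_addr _ _))// leq_mul ?leq_pexp2l//.
  by rewrite -[leqRHS]expn1 leq_pexp2l.
elim: c => [|a e r|c1 IH1 c2 IH2|b c1 IH1 c2 IH2|v b c IH] /orP[/mono//|] //=.
- move=> /andP[/IH1[K1 H1] /IH2[K2 H2]]; exists (K1 + K2)%N => d t T d0 tT T0.
  by rewrite mulnDl leq_add ?H1 ?H2.
- move=> /andP[/IH1[K1 H1] /IH2[K2 H2]].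
  exists ((bcost b).+1 + (K1 + K2))%N => d t T d0 tT T0.
  rewrite -addSn !mulnDl leq_add ?leq_pmulr ?addn_gt0 ?expn_gt0 ?d0 ?orbT//.
  by rewrite leq_add ?H1 ?H2.
Qed.

End StructuredPrograms.

(** * Functional semantics of structured programs *)

Section Denotation.
Context {R : realType}.
Implicit Types (m : memory R) (c : fcom).

Definition for_step (body : memory R -> memory R) v j m := set_ireg (body m) v j.+1.

Fixpoint den c m : memory R :=
  match c with
  | FSkip => m
  | FRSet a e r => set_rarr m a (ieval m e) (reval m r)
  | FSeq c1 c2 => den c2 (den c1 m)
  | FIf b c1 c2 => if beval m b then den c1 m else den c2 m
  | FFor v b c =>
      iteri (ieval m (bexpr b)) (for_step (den c) v) (set_ireg m v 0)
  end.

Lemma den_ireg c m v : v \notin wregs c -> ireg (den c m) v = ireg m v.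
Proof.
elim: c m => [|a e r|c1 IH1 c2 IH2|b c1 IH1 c2 IH2|w b c IH] m //=.
- by rewrite mem_cat negb_or => /andP[v1 v2]; rewrite IH2// IH1.
- by rewrite mem_cat negb_or => /andP[v1 v2]; case: ifP => _; rewrite ?IH2 ?IH1.
- rewrite inE negb_or => /andP[vw vc].
  elim: (ieval _ _) => [|n IHn]; first by rewrite /= (negPf vw).
  by rewrite /= (negPf vw) IH.
Qed.

Lemma den_rarr c m a l : a \notin warrs c -> rarr (den c m) a l = rarr m a l.
Proof.
elim: c m => [|b e r|c1 IH1 c2 IH2|b c1 IH1 c2 IH2|w b c IH] m //=.
- by rewrite inE => /negPf ->.
- by rewrite mem_cat negb_or => /andP[v1 v2]; rewrite IH2// IH1.
- by rewrite mem_cat negb_or => /andP[v1 v2]; case: ifP => _; rewrite ?IH2 ?IH1.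
- by move=> ac; elim: (ieval _ _) => [//|n IHn] /=; rewrite IH.
Qed.

Lemma wf_wregs c v : wf c -> (v <= 1)%N -> v \notin wregs c.
Proof.
elim: c => [|b e r|c1 IH1 c2 IH2|b c1 IH1 c2 IH2|w b c IH] //=.
- by move=> /andP[w1 w2] v1; rewrite mem_cat negb_or IH1// IH2.
- by move=> /andP[w1 w2] v1; rewrite mem_cat negb_or IH1// IH2.
- move=> /and3P[w1 _ wc] v1; rewrite inE negb_or IH// andbT.
  by apply: contraTneq w1 => <-; rewrite -leqNgt.
Qed.

Lemma ieval_bexpr m b : ieval m (bexpr b) = bval (ireg m 0) (ireg m 1) b.
Proof. by case: b. Qed.

Lemma comp_exec c m : wf c -> exists k, exec (comp c) m k (den c m) /\
  (k <= cst (ireg m 0) (ireg m 1) c)%N.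
Proof.
elim: c m => [|a e r|c1 IH1 c2 IH2|b c1 IH1 c2 IH2|v b c IH] m /=.
- by move=> _; exists 1%N; split=> //; constructor.
- by move=> _; eexists; split; [exact: exec_rset|].
- move=> /andP[w1 w2]; have [k1 [e1 h1]] := IH1 m w1.
  have [k2 [e2 h2]] := IH2 (den c1 m) w2.
  exists (k1 + k2)%N; split; first exact: exec_seq e1 e2.
  by move: h2; rewrite !den_ireg ?wf_wregs// => h2; exact: leq_add.
- move=> /andP[w1 w2]; have [k1 [e1 h1]] := IH1 m w1.
  have [k2 [e2 h2]] := IH2 m w2.
  exists (bcost b + (if beval m b then k1 else k2)).+1; split.
    by apply: exec_if; case: ifP.
  by rewrite ltnS leq_add2l; case: ifP => _; lia.
- move=> /and3P[v1 vc wc]; rewrite ieval_bexpr.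
  set d := ireg m 0; set t := ireg m 1; set N := bval d t b.
  pose M j := iteri j (for_step (den c) v) (set_ireg m v 0).
  have v01 w : (w <= 1)%N -> (w == v) = false by move=> w1; apply/eqP; lia.
  have Mr j w : (w <= 1)%N -> ireg (M j) w = ireg m w.
    move=> w1; elim: j => [|j IHj] /=; first by rewrite v01.
    by rewrite v01// den_ireg ?wf_wregs.
  have Mv j : ireg (M j) v = j by case: j => [|j] /=; rewrite eqxx.
  have Mb j : ieval (M j) (bexpr b) = N by rewrite ieval_bexpr !Mr.
  (* The induction is on the number of remaining iterations, since [exec] unfolds a loop at its
     first iteration and [iteri] at its last. *)
  have loop j : (j <= N)%N -> exists k,
      exec (While (BNot (ILe (bexpr b) (IVar v)))
        (Seq (comp c) (ISet v (IAdd (IVar v) (ICst 1))))) (M (N - j)%N) k (M N) /\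
      (k <= j * (cst d t c + 11) + 7)%N.
    have cb : (icost (bexpr b) <= 3)%N by case: (b).
    elim: j => [|j IHj] jN.
      rewrite subn0; eexists; split.
        by apply: exec_while_stop; rewrite /= Mb Mv leqnn.
      by rewrite /=; lia.
    have [k [ek hk]] := IHj (ltnW jN).
    have [k1 [e1 h1]] := IH (M (N - j.+1)%N) wc.
    eexists; split.
      apply: (@exec_while_step _ _ (M (N - j)%N)).
      - by rewrite /= Mb Mv; lia.
      - apply: exec_seq e1 _.
        have -> : M (N - j)%N = set_ireg (den c (M (N - j.+1)%N)) v
            (ieval (den c (M (N - j.+1)%N)) (IAdd (IVar v) (ICst 1))).
          have -> : (N - j = (N - j.+1).+1)%N by lia.
          by rewrite /M /= /for_step den_ireg// -/(M _) Mv addn1.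
        exact: exec_iset.
      - exact: ek.
    move: h1; rewrite !Mr// -/d -/t /= => h1; lia.
  have [k [ek hk]] := loop N (leqnn N).
  exists (2 + k)%N; split; last by lia.
  apply: exec_seq; first exact: exec_iset.
  by move: ek; rewrite subnn.
Qed.

End Denotation.

(** * Arrays of iterated sums *)

Section Tables.
Context {R : realType}.
Implicit Types (m : memory R) (ls : seq (nat * bnd)) (e : rexp).

Fixpoint nest ls (c : fcom) : fcom :=
  if ls is vb :: ls' then FFor vb.1 vb.2 (nest ls' c) else c.

(* Array 5 is a scratch cell in which sums are collected. *)
Definition add_cell e := FRSet 5 (ICst 0) (RAdd (RGet 5 (ICst 0)) e).

Definition sum_cell ls e :=
  FSeq (FRSet 5 (ICst 0) (RNat (ICst 0))) (nest ls (add_cell e)).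

Fixpoint row_major (acc : iexp) ls : iexp :=
  if ls is vb :: ls' then row_major (IAdd (IMul acc (bexpr vb.2)) (IVar vb.1)) ls'
  else acc.

(** Nearly all computed quantities are arrays of iterated sums, so one correctness lemma serves
    them. The position is accumulated in [acc] by Horner's rule, which lets the induction peel off
    the outermost loop. *)
Definition table_body (a : nat) (acc : iexp) ls inner e :=
  nest ls (FSeq (sum_cell inner e) (FRSet a (row_major acc ls) (RGet 5 (ICst 0)))).

Definition table a ls inner e := table_body a (ICst 0) ls inner e.

Fixpoint rarrs e : seq nat :=
  match e with
  | RNat _ => [::]
  | RGet a _ => [:: a]
  | RAdd e1 e2 | RSub e1 e2 | RMul e1 e2 | RDiv e1 e2 => rarrs e1 ++ rarrs e2
  | RSqrt e1 => rarrs e1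
  end.

Fixpoint nsum ls m e : R :=
  if ls is vb :: ls' then
    \sum_(i < bval (ireg m 0) (ireg m 1) vb.2) nsum ls' (set_ireg m vb.1 i) e
  else reval m e.

Lemma ieval_ext m m' (e : iexp) : (forall v, ireg m v = ireg m' v) ->
  ieval m e = ieval m' e.
Proof. by move=> h; elim: e => //= [e1 -> e2 ->|e1 -> e2 ->|e1 -> e2 ->]. Qed.

Lemma reval_ext m m' e : (forall v, ireg m v = ireg m' v) ->
  (forall a l, a \in rarrs e -> rarr m a l = rarr m' a l) ->
  reval m e = reval m' e.
Proof.
move=> h; elim: e => [i|a i|e1 IH1 e2 IH2|e1 IH1 e2 IH2|e1 IH1 e2 IH2|e1 IH1 e2 IH2|e1 IH1] /= ha;
  rewrite ?(ieval_ext _ h)//; try (by rewrite ha ?mem_head);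
  try (by rewrite IH1 ?IH2// => a l ae; apply: ha; rewrite mem_cat ae ?orbT).
Qed.

Definition loop_vars ls := unzip1 ls.

Lemma nsum_ext ls m m' e : all (fun v => 1 < v)%N (loop_vars ls) ->
  (forall v, v \notin loop_vars ls -> ireg m v = ireg m' v) ->
  (forall a l, a \in rarrs e -> rarr m a l = rarr m' a l) ->
  nsum ls m e = nsum ls m' e.
Proof.
elim: ls m m' => [|[v b] ls IH] m m' /=; first by move=> _ h ha; apply: reval_ext => // v; exact: h.
move=> /andP[v1 ls1] h ha.
have h01 w : (w <= 1)%N -> ireg m w = ireg m' w.
  move=> w1; apply: h; rewrite inE negb_or; apply/andP; split.
    by apply/eqP; lia.
  by apply/negP => /(allP ls1); lia.
rewrite !h01//; apply: eq_bigr => i _; apply: IH => // w wls /=.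
by case: eqP => // /eqP wv; apply: h; rewrite inE negb_or wv.
Qed.

Lemma wregs_nest ls c : wregs (nest ls c) = loop_vars ls ++ wregs c.
Proof. by elim: ls => //= vb ls ->. Qed.

Lemma warrs_nest ls c : warrs (nest ls c) = warrs c.
Proof. by elim: ls. Qed.

Section Iterates.
Variables (c : fcom) (v : nat) (m : memory R).
Let M j := iteri j (for_step (den c) v) (set_ireg m v 0).

Lemma iter_ireg_var j : ireg (M j) v = j.
Proof. by case: j => [|j] /=; rewrite eqxx. Qed.

Lemma iter_ireg j w : w != v -> w \notin wregs c -> ireg (M j) w = ireg m w.
Proof.
move=> /negPf wv wc; elim: j => [|j IH] /=; rewrite wv//.
by rewrite den_ireg.
Qed.

Lemma iter_rarr j a l : a \notin warrs c -> rarr (M j) a l = rarr m a l.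
Proof. by move=> ac; elim: j => //= j IH; rewrite den_rarr. Qed.

End Iterates.

Lemma den_nest_add ls m e : all (fun v => 1 < v)%N (loop_vars ls) ->
  uniq (loop_vars ls) -> 5%N \notin rarrs e ->
  rarr (den (nest ls (add_cell e)) m) 5 0 = rarr m 5 0 + nsum ls m e.
Proof.
elim: ls m => [|[v b] ls IH] m //= /andP[v1 ls1] /andP[vls uls] e5.
rewrite ieval_bexpr; set N := bval _ _ _; set c := nest ls _.
elim: {-2}N (leqnn N) => [|j IHj] jN; first by rewrite big_ord0 addr0.
rewrite /= IH// IHj ?(ltnW jN)// big_ord_recr/= addrA; congr (_ + _).
apply: nsum_ext => // [w wls|a l ae] /=.
  case: eqP => [->|/eqP wv]; first exact: iter_ireg_var.
  by apply: iter_ireg => //; rewrite /c wregs_nest /= cats0.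
apply: iter_rarr; rewrite /c warrs_nest inE.
by apply/eqP => a5; move: e5; rewrite -a5 ae.
Qed.

Lemma den_sum_cell ls m e : all (fun v => 1 < v)%N (loop_vars ls) ->
  uniq (loop_vars ls) -> 5%N \notin rarrs e ->
  rarr (den (sum_cell ls e) m) 5 0 = nsum ls m e.
Proof.
move=> ls1 uls e5; rewrite /= den_nest_add//= add0r.
apply: nsum_ext => // a l ae /=.
by case: eqP => // a5; move: e5; rewrite -a5 ae.
Qed.

Fixpoint in_bounds d t ls (s : seq nat) : bool :=
  match ls, s with
  | [::], [::] => true
  | vb :: ls', i :: s' => (i < bval d t vb.2)%N && in_bounds d t ls' s'
  | _, _ => false
  end.

Fixpoint position d t p ls (s : seq nat) : nat :=
  match ls, s with
  | vb :: ls', i :: s' => position d t (p * bval d t vb.2 + i) ls' s'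
  | _, _ => p
  end.

Fixpoint block_size d t ls : nat :=
  if ls is vb :: ls' then bval d t vb.2 * block_size d t ls' else 1%N.

Fixpoint set_iregs m ls (s : seq nat) : memory R :=
  match ls, s with
  | vb :: ls', i :: s' => set_iregs (set_ireg m vb.1 i) ls' s'
  | _, _ => m
  end.

(** The entries below the prefix [p] fill a block of their own, so different values of an outer
    index never overwrite each other. *)
Lemma position_in_block d t p ls s : in_bounds d t ls s ->
  (p * block_size d t ls <= position d t p ls s < p.+1 * block_size d t ls)%N.
Proof.
elim: ls p s => [|vb ls IH] p [|i s] //=; first by rewrite !muln1 leqnn ltnSn.
move=> /andP[iN /IH h]; have /andP[h1 h2] := h (p * bval d t vb.2 + i)%N.
move: h1 h2; set W := block_size _ _ _; set q := position _ _ _ _ _.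
move: (bval _ _ _) iN => N iN h1 h2; apply/andP; split.
  by apply: leq_trans h1; rewrite mulnA leq_mul2r leq_addr orbT.
by apply: leq_trans h2 _; rewrite mulnA leq_mul2r mulSn; apply/orP; right; lia.
Qed.

Lemma set_iregs_rarr m ls s a l : rarr (set_iregs m ls s) a l = rarr m a l.
Proof. by elim: ls m s => [|vb ls IH] m [|i s] //=; rewrite IH. Qed.

Lemma set_iregs_ext d t m m' ls (V : seq nat) s : in_bounds d t ls s ->
  (forall v, v \notin loop_vars ls -> v \notin V -> ireg m v = ireg m' v) ->
  forall v, v \notin V -> ireg (set_iregs m ls s) v = ireg (set_iregs m' ls s) v.
Proof.
elim: ls m m' s => [|vb ls IH] m m' [|i s] //=; first by move=> _ h v; exact: h.
move=> /andP[_ bs] h; apply: IH bs _ => v vls vV /=.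
by case: eqP => // /eqP vv; apply: h => //; rewrite inE negb_or vv.
Qed.

Definition table_ok (a : nat) ls inner e : bool :=
  [&& all (fun v => 1 < v)%N (loop_vars ls ++ loop_vars inner),
      uniq (loop_vars ls ++ loop_vars inner), a != 5%N, 5%N \notin rarrs e
    & a \notin rarrs e].

(** The second conclusion, that nothing outside the current block changes, is what lets entries
    written by earlier iterations survive the later ones. *)
Lemma den_table_body a ls inner e acc m p : table_ok a ls inner e ->
  (forall m', (forall w, w \notin loop_vars ls -> w \notin loop_vars inner ->
      ireg m' w = ireg m w) -> ieval m' acc = p) ->
  let m' := den (table_body a acc ls inner e) m in
  let d := ireg m 0 in let t := ireg m 1 in
  (forall s, in_bounds d t ls s -> rarr m' a (position d t p ls s) =
     nsum inner (set_iregs m ls s) e) /\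
  (forall l, (l < p * block_size d t ls)%N \/ (p.+1 * block_size d t ls <= l)%N ->
     rarr m' a l = rarr m a l).
Proof.
elim: ls acc m p => [|[v b] ls IH] acc m p.
  rewrite /table_body => /and5P[/= i1 iu a5 e5 ea] accE.
  set m1 := den (nest inner _) _.
  have -> : ieval m1 acc = p.
    apply: accE => w _ wi; rewrite /m1 den_ireg// wregs_nest /= cats0//.
  split=> [[|//] _|l]; first by rewrite !eqxx /= (den_sum_cell m i1 iu e5).
  rewrite eqxx !muln1 /= => lp.
  have -> : (l == p) = false by apply/eqP; case: lp; lia.
  by rewrite /m1 den_rarr ?warrs_nest ?inE//= (negPf a5).
move=> ok; have := ok; rewrite /table_ok /= => /and5P[/andP[v1 i1] /andP[vn iu] a5 e5 ea] accE.
rewrite /table_body /= -/(table_body a _ ls inner e) ieval_bexpr.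
set d := ireg m 0; set t := ireg m 1; set N := bval d t b; set W := block_size d t ls.
set c := table_body _ _ _ _ _; pose M j := iteri j (for_step (den c) v) (set_ireg m v 0).
have wc : wregs c =i loop_vars ls ++ loop_vars inner.
  by move=> w; rewrite /c /table_body wregs_nest /= wregs_nest /= !cats0.
have ac : warrs c =i [:: 5%N; a].
  by move=> x; rewrite /c /table_body warrs_nest /= warrs_nest !inE /= orbA orbb.
have M01 j w : (w <= 1)%N -> ireg (M j) w = ireg m w.
  move=> w1; apply: iter_ireg; first by apply/eqP; lia.
  by rewrite wc; apply/negP => /(allP i1); lia.
have Mr j w : w != v -> w \notin loop_vars ls -> w \notin loop_vars inner ->
    ireg (M j) w = ireg m w.
  by move=> wv w1 w2; apply: iter_ireg => //; rewrite wc mem_cat negb_or w1.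
have Mv j : ireg (M j) v = j by exact: iter_ireg_var.
have nl w : (w <= 1)%N -> w \notin loop_vars ls.
  by move=> w1; apply/negP => h; have := allP i1 w; rewrite mem_cat h => /(_ isT); lia.
have ni w : (w <= 1)%N -> w \notin loop_vars inner.
  by move=> w1; apply/negP => h; have := allP i1 w; rewrite mem_cat h orbT => /(_ isT); lia.
have okls : table_ok a ls inner e by rewrite /table_ok i1 iu a5 e5.
move: (vn); rewrite mem_cat negb_or => /andP[vls vin].
have step j : (j < N)%N ->
   (forall s, in_bounds d t ls s -> rarr (M j.+1) a (position d t (p * N + j) ls s) =
     nsum inner (set_iregs (set_ireg m v j) ls s) e) /\
   (forall l, (l < (p * N + j) * W)%N \/ ((p * N + j).+1 * W <= l)%N ->
     rarr (M j.+1) a l = rarr (M j) a l).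
  move=> jN; have [] := IH (IAdd (IMul acc (bexpr b)) (IVar v)) (M j) (p * N + j)%N okls.
    move=> m' m'E /=; rewrite (accE m'); last first.
      move=> w; rewrite inE negb_or => /andP[wv w1] w2.
      by rewrite m'E// Mr.
    by rewrite ieval_bexpr !m'E ?Mv ?M01// ?nl ?ni.
  rewrite !M01// -/d -/t -/W => h1 h2; split=> // s bs.
  rewrite h1//; apply: nsum_ext.
  - by move: i1; rewrite all_cat => /andP[].
  - apply: (set_iregs_ext bs) => w w1 w2 /=.
    by case: eqP => [->|/eqP wv]; [exact: Mv | exact: Mr].
  - move=> x l xe; rewrite !set_iregs_rarr; apply: iter_rarr.
    by rewrite ac !inE negb_or; apply/andP; split; apply: contraTneq xe => ->.
have inv j : (j <= N)%N ->
   (forall i s, (i < j)%N -> in_bounds d t ls s ->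
     rarr (M j) a (position d t (p * N + i) ls s) =
     nsum inner (set_iregs (set_ireg m v i) ls s) e) /\
   (forall l, (l < p * N * W)%N \/ ((p * N + j) * W <= l)%N ->
     rarr (M j) a l = rarr m a l).
  elim: j => [|j IHj] jN; first by split=> // l _.
  have [h1 h2] := IHj (ltnW jN); have [s1 s2] := step j jN; split.
    move=> i s; rewrite ltnS leq_eqVlt => /predU1P[->|ij] bs; first exact: s1.
    rewrite s2 ?h1//; left; have /andP[_ lt] := position_in_block (p * N + i) bs.
    by apply: leq_trans lt _; rewrite leq_mul2r -addnS leq_add2l ij orbT.
  move=> l hl; rewrite s2; last first.
    case: hl => hl; [left|right]; last by rewrite -addnS.
    by apply: leq_trans hl _; rewrite leq_mul2r leq_addr orbT.
  apply: h2; case: hl => hl; [by left|right].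
  by apply: leq_trans hl; rewrite leq_mul2r leq_add2l leqnSn orbT.
have [h1 h2] := inv N (leqnn N); split.
  by move=> [|i s] //= /andP[iN bs]; exact: h1.
move=> l hl; apply: h2; rewrite -!mulnA -/W.
case: hl => hl; [by left|right].
by move: hl; rewrite mulSn -/N addnC mulnDl mulnA.
Qed.

Lemma den_table a ls inner e m s : table_ok a ls inner e ->
  in_bounds (ireg m 0) (ireg m 1) ls s ->
  rarr (den (table a ls inner e) m) a (position (ireg m 0) (ireg m 1) 0 ls s) =
  nsum inner (set_iregs m ls s) e.
Proof.
move=> ok; have [] := @den_table_body a ls inner e (ICst 0) m 0 ok; first by [].
by move=> h _ bs; rewrite -h.
Qed.

Lemma warrs_table a ls inner e : warrs (table a ls inner e) =i [:: 5%N; a].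
Proof.
by move=> x; rewrite /table /table_body warrs_nest /= warrs_nest !inE /= orbA orbb.
Qed.

Lemma table_rarr a ls inner e m b l : b \notin [:: 5%N; a] ->
  rarr (den (table a ls inner e) m) b l = rarr m b l.
Proof. by move=> h; apply: den_rarr; rewrite warrs_table. Qed.

End Tables.

(** * Principal pivots *)

Section PrincipalPivot.
Context {R : realType} {q : nat}.
Implicit Types (M N : 'M[R]_q) (k i j : 'I_q).

(** The Kronecker factors replace a case distinction, so that the branch-free [pivot_expr] evaluates
    to the same formula. *)
Definition pivot_mx k N : 'M[R]_q := \matrix_(i, j)
  let di := (i == k)%:R in let dj := (j == k)%:R in
  (1 - di) * (1 - dj) * (N i j - N i k * N k j / N k k) + di * dj * (1 / N k k)
  - di * (1 - dj) * (N k j / N k k) + (1 - di) * dj * (N i k / N k k).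

(* [N] is [M] after exchanging the first [k] coordinates of the argument and
   of the value of the linear map x |-> M x. *)
Definition pivoted M (k : nat) N : Prop :=
  [/\ forall w : 'I_q -> R,
        let z i := \sum_j N i j * w j in
        let x i := if (i < k)%N then z i else w i in
        let y i := if (i < k)%N then w i else z i in
        forall i, y i = \sum_j M i j * x j,
      forall i j, (k <= i)%N -> (k <= j)%N -> N i j = N j i
    & forall x : 'I_q -> R,
        \sum_(i : 'I_q | (k <= i)%N) \sum_(j : 'I_q | (k <= j)%N) x i * N i j * x j <=
        \sum_i \sum_j x i * M i j * x j].

Lemma pivoted0 M : M^T = M -> pivoted M 0 M.
Proof.
move=> sM; split=> // i j _ _.
by rewrite -[in LHS]sM mxE.
Qed.

(** Solving the [k]-th equation for its argument is possible as the pivot is nonzero. The trailing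
    block becomes its Schur complement, and the form loses only the square
    [(N k k * x k + s) ^+ 2 / N k k], which is nonnegative as the pivot is positive. *)
Lemma pivotedS M k N : pivoted M k N -> 0 < N k k -> pivoted M k.+1 (pivot_mx k N).
Proof.
move=> [J1 J2 J3] p0; have pn0 : N k k != 0 by rewrite gt_eqF.
have Nkk : pivot_mx k N k k = 1 / N k k by rewrite mxE eqxx /=; ring.
have Nkj j : j != k -> pivot_mx k N k j = - (N k j / N k k).
  by move=> /negPf jk; rewrite mxE eqxx jk /=; ring.
have Nik i : i != k -> pivot_mx k N i k = N i k / N k k.
  by move=> /negPf ik; rewrite mxE eqxx ik /=; ring.
have Nij i j : i != k -> j != k ->
    pivot_mx k N i j = N i j - N i k * N k j / N k k.
  by move=> /negPf ik /negPf jk; rewrite mxE ik jk /=; ring.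
have ltk i : i != k -> ((i < k.+1) = (i < k))%N.
  by move=> ik; rewrite ltnS leq_eqVlt val_eqE (negPf ik).
split.
- move=> w z x y i.
  pose w' i := if i == k then z k else w i.
  pose z' i := \sum_j N i j * w' j.
  have z'E i' : z' i' = N i' k * z k + \sum_(j | j != k) N i' j * w j.
    rewrite /z' (bigD1 k)//= /w' eqxx; congr (_ + _).
    by apply: eq_bigr => j /negPf ->.
  have zk : z k = (w k - \sum_(j | j != k) N k j * w j) / N k k.
    rewrite /z (bigD1 k)//= Nkk mulrBl; congr (_ + _); first by field.
    rewrite mulr_suml -sumrN; apply: eq_bigr => j jk.
    by rewrite Nkj//; ring.
  have z'k : z' k = w k by rewrite z'E zk; field.
  have z'i i' : i' != k -> z' i' = z i'.
    move=> ik; rewrite z'E zk; have -> : z i' = \sum_j pivot_mx k N i' j * w j by [].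
    rewrite [RHS](bigD1 k)//= Nik//.
    have -> : \sum_(j | j != k) pivot_mx k N i' j * w j =
        \sum_(j | j != k) N i' j * w j - N i' k / N k k * \sum_(j | j != k) N k j * w j.
      rewrite mulr_sumr -sumrB; apply: eq_bigr => j jk.
      by rewrite Nij//; ring.
    by move: (\sum_(j | _) _) (\sum_(j | _) _) => X Y; field.
  have yE : y i = if (i < k)%N then w' i else z' i.
    rewrite /y; have [->|ik] := eqVneq i k; first by rewrite ltnSn ltnn z'k.
    by rewrite ltk// /w' (negPf ik) z'i.
  rewrite yE J1; apply: eq_bigr => j _; congr (_ * _).
  rewrite /x; have [->|jk] := eqVneq j k; first by rewrite ltnSn ltnn /w' eqxx.
  by rewrite ltk// /w' (negPf jk) -/(z' j) z'i.
- move=> i j ki kj.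
  have ik : i != k by apply/eqP => e; rewrite e ltnn in ki.
  have jk : j != k by apply/eqP => e; rewrite e ltnn in kj.
  rewrite !Nij// (J2 i j) ?(J2 i k) ?(J2 k j) ?(ltnW ki) ?(ltnW kj)//.
  by rewrite [N k i * _]mulrC.
- move=> x; apply: le_trans (J3 x).
  have split1 (f : 'I_q -> R) : \sum_(i : 'I_q | (k <= i)%N) f i =
      f k + \sum_(i : 'I_q | (k < i)%N) f i.
    rewrite (bigD1 k)//=; congr (_ + _); apply: eq_bigl => i.
    by rewrite ltn_neqAle andbC -val_eqE eq_sym.
  have -> : \sum_(i : 'I_q | (k <= i)%N) \sum_(j : 'I_q | (k <= j)%N) x i * N i j * x j =
      (x k * N k k * x k + \sum_(j : 'I_q | (k < j)%N) x k * N k j * x j) +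
      \sum_(i : 'I_q | (k < i)%N)
        (x i * N i k * x k + \sum_(j : 'I_q | (k < j)%N) x i * N i j * x j).
    rewrite split1 (split1 (fun j => x k * N k j * x j)); congr (_ + _).
    by apply: eq_bigr => i _; exact: split1.
  rewrite big_split/=.
  pose s := \sum_(j : 'I_q | (k < j)%N) N k j * x j.
  have e1 : \sum_(j : 'I_q | (k < j)%N) x k * N k j * x j = x k * s.
    by rewrite mulr_sumr; apply: eq_bigr => j _; rewrite mulrA.
  have e2 : \sum_(i : 'I_q | (k < i)%N) x i * N i k * x k = x k * s.
    rewrite mulr_sumr; apply: eq_bigr => i ki.
    by rewrite (J2 i k) ?(ltnW ki)//; ring.
  have e3 : \sum_(i : 'I_q | (k < i)%N) \sum_(j : 'I_q | (k < j)%N) x i * pivot_mx k N i j * x j =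
     \sum_(i : 'I_q | (k < i)%N) \sum_(j : 'I_q | (k < j)%N) x i * N i j * x j - s ^+ 2 / N k k.
    rewrite expr2 -mulrA {1}/s mulr_suml -sumrB; apply: eq_bigr => i ki.
    rewrite mulrA [_ * s]mulrC /s mulr_suml mulr_suml -sumrB; apply: eq_bigr => j kj.
    have ik : i != k by apply/eqP => e; rewrite e ltnn in ki.
    have jk : j != k by apply/eqP => e; rewrite e ltnn in kj.
    by rewrite Nij// (J2 i k) ?(ltnW ki)//; ring.
  rewrite e1 e2 e3 -subr_ge0.
  move: (\sum_(i | _) _) => X.
  have -> : x k * N k k * x k + x k * s + (x k * s + X) - (X - s ^+ 2 / N k k) =
      (N k k * x k + s) ^+ 2 / N k k by field.
  by rewrite divr_ge0// ?sqr_ge0// ltW.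
Qed.

(** After all exchanges [N] maps values to arguments, so [M *m N = 1%:M]. The last clause of
    [pivoted] then has an empty left side and says that [M] is semidefinite. *)
Lemma pivoted_inv M N : M^T = M -> pivoted M q N ->
  posdef M /\ invmx M = N.
Proof.
move=> sM [J1 _ J3].
have MN : M *m N = 1%:M.
  apply/matrixP => i j; have := J1 (fun l => (l == j)%:R) i; rewrite /= ltn_ord.
  rewrite !mxE => ->; apply: eq_bigr => l _; rewrite ltn_ord; congr (_ * _).
  by rewrite (bigD1 j)//= eqxx mulr1 big1 ?addr0// => h /negPf ->; rewrite mulr0.
split; last exact: invmx_unique.
apply: semidef_unit_posdef; last by have [] := mulmx1_unit MN.
split=> // u; have := J3 (fun i => u 0 i).
rewrite [X in X <= _ -> _]big_pred0; last by move=> i; rewrite leqNgt ltn_ord.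
move=> h; apply: le_trans h _; rewrite dotE le_eqVlt; apply/orP; left; apply/eqP.
rewrite exchange_big; apply: eq_bigr => j _ /=.
by rewrite mxE mulr_suml.
Qed.

(** Feed the partially exchanged map with the [k]-th unit vector: [x] is the resulting argument of
    [M]. The first [k] values of [M] at [x] are 0, the [k]-th is the pivot, and [x] vanishes beyond
    [k], so the form at [x] is the pivot. *)
Lemma pivoted_witness M k N : M^T = M -> pivoted M k N -> N k k <= 0 ->
  let x : 'rV[R]_q := \row_i ((i < k)%N%:R * N i k + (i == k)%:R) in
  x != 0 /\ dot (x *m M) x <= 0.
Proof.
move=> sM [J1 _ _] p0 x.
have xk : x 0 k = 1 by rewrite mxE ltnn eqxx mul0r add0r.
split; first by apply/eqP => x0; move: xk; rewrite x0 mxE => /eqP; rewrite eq_sym oner_eq0.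
have z i : \sum_j N i j * (j == k)%:R = N i k.
  by rewrite (bigD1 k)//= eqxx mulr1 big1 ?addr0// => h /negPf ->; rewrite mulr0.
have xE j : (if (j < k)%N then \sum_l N j l * (l == k)%:R else (j == k)%:R) = x 0 j.
  rewrite mxE z; case: ltnP => [jk|_]; last by rewrite mul0r add0r.
  have -> : (j == k) = false by apply/eqP => e; rewrite e ltnn in jk.
  by rewrite mul1r addr0.
rewrite dotE (bigD1 k)//= big1 => [|j jk].
  rewrite addr0 xk mulr1 mxE; have := J1 (fun l => (l == k)%:R) k.
  rewrite /= ltnn z => e; apply: le_trans p0; rewrite e le_eqVlt; apply/orP; left.
  by apply/eqP/eq_bigr => l _; rewrite xE mulrC -[in LHS]sM [M^T _ _]mxE.
have := J1 (fun l => (l == k)%:R) j; rewrite /= z.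
have -> : \sum_l M j l * (if (l < k)%N then \sum_j0 N l j0 * (j0 == k)%:R else (l == k)%:R) =
    (x *m M) 0 j.
  by rewrite mxE; apply: eq_bigr => l _; rewrite xE mulrC -[in LHS]sM [M^T _ _]mxE.
move=> <-; rewrite mxE (negPf jk); case: ltnP => jk'; first by rewrite mul0r.
by rewrite mul0r add0r mulr0.
Qed.

End PrincipalPivot.

Section TableForms.
Context {R : realType}.
Implicit Types (m : memory R).

Definition is_row N m a (v : 'rV[R]_N) := forall k : 'I_N, rarr m a k = v 0 k.

Definition is_mx r s m a (M : 'M[R]_(r, s)) :=
  forall (i : 'I_r) (j : 'I_s), rarr m a (i * s + j)%N = M i j.

Lemma is_mx_eq r s m m' a (M : 'M[R]_(r, s)) :
  (forall l, rarr m' a l = rarr m a l) -> is_mx m a M -> is_mx m' a M.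
Proof. by move=> h mv i j; rewrite h. Qed.

Lemma den_table0 a inner e m : table_ok a [::] inner e ->
  rarr (den (table a [::] inner e) m) a 0 = nsum inner m e.
Proof. by move=> ok; exact: (den_table (s := [::]) ok). Qed.

Lemma den_table1 a v b inner e m i : table_ok a [:: (v, b)] inner e ->
  (i < bval (ireg m 0) (ireg m 1) b)%N ->
  rarr (den (table a [:: (v, b)] inner e) m) a i = nsum inner (set_ireg m v i) e.
Proof.
move=> ok iN; have := den_table (m := m) (s := [:: i]) ok.
by rewrite /= iN ?mul0n ?add0n => /(_ isT).
Qed.

Lemma den_table2 a v b w c inner e m i j :
  table_ok a [:: (v, b); (w, c)] inner e ->
  (i < bval (ireg m 0) (ireg m 1) b)%N -> (j < bval (ireg m 0) (ireg m 1) c)%N ->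
  rarr (den (table a [:: (v, b); (w, c)] inner e) m) a
    (i * bval (ireg m 0) (ireg m 1) c + j)%N =
  nsum inner (set_ireg (set_ireg m v i) w j) e.
Proof.
move=> ok iN jN; have := den_table (m := m) (s := [:: i; j]) ok.
by rewrite /= iN jN ?mul0n ?add0n => /(_ isT).
Qed.

Lemma den_table_ireg a ls inner e m v :
  v \notin loop_vars ls ++ loop_vars inner ->
  ireg (den (table a ls inner e) m) v = ireg m v.
Proof.
move=> h; apply: den_ireg.
by rewrite /table /table_body wregs_nest /= wregs_nest /= !cats0.
Qed.

Lemma den_for_ind v b c m (I : nat -> memory R -> Prop) :
  I 0%N (set_ireg m v 0) ->
  (forall j m', (j < bval (ireg m 0) (ireg m 1) b)%N -> ireg m' v = j -> I j m' ->
     I j.+1 (set_ireg (den c m') v j.+1)) ->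
  I (bval (ireg m 0) (ireg m 1) b) (den (FFor v b c) m).
Proof.
move=> I0 IS /=; rewrite ieval_bexpr; set N := bval _ _ _ in IS *.
suff H j : (j <= N)%N -> I j (iteri j (for_step (den c) v) (set_ireg m v 0)).
  exact: H.
elim: j => [//|j IH] jN /=.
by apply: IS => //; [exact: iter_ireg_var | exact/IH/ltnW].
Qed.

End TableForms.

Section Expressions.
Context {R : realType}.
Implicit Types (m : memory R).
Local Open Scope nat_scope.

(** Truncated subtraction encodes the 0/1 indicators of equality and strict order as index
    expressions, which [RNat] turns into reals. *)
Definition ieq (x y : iexp) : iexp :=
  ISub (ICst 1) (IAdd (ISub x y) (ISub y x)).

Definition ilt (x y : iexp) : iexp := ISub (ICst 1) (ISub (ICst 1) (ISub y x)).

Definition scal (a : nat) : rexp := RGet a (ICst 0).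

Definition nat_r (k : nat) : rexp := RNat (ICst k).

Definition cell (a : nat) (i : iexp) (b : bnd) (j : iexp) : rexp :=
  RGet a (IAdd (IMul i (bexpr b)) j).

Definition copy_mx dst src b c : fcom :=
  table dst [:: (10, b); (11, c)] [::] (cell src (IVar 10) c (IVar 11)).

Definition copy_row dst src b : fcom :=
  table dst [:: (10, b)] [::] (RGet src (IVar 10)).

Lemma ieval_ieq m x y : ieval m (ieq x y) = (ieval m x == ieval m y).
Proof. by rewrite /=; case: eqP => [->|]; lia. Qed.

Lemma ieval_ilt m x y : ieval m (ilt x y) = (ieval m x < ieval m y).
Proof. by rewrite /=; case: ltnP; lia. Qed.

Lemma reval_cell m a i b j : reval m (cell a i b j) =
  rarr m a (ieval m i * bval (ireg m 0) (ireg m 1) b + ieval m j).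
Proof. by rewrite /= ieval_bexpr. Qed.

Lemma reval_scal m a : reval m (scal a) = rarr m a 0.
Proof. by []. Qed.

Lemma table_mx a v b w c inner e m r s (F : 'M[R]_(r, s)) :
  table_ok a [:: (v, b); (w, c)] inner e ->
  bval (ireg m 0) (ireg m 1) b = r -> bval (ireg m 0) (ireg m 1) c = s ->
  (forall (i : 'I_r) (j : 'I_s),
     nsum inner (set_ireg (set_ireg m v i) w j) e = F i j) ->
  is_mx (den (table a [:: (v, b); (w, c)] inner e) m) a F.
Proof.
move=> ok br cs FE i j.
have ib : i < bval (ireg m 0) (ireg m 1) b by rewrite br.
have jc : j < bval (ireg m 0) (ireg m 1) c by rewrite cs.
by have := den_table2 ok ib jc; rewrite cs FE.
Qed.

Lemma table_row a v b inner e m r (F : 'rV[R]_r) :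
  table_ok a [:: (v, b)] inner e -> bval (ireg m 0) (ireg m 1) b = r ->
  (forall (i : 'I_r), nsum inner (set_ireg m v i) e = F 0%R i) ->
  is_row (den (table a [:: (v, b)] inner e) m) a F.
Proof. by move=> ok br FE i; rewrite -FE den_table1// br. Qed.

Lemma copy_mxP dst src b c m r s (F : 'M[R]_(r, s)) :
  table_ok dst [:: (10, b); (11, c)] [::] (cell src (IVar 10) c (IVar 11)) ->
  bval (ireg m 0) (ireg m 1) b = r -> bval (ireg m 0) (ireg m 1) c = s ->
  is_mx m src F -> is_mx (den (copy_mx dst src b c) m) dst F.
Proof.
move=> ok br cs mF; apply: table_mx => // i j.
by rewrite /nsum reval_cell /= cs mF.
Qed.

Lemma copy_rowP dst src b m r (F : 'rV[R]_r) :
  table_ok dst [:: (10, b)] [::] (RGet src (IVar 10)) ->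
  bval (ireg m 0) (ireg m 1) b = r ->
  is_row m src F -> is_row (den (copy_row dst src b) m) dst F.
Proof. by move=> ok br mF; apply: table_row => // i; rewrite /= mF. Qed.

End Expressions.

Section EvaluationRules.
Context {R : realType}.
Implicit Types (m : memory R).
Local Open Scope nat_scope.

Lemma den_seq c1 c2 m : den (FSeq c1 c2) m = den c2 (den c1 m).
Proof. by []. Qed.

Lemma den_if b c1 c2 m :
  den (FIf b c1 c2) m = if beval m b then den c1 m else den c2 m.
Proof. by []. Qed.

Lemma reval_nat m e : reval m (RNat e) = (ieval m e)%:R%R. Proof. by []. Qed.
Lemma reval_get m a e : reval m (RGet a e) = rarr m a (ieval m e). Proof. by []. Qed.
Lemma reval_add m x y : reval m (RAdd x y) = (reval m x + reval m y)%R.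
Proof. by []. Qed.
Lemma reval_sub m x y : reval m (RSub x y) = (reval m x - reval m y)%R.
Proof. by []. Qed.
Lemma reval_mul m x y : reval m (RMul x y) = (reval m x * reval m y)%R.
Proof. by []. Qed.
Lemma reval_div m x y : reval m (RDiv x y) = (reval m x / reval m y)%R.
Proof. by []. Qed.
Lemma reval_sqrt m x : reval m (RSqrt x) = Num.sqrt (reval m x).
Proof. by []. Qed.
Lemma ieval_cst m n : ieval m (ICst n) = n. Proof. by []. Qed.
Lemma ieval_var m v : ieval m (IVar v) = ireg m v. Proof. by []. Qed.
Lemma ieval_add m x y : ieval m (IAdd x y) = ieval m x + ieval m y.
Proof. by []. Qed.
Lemma ieval_sub m x y : ieval m (ISub x y) = ieval m x - ieval m y.
Proof. by []. Qed.
Lemma ieval_mul m x y : ieval m (IMul x y) = ieval m x * ieval m y.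
Proof. by []. Qed.
Lemma ireg_set m v n w : ireg (set_ireg m v n) w = if w == v then n else ireg m w.
Proof. by []. Qed.
Lemma rarr_set m v n : rarr (set_ireg m v n) = rarr m.
Proof. by []. Qed.

End EvaluationRules.

Definition evalE {R : realType} := (@ieval_ieq R, @ieval_ilt R, @reval_cell R,
  @reval_scal R, @ieval_bexpr R, @reval_nat R, @reval_get R, @reval_add R,
  @reval_sub R, @reval_mul R, @reval_div R, @reval_sqrt R, @ieval_cst R,
  @ieval_var R, @ieval_add R, @ieval_sub R, @ieval_mul R, @ireg_set R,
  @rarr_set R).

Opaque den reval ieval.

Section Sweep.
Context {R : realType}.
Implicit Types (m : memory R).
Local Open Scope nat_scope.

Definition pivot_expr (s : nat) (b : bnd) : rexp :=
  let k := IVar 20 in let i := IVar 10 in let j := IVar 11 in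
  let di := RNat (ieq i k) in let dj := RNat (ieq j k) in
  let g i j := cell s i b j in
  RAdd (RSub (RAdd
    (RMul (RMul (RSub (nat_r 1) di) (RSub (nat_r 1) dj))
          (RSub (g i j) (RDiv (RMul (g i k) (g k j)) (g k k))))
    (RMul (RMul di dj) (RDiv (nat_r 1) (g k k))))
    (RMul (RMul di (RSub (nat_r 1) dj)) (RDiv (g k j) (g k k))))
    (RMul (RMul (RSub (nat_r 1) di) dj) (RDiv (g i k) (g k k))).

Definition witness_expr (s : nat) (b : bnd) : rexp :=
  RAdd (RMul (RNat (ilt (IVar 10) (IVar 20))) (cell s (IVar 10) b (IVar 20)))
       (RNat (ieq (IVar 10) (IVar 20))).

(* Inverts the matrix in array [s] by principal pivots; a pivot that is not
   positive clears the flag in array 17 and leaves a witness in array [x]. *)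
Definition sweep_step (s : nat) (b : bnd) (x : nat) : fcom :=
  FIf (RLe (scal 17) (nat_r 0)) FSkip
    (FIf (RLe (cell s (IVar 20) b (IVar 20)) (nat_r 0))
      (FSeq (table 17 [::] [::] (nat_r 0))
            (table x [:: (10, b)] [::] (witness_expr s b)))
      (FSeq (table 9 [:: (10, b); (11, b)] [::] (pivot_expr s b))
            (copy_mx s 9 b b))).

Definition sweep s b x : fcom :=
  FSeq (table 17 [::] [::] (nat_r 1)) (FFor 20 b (sweep_step s b x)).

Lemma den_sweep s b x m q (M : 'M[R]_q) :
  (* The two cases are the uses for [S(c)] and for the Hessian; concrete array numbers let the
     disjointness conditions be decided by computation. *)
  (s, x) = (8, 14) \/ (s, x) = (10, 28) ->
  bval (ireg m 0) (ireg m 1) b = q -> (M^T)%R = M -> is_mx m s M ->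
  let m' := den (sweep s b x) m in
  (rarr m' 17 0 = 1%R /\ posdef M /\ is_mx m' s (invmx M)) \/
  (rarr m' 17 0 = 0%R /\ exists u : 'rV[R]_q,
     is_row m' x u /\ (u != 0)%R /\ (dot (u *m M) u <= 0)%R).
Proof.
move=> sx bq sM mM; rewrite /sweep den_seq /=.
set m0 := den (table 17 _ _ _) m; set m1 := den _ _.
have r0 v : v <= 1 -> ireg m0 v = ireg m v by move=> _; exact: den_table_ireg.
have okw : table_ok x [:: (10, b)] [::] (witness_expr s b).
  by case: sx => -[-> ->]; case: (b).
have okp : table_ok 9 [:: (10, b); (11, b)] [::] (pivot_expr s b).
  by case: sx => -[-> _]; case: (b).
have okc : table_ok s [:: (10, b); (11, b)] [::] (cell 9 (IVar 10) b (IVar 11)).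
  by case: sx => -[-> _]; case: (b).
(* Once the flag is 0 the remaining iterations do nothing, so the witness survives to the end. *)
pose I j (m' : memory R) :=
  [/\ ireg m' 0 = ireg m 0, ireg m' 1 = ireg m 1 &
  (rarr m' 17 0 = 1%R /\ exists N, is_mx m' s N /\ pivoted M j N) \/
  (rarr m' 17 0 = 0%R /\ exists u : 'rV[R]_q,
     is_row m' x u /\ (u != 0)%R /\ (dot (u *m M) u <= 0)%R)].
suff [_ _ [[f1 [N [mN pN]]]|]] : I q m1.
- have [pM iM] := pivoted_inv sM pN; left; split=> //; split=> //.
  by rewrite iM.
- by right.
rewrite /m1 -bq -!(r0 _ _)//; apply: den_for_ind => [|j m' jq jr [i0 i1 Ij]].
  split; rewrite ?evalE /= ?r0//; left; split.
    by rewrite /m0 den_table0// /nsum !evalE.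
  exists M; split; last exact: pivoted0.
  apply: is_mx_eq mM => l; rewrite rarr_set /m0 table_rarr//.
  by case: sx => -[-> _].
have bq' : bval (ireg m' 0) (ireg m' 1) b = q by rewrite i0 i1.
have jq' : j < q by rewrite -bq -!(r0 _ _).
pose k := Ordinal jq'.
have keep c : (forall v, v <= 1 -> ireg (den c m') v = ireg m' v) ->
    ((rarr (den c m') 17 0 = 1%R /\ exists N, is_mx (den c m') s N /\ pivoted M j.+1 N) \/
     (rarr (den c m') 17 0 = 0%R /\ exists u : 'rV[R]_q,
     is_row (den c m') x u /\ (u != 0)%R /\ (dot (u *m M) u <= 0)%R)) ->
    I j.+1 (set_ireg (den c m') 20 j.+1).
  move=> h1 h2; split; rewrite ?ireg_set /= ?h1//.
apply: keep.
  move=> v v1; apply: den_ireg; rewrite /= !inE; apply/negP; lia.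
rewrite /sweep_step den_if /beval !evalE /=.
case: Ij => [[f1 [N [mN pN]]]|[f0 ux]]; last first.
  by rewrite f0 lexx; right.
rewrite f1 ler10 den_if /beval !evalE /= bq' jr (mN k k).
have rs l (c : bnd) inner e ls m2 : s \notin [:: 5; l] -> rarr (den (table l ls inner e) m2) s =1 rarr m2 s.
  by move=> sl l'; rewrite table_rarr.
case: ifP => [p0|/negbT p0]; rewrite den_seq.
  right; split.
    rewrite table_rarr ?den_table0// /nsum ?evalE//.
    by case: sx => -[_ ->].
  have [u0 uM] := pivoted_witness sM (pN : pivoted M k N) p0.
  exists (\row_i ((i < k)%N%:R * N i k + (i == k)%:R)%R); split=> //.
  apply: table_row; rewrite ?den_table_ireg//.
  move=> i; rewrite /nsum !evalE /= !den_table_ireg//.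
  rewrite bq' jr table_rarr; last by case: sx => -[-> _].
  by rewrite (mN i k) !mxE.
left; split.
  rewrite /copy_mx !table_rarr//; first by case: sx => -[-> _].
exists (pivot_mx k N); split; last by apply: (pivotedS (pN : pivoted M k N)); rewrite ltNge.
apply: copy_mxP; rewrite ?den_table_ireg//.
apply: table_mx => // i j'.
rewrite /nsum !evalE /= bq' jr.
by rewrite (mN i j') (mN i k) (mN k j') (mN k k) mxE.
Qed.

End Sweep.

(** * Computation of the gradient *)

Transparent reval ieval.

Section GradientProgram.
Local Open Scope nat_scope.

Definition seqs (cs : seq fcom) : fcom := foldr FSeq FSkip cs.

(* Arrays: 3 center, 4 shape, 5 and 9 scratch, 6 basis matrices, 7 coordinates
   of the announced matrices, 8 S(c) and its inverse, 10 Hessian and its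
   inverse, 14 and 28 pivoting witnesses, 15 gradient or separating vector,
   16 its traceless part, 17 pivoting flag, 20 bound on det B (0 when done),
   21 flag for vanishing losses; the others hold intermediate sums. *)
Definition basis_cell (k i j : iexp) : rexp :=
  RGet 6 (IAdd (IMul (IAdd (IMul k (bexpr Bp)) i) (bexpr Bp)) j).

Definition half_lam : rexp := RDiv (RGet 0 (ICst 0)) (nat_r 2).

Definition losses_prog : fcom :=
  table 13 [:: (18, Bt)] [:: (12, Bn)]
    (RMul (cell 7 (IVar 18) Bn (IVar 12)) (RGet 3 (IVar 12))).

Definition loss_hessian_prog : fcom :=
  table 25 [:: (12, Bn); (13, Bn)] [:: (18, Bt)]
    (RDiv (RMul (cell 7 (IVar 18) Bn (IVar 12)) (cell 7 (IVar 18) Bn (IVar 13)))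
      (RMul (RGet 13 (IVar 18)) (RGet 13 (IVar 18)))).

(** Two indices below [d ^ 2] and four below [2 d]: this table and [weight_prog] are the ones of
    degree 8 in [d]. *)
Definition trace_prog : fcom :=
  table 24 [:: (12, Bn); (13, Bn)] [:: (14, Bp); (16, Bp); (15, Bp); (17, Bp)]
    (RMul (RMul (cell 8 (IVar 14) Bp (IVar 15)) (basis_cell (IVar 12) (IVar 15) (IVar 16)))
      (RMul (cell 8 (IVar 16) Bp (IVar 17)) (basis_cell (IVar 13) (IVar 17) (IVar 14)))).

Definition hessian_prog : fcom :=
  table 10 [:: (12, Bn); (13, Bn)] [::]
    (RAdd (cell 25 (IVar 12) Bn (IVar 13))
      (RMul half_lam (cell 24 (IVar 12) Bn (IVar 13)))).

Definition weight_prog : fcom :=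
  table 11 [:: (14, Bp); (17, Bp)] [:: (12, Bn); (13, Bn); (16, Bp); (15, Bp)]
    (RMul (cell 10 (IVar 12) Bn (IVar 13))
      (RMul (RMul (basis_cell (IVar 12) (IVar 14) (IVar 15)) (cell 8 (IVar 15) Bp (IVar 16)))
        (basis_cell (IVar 13) (IVar 16) (IVar 17)))).

Definition loss_leverage_prog : fcom :=
  table 12 [:: (18, Bt)] [:: (13, Bn); (12, Bn)]
    (RMul (RMul (cell 7 (IVar 18) Bn (IVar 12)) (cell 10 (IVar 12) Bn (IVar 13)))
      (cell 7 (IVar 18) Bn (IVar 13))).

Definition log_losses_prog : fcom :=
  table 30 [:: (12, Bn)] [:: (18, Bt)]
    (RDiv (cell 7 (IVar 18) Bn (IVar 12)) (RGet 13 (IVar 18))).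

Definition log_det_prog : fcom :=
  table 31 [:: (12, Bn)] [:: (14, Bp); (15, Bp)]
    (RMul (cell 8 (IVar 14) Bp (IVar 15)) (basis_cell (IVar 12) (IVar 15) (IVar 14))).

Definition vol_losses_prog : fcom :=
  table 32 [:: (12, Bn)] [:: (18, Bt)]
    (RDiv (RMul (RGet 12 (IVar 18)) (cell 7 (IVar 18) Bn (IVar 12)))
      (RMul (RGet 13 (IVar 18)) (RMul (RGet 13 (IVar 18)) (RGet 13 (IVar 18))))).

Definition vol_det_prog : fcom :=
  table 33 [:: (12, Bn)] [:: (14, Bp); (15, Bp); (17, Bp); (16, Bp)]
    (RMul (basis_cell (IVar 12) (IVar 14) (IVar 15))
      (RMul (RMul (cell 8 (IVar 15) Bp (IVar 16)) (cell 11 (IVar 16) Bp (IVar 17)))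
        (cell 8 (IVar 17) Bp (IVar 14)))).

Definition assemble_prog : fcom :=
  table 15 [:: (12, Bn)] [::]
    (RAdd (RSub (RSub (nat_r 0) (RGet 30 (IVar 12))) (RMul half_lam (RGet 31 (IVar 12))))
      (RMul (RGet 0 (ICst 1))
        (RSub (RSub (nat_r 0) (RGet 32 (IVar 12))) (RMul half_lam (RGet 33 (IVar 12)))))).

Definition gradient_prog : fcom := seqs [:: losses_prog; loss_hessian_prog;
  trace_prog; hessian_prog; sweep 10 Bn 28; weight_prog; loss_leverage_prog;
  log_losses_prog; log_det_prog; vol_losses_prog; vol_det_prog; assemble_prog].

Definition separation_prog : fcom :=
  table 15 [:: (12, Bn)] [:: (15, Bp); (14, Bp)]
    (RSub (nat_r 0) (RMul (RMul (RGet 14 (IVar 14))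
       (basis_cell (IVar 12) (IVar 14) (IVar 15))) (RGet 14 (IVar 15)))).

End GradientProgram.

Section Framing.
Context {R : realType}.
Implicit Types (m : memory R).

Lemma den_seqs_cons p ps m : den (seqs (p :: ps)) m = den (seqs ps) (den p m).
Proof. exact: den_seq. Qed.

Lemma den_seqs_nil m : den (seqs [::]) m = m.
Proof. by []. Qed.

Lemma keep_row p m b N (v : 'rV[R]_N) : b \notin warrs p ->
  is_row m b v -> is_row (den p m) b v.
Proof. by move=> bp mv k; rewrite den_rarr. Qed.

Lemma keep_mx p m b r s (M : 'M[R]_(r, s)) : b \notin warrs p ->
  is_mx m b M -> is_mx (den p m) b M.
Proof. by move=> bp mv i j; rewrite den_rarr. Qed.

Lemma keep_scal p m b (r : R) : b \notin warrs p ->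
  rarr m b 0 = r -> rarr (den p m) b 0 = r.
Proof. by move=> bp <-; rewrite den_rarr. Qed.

End Framing.

(* Steps over the program [p]: the facts about the memory [m] that [p] does not
   destroy become facts about [den p m], which is then renamed to [m]. *)
Ltac step_over p m keep_inv :=
  rewrite den_seqs_cons; keep_inv p m;
  repeat match goal with
  | H : is_mx m ?b _ |- _ => apply (keep_mx (p := p) (b := b) isT) in H
  | H : is_row m ?b _ |- _ => apply (keep_row (p := p) (b := b) isT) in H
  | H : rarr m ?b 0 = _ |- _ => apply (keep_scal (p := p) (b := b) isT) in H
  end;
  let m' := fresh "m" in
  set (m' := den p m) in *; clearbody m'; clear dependent m; rename m' into m.

Section GradientCorrectness.
Context {R : realType} {d : nat}.
Variables (lam mu eps : R) (A : nat -> 'M[complex R]_d) (t : nat).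
Implicit Types (m : memory R).
Local Notation S := (@herm_basis R d).
Local Notation a := (@loss_coords R d A t).

Record setup m : Prop := Setup {
  setup_d : ireg m 0 = d;
  setup_t : ireg m 1 = t;
  setup_lam : rarr m 0 0 = lam;
  setup_mu : rarr m 0 1 = mu;
  setup_eps : rarr m 0 2 = eps;
  setup_basis : forall (k : 'I_(d * d)) (i j : 'I_(d + d)),
    rarr m 6 ((k * (d + d) + i) * (d + d) + j)%N = S k i j;
  setup_loss : forall (tau : 'I_t) (k : 'I_(d * d)),
    rarr m 7 (tau * (d * d) + k)%N = a tau 0 k }.

Lemma setup_keep c m : wf c -> all (fun b => b \notin warrs c) [:: 0; 6; 7]%N ->
  setup m -> setup (den c m).
Proof.
move=> wc /and4P[n0 n6 n7 _] [h0 h1 hl hm he hb ha].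
split; rewrite ?den_ireg ?den_rarr ?wf_wregs// => *; rewrite den_rarr//.
Qed.

Lemma separation_progP m (u : 'rV[R]_(d + d)) : setup m -> is_row m 14 u ->
  is_row (den separation_prog m) 15 (\row_k - dot (u *m S k) u).
Proof.
move=> [h0 h1 hl hm he hb ha] mu14; apply: table_row => //=; first by rewrite h0.
move=> k; rewrite h0 mxE dotE -sumrN; apply: eq_bigr => j _.
rewrite mxE mulr_suml -sumrN; apply: eq_bigr => i _.
by rewrite hb !mu14 sub0r.
Qed.

Definition state m c (X : 'M[R]_(d + d)) :=
  [/\ setup m, is_mx m 8 X & is_row m 13 (\row_tau dot (a tau) c)].

Lemma state_keep p m c X : wf p ->
  all (fun b => b \notin warrs p) [:: 0; 6; 7; 8; 13]%N ->
  state m c X -> state (den p m) c X.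
Proof.
move=> wp /and5P[n0 n6 n7 n8 /andP[n13 _]] [s0 x8 l13]; split.
- by apply: setup_keep => //=; rewrite n0 n6 n7.
- exact: keep_mx.
- exact: keep_row.
Qed.

Ltac keep_state p m :=
  match goal with
  | H : state m _ _ |- _ => apply (state_keep (p := p) isT isT) in H
  end.

Lemma losses_progP m c : setup m -> is_row m 3 c ->
  is_row (den losses_prog m) 13 (\row_tau dot (a tau) c).
Proof.
move=> s0 r3; apply: table_row => //=; first exact: setup_t.
move=> tau; rewrite (setup_d s0) mxE dotE; apply: eq_bigr => k _.
by rewrite r3 (setup_loss s0).
Qed.

Lemma loss_hessian_progP m c X : state m c X ->
  is_mx (den loss_hessian_prog m) 25 (\matrix_(k < d * d, l < d * d)
    \sum_tau a tau 0 k * a tau 0 l / dot (a tau) c ^+ 2).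
Proof.
move=> [s0 x8 e13]; apply: table_mx => //=; rewrite ?(setup_d s0)// => k l.
rewrite (setup_t s0) mxE; apply: eq_bigr => tau _.
by rewrite !(setup_loss s0) e13 mxE expr2.
Qed.

Lemma trace_progP m c X : state m c X ->
  is_mx (den trace_prog m) 24
    (\matrix_(k < d * d, l < d * d) \tr (X *m S k *m (X *m S l))).
Proof.
move=> [s0 x8 e13]; apply: table_mx => //=; rewrite ?(setup_d s0)// => k l.
rewrite mxE; apply: eq_bigr => i _; rewrite mxE; apply: eq_bigr => j _.
rewrite !mxE big_distrlr; apply: eq_bigr => i' _; apply: eq_bigr => j' _.
by rewrite !(setup_basis s0) !x8.
Qed.

Lemma hessian_progP m c : setup m ->
  is_mx m 25 (\matrix_(k < d * d, l < d * d)
    \sum_tau a tau 0 k * a tau 0 l / dot (a tau) c ^+ 2) ->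
  is_mx m 24 (\matrix_(k < d * d, l < d * d)
    \tr (invmx (pencil S c) *m S k *m (invmx (pencil S c) *m S l))) ->
  is_mx (den hessian_prog m) 10 (hess_mx S a lam c).
Proof.
move=> s0 e25 e24; apply: table_mx => //=; rewrite ?(setup_d s0)// => k l.
by rewrite e25 e24 !mxE (setup_lam s0).
Qed.

Lemma weight_progP m c : state m c (invmx (pencil S c)) ->
  is_mx m 10 (invmx (hess_mx S a lam c)) ->
  is_mx (den weight_prog m) 11 (vol_weight S a lam c).
Proof.
move=> [s0 x8 _] e10; apply: table_mx => //=; rewrite ?(setup_d s0)// => i j.
rewrite summxE; apply: eq_bigr => k _; rewrite summxE; apply: eq_bigr => l _.
rewrite mxE mxE mulr_sumr; apply: eq_bigr => i' _.
rewrite mxE mulr_suml mulr_sumr; apply: eq_bigr => j' _.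
by rewrite !(setup_basis s0) !x8 e10.
Qed.

Lemma loss_leverage_progP m c X : state m c X ->
  is_mx m 10 (invmx (hess_mx S a lam c)) ->
  is_row (den loss_leverage_prog m) 12
    (\row_tau dot (a tau *m invmx (hess_mx S a lam c)) (a tau)).
Proof.
move=> [s0 _ _] e10; apply: table_row => //=; first exact: setup_t.
move=> tau; rewrite (setup_d s0) mxE dotE; apply: eq_bigr => l _.
rewrite mxE mulr_suml; apply: eq_bigr => k _.
by rewrite !(setup_loss s0) e10.
Qed.

Lemma log_losses_progP m c X : state m c X ->
  is_row (den log_losses_prog m) 30
    (\row_(k < d * d) \sum_tau a tau 0 k / dot (a tau) c).
Proof.
move=> [s0 _ e13]; apply: table_row => //=; rewrite ?(setup_d s0)// => k.
rewrite (setup_t s0) mxE; apply: eq_bigr => tau _.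
by rewrite !(setup_loss s0) e13 mxE.
Qed.

Lemma log_det_progP m c X : state m c X ->
  is_row (den log_det_prog m) 31 (\row_(k < d * d) \tr (X *m S k)).
Proof.
move=> [s0 x8 _]; apply: table_row => //=; rewrite ?(setup_d s0)// => k.
rewrite mxE; apply: eq_bigr => i _; rewrite mxE; apply: eq_bigr => j _.
by rewrite !(setup_basis s0) x8.
Qed.

Lemma vol_losses_progP m c X : state m c X ->
  is_row m 12 (\row_tau dot (a tau *m invmx (hess_mx S a lam c)) (a tau)) ->
  is_row (den vol_losses_prog m) 32 (\row_(k < d * d)
    \sum_tau dot (a tau *m invmx (hess_mx S a lam c)) (a tau) * a tau 0 k
      / dot (a tau) c ^+ 3).
Proof.
move=> [s0 _ e13] e12; apply: table_row => //=; rewrite ?(setup_d s0)// => k.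
rewrite (setup_t s0) mxE; apply: eq_bigr => tau _.
by rewrite !(setup_loss s0) e13 e12 !mxE.
Qed.

Lemma vol_det_progP m c X W : state m c X -> is_mx m 11 W ->
  is_row (den vol_det_prog m) 33
    (\row_(k < d * d) \tr (S k *m (X *m W *m X))).
Proof.
move=> [s0 x8 _] e11; apply: table_row => //=; rewrite ?(setup_d s0)// => k.
rewrite mxE; apply: eq_bigr => i _; rewrite mxE; apply: eq_bigr => j _.
rewrite [(X *m W *m X) j i]mxE mulr_sumr; apply: eq_bigr => i' _.
rewrite [(X *m W) j i']mxE mulr_suml mulr_sumr; apply: eq_bigr => j' _.
by rewrite !(setup_basis s0) !x8 e11.
Qed.

Lemma assemble_progP m c (X := invmx (pencil S c)) (H := hess_mx S a lam c) :
  setup m ->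
  is_row m 30 (\row_(k < d * d) \sum_tau a tau 0 k / dot (a tau) c) ->
  is_row m 31 (\row_(k < d * d) \tr (X *m S k)) ->
  is_row m 32 (\row_(k < d * d)
    \sum_tau dot (a tau *m invmx H) (a tau) * a tau 0 k / dot (a tau) c ^+ 3) ->
  is_row m 33 (\row_(k < d * d) \tr (S k *m (X *m vol_weight S a lam c *m X))) ->
  is_row (den assemble_prog m) 15 (grad_objective lam mu A t c).
Proof.
move=> s0 e30 e31 e32 e33; apply: table_row => //=; rewrite ?(setup_d s0)// => k.
by rewrite e30 e31 e32 e33 (setup_lam s0) (setup_mu s0) !sub0r !mxE.
Qed.

Lemma hess_mx_sym c : (hess_mx S a lam c)^T = hess_mx S a lam c.
Proof.
apply/matrixP => k l; rewrite mxE [LHS]mxE [RHS]mxE mxtrace_mulC; congr (_ + _).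
by apply: eq_bigr => tau _; rewrite [a tau 0 l * _]mulrC.
Qed.

Lemma gradient_progP m c : 0 < lam -> feasible S a c ->
  setup m -> is_row m 3 c -> is_mx m 8 (invmx (pencil S c)) ->
  is_row (den gradient_prog m) 15 (grad_objective lam mu A t c).
Proof.
move=> lam0 fc; set X := invmx _ => s0 r3 x8.
rewrite /gradient_prog den_seqs_cons.
have {s0 r3 x8} : state (den losses_prog m) c X.
  split; [exact: setup_keep|exact: keep_mx|exact: losses_progP].
move: (den _ m) => {}m st.
have e25 := loss_hessian_progP st.
step_over loss_hessian_prog m keep_state.
have e24 := trace_progP st.
step_over trace_prog m keep_state.
have e10 := let: And3 s0 _ _ := st in hessian_progP s0 e25 e24.
step_over hessian_prog m keep_state.
(* Pivoting cannot fail here, as the Hessian is positive definite at a feasible point. *)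
have {}e10 : is_mx (den (sweep 10 Bn 28) m) 10 (invmx (hess_mx S a lam c)).
  have bq : bval (ireg m 0) (ireg m 1) Bn = (d * d)%N.
    by case: st => s0 _ _; rewrite /= (setup_d s0).
  have [[_ [_ //]]|[_ [u [_ [u0 /le_gtF uH]]]]] :=
    den_sweep (or_intror erefl) bq (hess_mx_sym c) e10.
  have pH : posdef (hess_mx S a lam c).
    exact: (posdef_hess (@herm_basis_sym R d) (@herm_basis_inj R d)).
  by have [_ /(_ u u0)] := pH; rewrite uH.
step_over (sweep 10 Bn 28) m keep_state.
have e11 := weight_progP st e10.
step_over weight_prog m keep_state.
have e12 := loss_leverage_progP st e10.
step_over loss_leverage_prog m keep_state.
have e30 := log_losses_progP st.
step_over log_losses_prog m keep_state.
have e31 := log_det_progP st.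
step_over log_det_prog m keep_state.
have e32 := vol_losses_progP st e12.
step_over vol_losses_prog m keep_state.
have e33 := vol_det_progP st e11.
step_over vol_det_prog m keep_state.
by rewrite den_seqs_cons; case: st => s0 _ _; apply: assemble_progP.
Qed.

End GradientCorrectness.

(** * Iterations of the ellipsoid method *)

Section EllipsoidSteps.
Context {R : realType} {d : nat}.
Variables (lam mu : R) (A : nat -> 'M[complex R]_d) (t : nat).
Hypotheses (d0 : (0 < d)%N) (lam0 : 0 < lam) (mu0 : 0 < mu).
Hypothesis psdA : forall tau, (tau < t)%N -> psd (A tau).
Implicit Types (c g u v : 'rV[R]_(d * d)) (B : 'M[R]_(d * d)).

Local Notation S := (@herm_basis R d).
Local Notation P := (Pt lam mu A t).
Local Notation idv := (@diag_coords R d).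
Local Notation n := (d * d)%N.

Definition traceless_part g := g - (dot idv g / d%:R) *: idv.

Lemma dot_traceless_part g u : dot idv u = 0 ->
  dot (traceless_part g) u = dot g u.
Proof. by move=> u0; rewrite dotDl dotNl dotZl u0 mulr0 subr0. Qed.

Lemma traceless_partP g : dot idv (traceless_part g) = 0.
Proof.
rewrite dotDr dotNr dotZr dot_diag_coords -mulrA mulVf ?mulr1 ?subrr//.
by rewrite pnatr_eq0 -lt0n.
Qed.

(** For [d = 1] a traceless vector is 0. This provides the [1 < n] on which the bounds for cuts
    rely. *)
Lemma traceless_gt1 g : g != 0 -> dot idv g = 0 -> (1 < n)%N.
Proof.
move=> g0 ig; have n0 : (0 < n)%N by rewrite muln_gt0 d0.
rewrite ltnNge; apply: contraNN g0 => n1.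
have d1 : d = 1%N by apply/eqP; move: n1 n0; clear; nia.
apply/eqP/rowP => k; rewrite mxE.
have k0 (l : 'I_n) : l = k by apply/val_inj; case: l k => l hl [k hk] /=; lia.
have idk : idv 0 k = 1.
  case/mxvec_indexP: k k0 => i j _; rewrite mxvecE mxE.
  by case: eqP => // -[]; apply/val_inj; case: i j => i hi [j hj] /=; lia.
move: ig; rewrite dotE (bigD1 k)//= big1; last by move=> l; rewrite (k0 l) eqxx.
by rewrite addr0 idk mul1r.
Qed.

(** [r] is the bound on the determinant that the program maintains. The shape preserves the
    hyperplane of traceless vectors, so a cut along it moves the center within unit trace. *)
Record step_state k c B (r : R) : Prop := StepState {
  state_method : ellipsoid_method P k c B;
  state_posdef : posdef B;
  state_traceless : forall u, dot idv u = 0 -> dot idv (u *m B) = 0;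
  state_trace : dot idv c = 1;
  state_det : \det B <= r;
  state_minimizer : exists2 x, ellipsoid c B x & minimizer P (herm x) }.

Record stop_state k c B (r : R) : Prop := StopState {
  stop_method : ellipsoid_method P k c B;
  stop_posdef : posdef B;
  stop_det : \det B <= r;
  stop_minimizer : exists2 x, ellipsoid c B x & minimizer P (herm x) }.

Lemma det_scale_le m (s : R) (B : 'M[R]_m) : (0 < m)%N -> posdef B ->
  \det B <= 1 -> 0 < s < 1 -> \det (s *: B) <= s.
Proof.
case: m B => // m B _ pB B1 /andP[s0 s1]; rewrite detZ exprS -mulrA.
have h : s ^+ m * \det B <= 1.
  by rewrite mulr_ile1 ?exprn_ge0 ?exprn_ile1 ?(ltW s0) ?(ltW s1)// ltW// posdef_det_gt0.
by rewrite ger_pMr.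
Qed.

Lemma shrink_state k c B (s : R) : ellipsoid_method P k c B -> posdef B ->
  \det B <= 1 -> minimizer P (herm c) -> 0 < s < 1 ->
  stop_state k.+1 c (s *: B) s.
Proof.
move=> em pB B1 mc s01; have /andP[s0 _] := s01; split.
- exact: em_optimal.
- exact: posdefZ.
- by apply: det_scale_le => //; rewrite muln_gt0 d0.
- exists c => //; rewrite /ellipsoid /= subrr mul0mx dot0l; exact: ler01.
Qed.

Lemma cut_state k c B g r : step_state k c B r -> dot idv g = 0 -> g != 0 ->
  gradient_cut P c g \/ feasibility_cut P c g ->
  (forall x, minimizer P (herm x) -> dot g (x - c) <= 0) ->
  step_state k.+1 (cut_center c B g) (cut_shape B g) (r * (n.+1%:R / n.+2%:R)).
Proof.
move=> [em pB trB trc dB [x xB mx]] ig g0 cut gx.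
have n1 := traceless_gt1 g0 ig; split.
- by apply: em_cut => //; apply/tracelessP.
- exact: posdef_cut_shape.
- move=> u iu; rewrite -scalemxAr dotZr mulmxBr dotDr dotNr trB// sub0r.
  rewrite -scalemxAr dotZr [u *m _]mulmxA [u *m (g *m B)^T]mx11_scalar.
  by rewrite mul_scalar_mx dotZr trB// !mulr0 oppr0 mulr0.
- by rewrite dotDr dotNr dotZr trB// mulr0 subr0.
- apply: le_trans (det_cut_shape n1 pB g0) _; rewrite mulrC.
  by rewrite ler_wpM2r// divr_ge0.
- by exists x => //; apply: cut_ellipsoid => //; exact: gx.
Qed.

(** For [x] of unit trace, [dot g (x - c)] is [u S(c) u^T - u S(x) u^T], which is nonpositive for
    density matrices. If [g] were 0, the form at [u] would be nonpositive at the mixed state too,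
    whose representation is positive definite. *)
Lemma separation_cut c (u : 'rV[R]_(d + d)) : dot idv c = 1 -> u != 0 ->
  dot (u *m pencil S c) u <= 0 ->
  let g := traceless_part (\row_k - dot (u *m S k) u) in
  [/\ g != 0, ~ posdef (pencil S c) &
  forall x, density (herm x) -> dot g (x - c) <= 0].
Proof.
move=> ic u0 uc g.
have np : ~ posdef (pencil S c) by move=> [_ /(_ _ u0)]; rewrite ltNge uc.
have dg x : dot idv x = 1 ->
    dot g (x - c) = dot (u *m pencil S c) u - dot (u *m pencil S x) u.
  move=> ix; rewrite dot_traceless_part; last first.
    by rewrite dotDr dotNr ix ic subrr.
  have e y : dot (u *m pencil S y) u = \sum_k y 0 k * dot (u *m S k) u.
    rewrite mulmx_sumr dotE; under eq_bigr do rewrite summxE mulr_suml.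
    rewrite exchange_big; apply: eq_bigr => k _; rewrite dotE mulr_sumr.
    by apply: eq_bigr => j _; rewrite -scalemxAr mxE mulrA.
  rewrite !e -sumrB dotE; apply: eq_bigr => k _; rewrite !mxE; ring.
split=> //; last first.
  move=> x /densityP[[_ px] ix]; rewrite dg// subr_le0.
  exact: le_trans uc (px u).
apply/eqP => g0.
have := dg _ (@dot_mixed_state R d d0); rewrite g0 dot0l => /esym/eqP.
rewrite subr_eq0 => /eqP e; move: uc; rewrite e leNgt => /negP; apply.
by have [_] := @posdef_mixed_state R d d0; apply.
Qed.

Hypothesis A0 : forall tau : 'I_t, A tau != 0.

Lemma initial_state : step_state 0 (@mixed_state R d) 1%:M 1.
Proof.
split.
- exact: em_init.
- exact: posdef1.
- by move=> u; rewrite mulmx1.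
- exact: dot_mixed_state.
- by rewrite det1.
- have [x _ mx] := minimizer_exists d0 lam0 mu0 psdA A0; exists x => //.
  by rewrite /ellipsoid /= invmx1 mulmx1; apply: density_mixed_ball => //; case: mx.
Qed.

Lemma separation_state k c B r (u : 'rV[R]_(d + d)) : step_state k c B r -> u != 0 ->
  dot (u *m pencil S c) u <= 0 ->
  let g := traceless_part (\row_k - dot (u *m S k) u) in
  g != 0 /\
  step_state k.+1 (cut_center c B g) (cut_shape B g) (r * (n.+1%:R / n.+2%:R)).
Proof.
move=> st u0 uc g; have ic := state_trace st.
have [g0 np gx] := separation_cut ic u0 uc; split=> //.
apply: cut_state => //; first exact: traceless_partP.
  right; split=> // /(in_domainP mu lam0 psdA A0 c)[pc _]; exact: np pc.
by move=> x [dx _]; exact: gx.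
Qed.

Lemma gradient_state k c B r : step_state k c B r -> posdef (pencil S c) ->
  let g := traceless_part (grad_objective lam mu A t c) in
  (g = 0 -> minimizer P (herm c)) /\ (g != 0 ->
  step_state k.+1 (cut_center c B g) (cut_shape B g) (r * (n.+1%:R / n.+2%:R))).
Proof.
move=> st pc g; have ic := state_trace st.
have dc : in_domain P c by apply/(in_domainP mu lam0 psdA A0 c).
split=> [g0|g0].
  apply: stationary_minimizer => // u /tracelessP iu.
  by rewrite -dot_traceless_part// -/g g0 dot0l.
apply: cut_state => //; first exact: traceless_partP.
  left; split=> // u /tracelessP iu; rewrite dot_traceless_part//.
  exact/is_derive_Pt/posdef_feasible.
move=> x mx; rewrite dot_traceless_part.
  exact: minimizer_gradient.
have [/densityP[_ ix] _] := mx.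
by rewrite dotDr dotNr ix ic subrr.
Qed.

End EllipsoidSteps.

Section ZeroLoss.
Context {R : realType} {d : nat}.
Variables (lam mu : R) (A : nat -> 'M[complex R]_d) (t : nat).
Hypotheses (d0 : (0 < d)%N) (lam0 : 0 < lam).

(* If some A tau vanishes, the objective is +oo everywhere. *)
Lemma zero_loss_minimizer (tau : 'I_t) :
  (forall s, (s < t)%N -> psd (A s)) -> A tau = 0 ->
  minimizer (Pt lam mu A t) (herm (@mixed_state R d)).
Proof.
move=> psdA Atau; split; first exact: density_mixed_state.
move=> s _; rewrite /Pt !(Lt_zero_loss lam0 _ Atau).
by move: (Vt _ _ _ _) (Vt _ _ _ _) => v w; rewrite !addye.
Qed.

End ZeroLoss.

(** * One iteration as a program *)

Section BodyPrograms.
Local Open Scope nat_scope.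

Definition pencil_prog : fcom :=
  table 8 [:: (14, Bp); (15, Bp)] [:: (12, Bn)]
    (RMul (RGet 3 (IVar 12)) (basis_cell (IVar 12) (IVar 14) (IVar 15))).

Definition trace_sum_prog : fcom :=
  table 19 [::] [:: (10, Bd)] (cell 15 (IVar 10) Bd (IVar 10)).

Definition traceless_prog : fcom :=
  table 16 [:: (10, Bd); (11, Bd)] [::]
    (RSub (cell 15 (IVar 10) Bd (IVar 11))
      (RMul (RNat (ieq (IVar 10) (IVar 11))) (RDiv (scal 19) (RNat (IVar 0))))).

Definition norm_prog : fcom :=
  table 22 [::] [:: (12, Bn)] (RMul (RGet 16 (IVar 12)) (RGet 16 (IVar 12))).

Definition dim_r : rexp := RNat (bexpr Bn).

Definition gB_prog : fcom :=
  table 18 [:: (12, Bn)] [:: (13, Bn)]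
    (RMul (RGet 16 (IVar 13)) (cell 4 (IVar 13) Bn (IVar 12))).

Definition gBg_prog : fcom :=
  table 34 [::] [:: (12, Bn)] (RMul (RGet 18 (IVar 12)) (RGet 16 (IVar 12))).

Definition center_prog : fcom :=
  table 24 [:: (12, Bn)] [::]
    (RSub (RGet 3 (IVar 12))
      (RMul (RDiv (RDiv (nat_r 1) (RAdd dim_r (nat_r 1))) (RSqrt (scal 34)))
        (RGet 18 (IVar 12)))).

Definition shape_prog : fcom :=
  table 25 [:: (12, Bn); (13, Bn)] [::]
    (RMul (RDiv (RMul dim_r dim_r) (RSub (RMul dim_r dim_r) (nat_r 1)))
      (RSub (cell 4 (IVar 12) Bn (IVar 13))
        (RMul (RDiv (RDiv (nat_r 2) (RAdd dim_r (nat_r 1))) (scal 34))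
          (RMul (RGet 18 (IVar 12)) (RGet 18 (IVar 13)))))).

Definition ratio_prog : fcom :=
  table 35 [::] [::] (RMul (scal 20)
    (RDiv (RAdd dim_r (nat_r 1)) (RAdd dim_r (nat_r 2)))).

Definition cut_prog : fcom := seqs [:: gB_prog; gBg_prog; center_prog;
  shape_prog; ratio_prog; copy_row 3 24 Bn; copy_mx 4 25 Bn Bn;
  table 20 [::] [::] (scal 35)].

(** 100 is a natural number above e^pi, so a determinant below this threshold gives a volume of at
    most [expR pi * (eps / 100) <= eps]; the square undoes the root in [volume_ellipsoid]. *)
Definition thr_r : rexp :=
  let x := RDiv (RGet 0 (ICst 2)) (nat_r 100) in RMul x x.

Definition shrink_prog : fcom := seqs [::
  table 25 [:: (12, Bn); (13, Bn)] [::] (RMul thr_r (cell 4 (IVar 12) Bn (IVar 13)));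
  copy_mx 4 25 Bn Bn; table 20 [::] [::] (nat_r 0)].

Definition direction_prog : fcom := seqs [:: pencil_prog; sweep 8 Bp 14;
  FIf (RLe (scal 17) (nat_r 0)) separation_prog gradient_prog;
  trace_sum_prog; traceless_prog; norm_prog].

Definition body_prog : fcom := FSeq direction_prog
  (FIf (RLe (scal 22) (nat_r 0)) shrink_prog cut_prog).

End BodyPrograms.

Section BodyCorrectness.
Context {R : realType} {d : nat}.
Variables (lam mu eps : R) (A : nat -> 'M[complex R]_d) (t : nat).
Hypotheses (d0 : (0 < d)%N) (lam0 : 0 < lam) (mu0 : 0 < mu).
Hypothesis eps01 : 0 < eps <= 2^-1.
Hypothesis psdA : forall tau, (tau < t)%N -> psd (A tau).
Implicit Types (m : memory R) (c g : 'rV[R]_(d * d)) (B : 'M[R]_(d * d)) (r : R).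
Local Notation S := (@herm_basis R d).
Local Notation a := (@loss_coords R d A t).
Local Notation P := (Pt lam mu A t).
Local Notation idv := (@diag_coords R d).
Local Notation n := (d * d)%N.
Local Notation setup := (setup lam mu eps A t).
Local Notation thr := ((eps / 100) ^+ 2).

Record ell_mem m c B r : Prop := EllMem {
  ell_setup : setup m;
  ell_center : is_row m 3 c;
  ell_shape : is_mx m 4 B;
  ell_ratio : rarr m 20 0 = r }.

Lemma ell_keep p m c B r : wf p ->
  all (fun b => b \notin warrs p) [:: 0; 6; 7; 3; 4; 20]%N ->
  ell_mem m c B r -> ell_mem (den p m) c B r.
Proof.
move=> wp /and5P[n0 n6 n7 n3 /and3P[n4 n20 _]] [s0 r3 x4 l20]; split.
- by apply: setup_keep => //=; rewrite n0 n6 n7.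
- exact: keep_row.
- exact: keep_mx.
- by rewrite den_rarr.
Qed.

Ltac keep_ell p m :=
  try match goal with
  | H : ell_mem m _ _ _ |- _ => apply (ell_keep (p := p) isT isT) in H
  end;
  try match goal with
  | H : setup m |- _ => apply (setup_keep (c := p) isT isT) in H
  end.

Lemma pencil_progP m c : setup m -> is_row m 3 c ->
  is_mx (den pencil_prog m) 8 (pencil S c).
Proof.
move=> s0 r3; apply: table_mx => //=; rewrite ?(setup_d s0)// => i j.
rewrite summxE; apply: eq_bigr => k _.
by rewrite r3 (setup_basis s0) [RHS]mxE.
Qed.

Lemma is_row_cell m b g (i j : 'I_d) : is_row m b g ->
  rarr m b (i * d + j)%N = g 0 (mxvec_index i j).
Proof. by move=> mg; rewrite -mg val_mxvec_index. Qed.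

Lemma is_row_vec m b (M : 'M[R]_d) : is_mx m b M -> is_row m b (mxvec M).
Proof.
by move=> mM k; case/mxvec_indexP: k => i j; rewrite val_mxvec_index mM mxvecE.
Qed.

Lemma dot_diag g : dot idv g = \sum_i g 0 (mxvec_index i i).
Proof.
rewrite -{1}(vec_mxK g) dot_mxvec; apply: eq_bigr => i _.
rewrite (bigD1 i)//= big1 ?addr0 => [|j ji]; first by rewrite !mxE eqxx mul1r.
by rewrite !mxE eq_sym (negPf ji) mul0r.
Qed.

Lemma traceless_progP m g : setup m -> is_row m 15 g ->
  is_row (den traceless_prog (den trace_sum_prog m)) 16 (traceless_part g).
Proof.
move=> s0 e15; rewrite -(vec_mxK (traceless_part g)); apply: is_row_vec.
have e19 : rarr (den trace_sum_prog m) 19 0 = dot idv g.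
  rewrite den_table0//= (setup_d s0) dot_diag; apply: eq_bigr => i _.
  exact: is_row_cell.
have {}e15 := keep_row (p := trace_sum_prog) (b := 15) isT e15.
have {}s0 : setup (den trace_sum_prog m) by apply: setup_keep.
apply: table_mx => //=; rewrite ?(setup_d s0)// => i j.
rewrite e19 (is_row_cell _ _ e15) [RHS]mxE /traceless_part.
rewrite [RHS]mxE; congr (_ + _); rewrite [RHS]mxE; congr (- _).
rewrite [RHS]mxE mulrC mxvecE mxE; congr (_ * _); congr (_%:R).
by rewrite -val_eqE /=; case: eqP => [->|]; lia.
Qed.

Lemma norm_progP m g : setup m -> is_row m 16 g ->
  rarr (den norm_prog m) 22 0 = dot g g.
Proof.
move=> s0 e16; rewrite den_table0//= (setup_d s0) dotE.
by apply: eq_bigr => k _; rewrite e16.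
Qed.

Lemma cut_progP m c B r g : ell_mem m c B r -> is_row m 16 g ->
  ell_mem (den cut_prog m) (cut_center c B g) (cut_shape B g)
    (r * (n.+1%:R / n.+2%:R)).
Proof.
move=> em e16; rewrite /cut_prog.
have e18 : is_row (den gB_prog m) 18 (g *m B).
  apply: table_row => //=; rewrite ?(setup_d (ell_setup em))// => k.
  by rewrite [RHS]mxE; apply: eq_bigr => l _; rewrite e16 (ell_shape em).
step_over gB_prog m keep_ell.
have e34 : rarr (den gBg_prog m) 34 0 = dot (g *m B) g.
  rewrite den_table0//= (setup_d (ell_setup em)) dotE.
  by apply: eq_bigr => k _; rewrite e16 e18.
step_over gBg_prog m keep_ell.
have e24 : is_row (den center_prog m) 24 (cut_center c B g).
  apply: table_row => //=; rewrite ?(setup_d (ell_setup em))// => k.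
  rewrite e18 e34 (ell_center em) /cut_center [RHS]mxE; congr (_ + _).
  by rewrite [RHS]mxE; congr (- _); rewrite [RHS]mxE natr1 div1r.
step_over center_prog m keep_ell.
have e25 : is_mx (den shape_prog m) 25 (cut_shape B g).
  apply: table_mx => //=; rewrite ?(setup_d (ell_setup em))// => k l.
  rewrite e34 !e18 (ell_shape em) /cut_shape [RHS]mxE expr2; congr (_ * _).
  rewrite [RHS]mxE; congr (_ + _); rewrite [RHS]mxE; congr (- _).
  by rewrite [RHS]mxE outerE natr1.
step_over shape_prog m keep_ell.
have e35 : rarr (den ratio_prog m) 35 0 = r * (n.+1%:R / n.+2%:R).
  rewrite den_table0//= (setup_d (ell_setup em)) (ell_ratio em).
  by rewrite -!natrD addn1 addn2.
step_over ratio_prog m keep_ell.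
have s0 := ell_setup em.
have e3 : is_row (den (copy_row 3 24 Bn) m) 3 (cut_center c B g).
  by apply: copy_rowP => //=; rewrite (setup_d s0).
step_over (copy_row 3 24 Bn) m keep_ell.
have e4 : is_mx (den (copy_mx 4 25 Bn Bn) m) 4 (cut_shape B g).
  by apply: copy_mxP => //=; rewrite (setup_d s0).
step_over (copy_mx 4 25 Bn Bn) m keep_ell.
have e20 : rarr (den (table 20 [::] [::] (scal 35)) m) 20 0 = r * (n.+1%:R / n.+2%:R).
  by rewrite den_table0.
by step_over (table 20 [::] [::] (scal 35)) m keep_ell; rewrite den_seqs_nil; split.
Qed.

Lemma shrink_progP m c B r : ell_mem m c B r ->
  ell_mem (den shrink_prog m) c (thr *: B) 0.
Proof.
move=> em; rewrite /shrink_prog; set p := table 25 _ _ _.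
have e25 : is_mx (den p m) 25 (thr *: B).
  apply: table_mx => //=; rewrite ?(setup_d (ell_setup em))// => k l.
  by rewrite (ell_shape em) (setup_eps (ell_setup em)) [RHS]mxE expr2.
step_over p m keep_ell; have [s0 e3 _ _] := em.
have e4 : is_mx (den (copy_mx 4 25 Bn Bn) m) 4 (thr *: B).
  by apply: copy_mxP => //=; rewrite (setup_d s0).
step_over (copy_mx 4 25 Bn Bn) m keep_ell.
have e20 : rarr (den (table 20 [::] [::] (nat_r 0)) m) 20 0 = 0 by rewrite den_table0.
by step_over (table 20 [::] [::] (nat_r 0)) m keep_ell; rewrite den_seqs_nil; split.
Qed.

Hypothesis A0 : forall tau : 'I_t, A tau != 0.

Lemma direction_progP m k c B r : ell_mem m c B r ->
  step_state lam mu A t k c B r ->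
  let m' := den direction_prog m in ell_mem m' c B r /\
  exists g, [/\ is_row m' 16 g, rarr m' 22 0 = dot g g,
    g = 0 -> minimizer P (herm c) &
    g != 0 -> step_state lam mu A t k.+1 (cut_center c B g) (cut_shape B g)
      (r * (n.+1%:R / n.+2%:R))].
Proof.
move=> em st; rewrite /direction_prog.
split; first by apply: ell_keep em; vm_compute.
have e8 := pencil_progP (ell_setup em) (ell_center em).
step_over pencil_prog m keep_ell.
rewrite den_seqs_cons.
have bq : bval (ireg m 0) (ireg m 1) Bp = (d + d)%N.
  by rewrite /= (setup_d (ell_setup em)).
have symS : (pencil S c)^T = pencil S c by apply: pencil_sym; exact: herm_basis_sym.
have := den_sweep (or_introl erefl) bq symS e8.
have {em} : ell_mem (den (sweep 8 Bp 14) m) c B r by apply: ell_keep; vm_compute.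
move: (den _ m) => {e8 bq} {}m em sw.
rewrite den_seqs_cons; set p := FIf _ _ _.
(* Either branch leaves a vector whose traceless part is a valid cut normal unless it is 0; it can
   be 0 only in the gradient branch, and then the center is optimal. *)
have : exists G, is_row (den p m) 15 G /\ let g := traceless_part G in
    (g = 0 -> minimizer P (herm c)) /\
    (g != 0 -> step_state lam mu A t k.+1 (cut_center c B g) (cut_shape B g)
      (r * (n.+1%:R / n.+2%:R))).
  rewrite /p den_if; case: sw => [[f1 [pS e8]]|[f0 [u [e14 [u0 uS]]]]].
    rewrite /= f1 ler10; exists (grad_objective lam mu A t c).
    split; last exact: gradient_state st pS.
    apply: gradient_progP (ell_setup em) (ell_center em) e8 => //.
    exact: posdef_feasible.
  rewrite /= f0 lexx; exists (\row_k - dot (u *m S k) u).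
  split; first exact: separation_progP (ell_setup em) e14.
  have := separation_state d0 lam0 mu0 psdA A0 st u0 uS.
  move: (\row_k - _) => G; cbv zeta; move: (traceless_part G) => g [g0 st'].
  by split=> [g1|_]; [move: g0; rewrite g1 eqxx|exact: st'].
have {em} : ell_mem (den p m) c B r by apply: ell_keep; vm_compute.
move: (den p m) => {sw p} {}m em [G [e15 [G0 G1]]].
rewrite 2!den_seqs_cons.
have e16 := traceless_progP (ell_setup em) e15.
have {em} : ell_mem (den traceless_prog (den trace_sum_prog m)) c B r.
  by do 2![apply: ell_keep => //].
move: (den _ _) e16 => {e15} {}m e16 em.
rewrite den_seqs_cons den_seqs_nil; exists (traceless_part G); split=> //.
  exact: keep_row.
exact: norm_progP (ell_setup em) e16.
Qed.

Lemma thr01 : 0 < thr < 1.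
Proof.
have /andP[e0 e1] := eps01.
have h : 0 < eps / 100 < 1 by lra.
by have /andP[h0 h1] := h; rewrite exprn_gt0// expr_lt1// ltW.
Qed.

Lemma body_progP m k c B r : ell_mem m c B r -> r <= 1 ->
  step_state lam mu A t k c B r ->
  let m' := den body_prog m in
  exists c' B',
   (ell_mem m' c' B' 0 /\ stop_state lam mu A t k.+1 c' B' thr) \/
   (ell_mem m' c' B' (r * (n.+1%:R / n.+2%:R)) /\
    step_state lam mu A t k.+1 c' B' (r * (n.+1%:R / n.+2%:R))).
Proof.
move=> em r1 st; rewrite /body_prog den_seq.
have := direction_progP em st; move: (den _ m) => {em} {}m /= [em [g [e16 e22 g0 g1]]].
rewrite den_if /= e22; case: ifP => [gg|/negbT gg].
  exists c, (thr *: B); left; split; first exact: shrink_progP em.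
  have gz : g = 0 by apply/eqP; rewrite -dot_eq0 eq_le gg dot_ge0.
  have [sm pB _ _ dB _] := st.
  exact: (shrink_state d0 sm pB (le_trans dB r1) (g0 gz) thr01).
exists (cut_center c B g), (cut_shape B g); right; split; first exact: cut_progP.
by apply: g1; apply: contraNN gg => /eqP ->; rewrite dot0l.
Qed.

End BodyCorrectness.

(** * Initialization of the tables *)

Section InitPrograms.
Local Open Scope nat_scope.

(** Indices below [2 d] address blocks of size [d]: by truncated subtraction, [half_of] is 0 below
    [d] and 1 from [d] on, and [offset_of] is the index within the block. *)
Definition half_of (a : iexp) : iexp := ISub (ICst 1) (ISub (IVar 0) a).
Definition offset_of (a : iexp) : iexp := ISub a (IMul (IVar 0) (half_of a)).

Definition delta (x y : iexp) : rexp := RNat (ieq x y).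
Definition less (x y : iexp) : rexp := RNat (ilt x y).

(* The real part of entry (x, y) of the basis matrix with index (i, j). *)
Definition re_basis (i j x y : iexp) : rexp :=
  RAdd (RAdd (RMul (delta x y) (RMul (delta i x) (delta j x)))
    (RMul (less x y) (RDiv (RMul (delta i x) (delta j y)) (RSqrt (nat_r 2)))))
    (RMul (less y x) (RDiv (RMul (delta i y) (delta j x)) (RSqrt (nat_r 2)))).

Definition im_basis (i j x y : iexp) : rexp :=
  RSub (RMul (less x y) (RDiv (RMul (delta i y) (delta j x)) (RSqrt (nat_r 2))))
    (RMul (less y x) (RDiv (RMul (delta i x) (delta j y)) (RSqrt (nat_r 2)))).

(** Equal block indices select the real part. Otherwise their difference is the sign of the
    imaginary part: positive in the lower left block and negative in the upper right one. *)
Definition basis_expr (i j a b : iexp) : rexp :=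
  RAdd (RMul (delta (half_of a) (half_of b)) (re_basis i j (offset_of a) (offset_of b)))
    (RMul (RSub (RNat (half_of a)) (RNat (half_of b)))
      (im_basis i j (offset_of a) (offset_of b))).

Definition basis_prog : fcom :=
  table 6 [:: (10, Bd); (11, Bd); (14, Bp); (15, Bp)] [::]
    (basis_expr (IVar 10) (IVar 11) (IVar 14) (IVar 15)).

Definition entry (a : nat) (tau i j : iexp) : rexp :=
  RGet a (IAdd (IMul tau (bexpr Bn)) (IAdd (IMul i (IVar 0)) j)).

Definition coords_expr : rexp :=
  let tau := IVar 18 in let i := IVar 10 in let j := IVar 11 in
  RAdd (RAdd (RMul (delta i j) (entry 1 tau i i))
    (RMul (less i j) (RMul (RSqrt (nat_r 2)) (entry 1 tau i j))))
    (RMul (less j i) (RMul (RSqrt (nat_r 2)) (entry 2 tau j i))).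

Definition coords_prog : fcom :=
  table 7 [:: (18, Bt); (10, Bd); (11, Bd)] [::] coords_expr.

Definition mixed_prog : fcom :=
  table 3 [:: (10, Bd); (11, Bd)] [::]
    (RDiv (delta (IVar 10) (IVar 11)) (RNat (IVar 0))).

Definition identity_prog : fcom :=
  table 4 [:: (10, Bn); (11, Bn)] [::] (delta (IVar 10) (IVar 11)).

Definition square_prog : fcom :=
  table 34 [:: (18, Bt)] [:: (12, Bn)]
    (RMul (cell 7 (IVar 18) Bn (IVar 12)) (cell 7 (IVar 18) Bn (IVar 12))).

Definition nonzero_prog : fcom := FSeq (table 21 [::] [::] (nat_r 1))
  (FFor 18 Bt (FIf (RLe (RGet 34 (IVar 18)) (nat_r 0))
    (table 21 [::] [::] (nat_r 0)) FSkip)).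

Definition init_prog : fcom := seqs [:: basis_prog; coords_prog; mixed_prog;
  identity_prog; table 20 [::] [::] (nat_r 1); square_prog; nonzero_prog;
  FIf (RLe (scal 21) (nat_r 0)) shrink_prog FSkip].

End InitPrograms.

Section InitCorrectness.
Context {R : realType} {d : nat}.
Variables (lam mu eps : R) (A : nat -> 'M[complex R]_d) (t : nat).
Hypotheses (d0 : (0 < d)%N) (lam0 : 0 < lam) (mu0 : 0 < mu).
Hypothesis eps01 : 0 < eps <= 2^-1.
Hypothesis psdA : forall tau, (tau < t)%N -> psd (A tau).
Implicit Types (m : memory R) (c g : 'rV[R]_(d * d)) (B : 'M[R]_(d * d)) (r : R).
Local Notation S := (@herm_basis R d).
Local Notation a := (@loss_coords R d A t).
Local Notation P := (Pt lam mu A t).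
Local Notation setup := (setup lam mu eps A t).
Local Notation thr := ((eps / 100) ^+ 2).

Record input m : Prop := Input {
  input_d : ireg m 0 = d;
  input_t : ireg m 1 = t;
  input_lam : rarr m 0 0 = lam;
  input_mu : rarr m 0 1 = mu;
  input_eps : rarr m 0 2 = eps;
  input_re : forall tau (i j : 'I_d), (tau < t)%N ->
    rarr m 1 (tau * (d * d) + (i * d + j))%N = complex.Re (A tau i j);
  input_im : forall tau (i j : 'I_d), (tau < t)%N ->
    rarr m 2 (tau * (d * d) + (i * d + j))%N = complex.Im (A tau i j) }.

Lemma input_keep p m : wf p -> all (fun b => b \notin warrs p) [:: 0; 1; 2]%N ->
  input m -> input (den p m).
Proof.
move=> wp /and4P[n0 n1 n2 _] [h0 h1 hl hm he hr hi].
split; rewrite ?den_ireg ?den_rarr ?wf_wregs// => *; rewrite den_rarr//;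
  solve [exact: hr | exact: hi].
Qed.

Lemma herm_delta (i j x y : 'I_d) :
  herm (delta_mx 0 (mxvec_index i j) : 'rV[R]_(d * d)) x y =
  Complex (((x == y)%:R * ((i == x)%:R * (j == x)%:R)
     + (x < y)%N%:R * ((i == x)%:R * (j == y)%:R / Num.sqrt 2)
     + (y < x)%N%:R * ((i == y)%:R * (j == x)%:R / Num.sqrt 2)))
   ((x < y)%N%:R * ((i == y)%:R * (j == x)%:R / Num.sqrt 2)
     - (y < x)%N%:R * ((i == x)%:R * (j == y)%:R / Num.sqrt 2)).
Proof.
rewrite /herm mxE vec_mx_delta !mxE -!val_eqE /=.
rewrite !(eq_sym (val x)) !(eq_sym (val y)) -!mulnb !natrM.
case: (ltngtP x y) => xy; rewrite ?mul0r ?mul1r ?add0r ?addr0 ?subr0 ?sub0r ?oppr0//.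
Qed.

Lemma reval_basis m (I J X Y : iexp) (i j x y : 'I_d) :
  ieval m I = i -> ieval m J = j -> ieval m X = x -> ieval m Y = y ->
  Complex (reval m (re_basis I J X Y)) (reval m (im_basis I J X Y)) =
  herm (delta_mx 0 (mxvec_index i j) : 'rV[R]_(d * d)) x y.
Proof.
move=> hI hJ hX hY; rewrite herm_delta /re_basis /im_basis /delta /less.
by rewrite !evalE hI hJ hX hY.
Qed.

Lemma reval_basis_expr m (I J X Y : iexp) (i j : 'I_d) (x y : 'I_(d + d)) :
  ireg m 0 = d -> ieval m I = i -> ieval m J = j -> ieval m X = x ->
  ieval m Y = y ->
  reval m (basis_expr I J X Y) = S (mxvec_index i j) x y.
Proof.
move=> m0 hI hJ hX hY.
have lo (U : iexp) (u : 'I_d) : ieval m U = lshift d u ->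
    ieval m (half_of U) = 0%N /\ ieval m (offset_of U) = u.
  by move=> /= ->; rewrite m0 /=; have := ltn_ord u; nia.
have hi (U : iexp) (u : 'I_d) : ieval m U = rshift d u ->
    ieval m (half_of U) = 1%N /\ ieval m (offset_of U) = u.
  by move=> /= ->; rewrite m0 /=; have := ltn_ord u; nia.
have e (u v : 'I_d) U V : ieval m U = u -> ieval m V = v ->
    herm (delta_mx 0 (mxvec_index i j) : 'rV[R]_(d * d)) u v =
    Complex (reval m (re_basis I J U V)) (reval m (im_basis I J U V)).
  by move=> hU hV; rewrite (@reval_basis _ _ _ _ _ i j u v).
rewrite /basis_expr !reval_add !reval_mul reval_sub !reval_nat ieval_ieq.
rewrite /herm_basis /rep; case: (split_ordP x) hX => u -> /[dup] {}hX.
  move=> /lo[-> hU]; case: (split_ordP y) hY => v -> /[dup] {}hY.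
    move=> /lo[-> hV]; rewrite block_mxEul mxE (e _ _ _ _ hU hV) /=.
    by rewrite mul1r subrr mul0r addr0.
  move=> /hi[-> hV]; rewrite block_mxEur mxE mxE (e _ _ _ _ hU hV) /=.
  by rewrite mul0r sub0r mulN1r add0r.
move=> /hi[-> hU]; case: (split_ordP y) hY => v -> /[dup] {}hY.
  move=> /lo[-> hV]; rewrite block_mxEdl mxE (e _ _ _ _ hU hV) /=.
  by rewrite mul0r subr0 mul1r add0r.
move=> /hi[-> hV]; rewrite block_mxEdr mxE (e _ _ _ _ hU hV) /=.
by rewrite mul1r subrr mul0r addr0.
Qed.

Lemma basis_progP m : input m ->
  forall (k : 'I_(d * d)) (x y : 'I_(d + d)),
    rarr (den basis_prog m) 6 ((k * (d + d) + x) * (d + d) + y)%N = S k x y.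
Proof.
move=> im k x y; case/mxvec_indexP: k => i j; rewrite val_mxvec_index.
have ok : table_ok 6 [:: (10, Bd); (11, Bd); (14, Bp); (15, Bp)]%N [::]
  (basis_expr (IVar 10) (IVar 11) (IVar 14) (IVar 15)) by [].
have := den_table (m := m) (s := [:: i : nat; j : nat; x : nat; y : nat]) ok.
rewrite /basis_prog; set e := basis_expr _ _ _ _ in ok *.
set m' := set_iregs _ _ _.
have he : reval m' e = S (mxvec_index i j) x y.
  by apply: reval_basis_expr; rewrite /m'/= ?(input_d im).
rewrite {}/m' in he *; clearbody e; rewrite /= in he *.
by rewrite (input_d im) !ltn_ord he => /(_ isT).
Qed.

Lemma coords_progP m : input m -> forall (tau : 'I_t) (k : 'I_(d * d)),
  rarr (den coords_prog m) 7 (tau * (d * d) + k)%N = a tau 0 k.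
Proof.
move=> im tau k; case/mxvec_indexP: k => i j; rewrite val_mxvec_index.
rewrite /coords_prog; set e := coords_expr.
have ok : table_ok 7 [:: (18, Bt); (10, Bd); (11, Bd)]%N [::] e by [].
have := den_table (m := m) (s := [:: tau : nat; i : nat; j : nat]) ok.
set m' := set_iregs _ _ _.
have he : reval m' e = a tau 0 (mxvec_index i j).
  rewrite /e /coords_expr /delta /less /entry !evalE /m' /= (input_d im).
  rewrite !(input_re im)// (input_im im)// mxvecE mxE -val_eqE /=.
  by case: (ltngtP i j) => ij; rewrite ?mul0r ?mul1r ?add0r ?addr0 ?(val_inj ij).
rewrite {}/m' in he *; clearbody e; rewrite /= in he *.
rewrite (input_d im) (input_t im) !ltn_ord he => /(_ isT) <-.
by congr (rarr _ _ _); nia.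
Qed.

Ltac keep_setup p m :=
  match goal with
  | H : setup m |- _ => apply (setup_keep (c := p) isT isT) in H
  end.

Lemma setup_init m : input m ->
  setup (den coords_prog (den basis_prog m)).
Proof.
move=> im; have im1 : input (den basis_prog m) by apply: input_keep.
have [h0 h1 hl hm he _ _] := im.
split; rewrite ?den_ireg ?den_rarr//; last exact: coords_progP.
by move=> *; rewrite den_rarr//; exact: basis_progP.
Qed.

Lemma nonzero_progP m s : ireg m 1 = t -> is_row m 34 (s : 'rV[R]_t) ->
  let m' := den nonzero_prog m in
  (rarr m' 21 0 = 1 /\ forall tau, 0 < s 0 tau) \/
  (rarr m' 21 0 = 0 /\ exists tau, s 0 tau <= 0).
Proof.
move=> m1 e34; rewrite /nonzero_prog den_seq.
have e21 : rarr (den (table 21 [::] [::] (nat_r 1)) m) 21 0 = 1 by rewrite den_table0.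
apply (keep_row (p := table 21 [::] [::] (nat_r 1)) (b := 34) isT) in e34.
have {m1} : ireg (den (table 21 [::] [::] (nat_r 1)) m) 1 = t by rewrite den_ireg.
move: (den _ m) e21 e34 => {}m e21 e34 m1.
set p := FFor _ _ _.
pose I j m' := [/\ ireg m' 1 = t, is_row m' 34 s &
  (rarr m' 21 0 = 1 /\ forall tau : 'I_t, (tau < j)%N -> 0 < s 0 tau) \/
  (rarr m' 21 0 = 0 /\ exists tau, s 0 tau <= 0)].
suff [_ _ [[f1 h]|h]] : I (bval (ireg m 0) (ireg m 1) Bt) (den p m).
- by left; split=> // tau; apply: h; rewrite /= m1.
- by right.
apply: den_for_ind => [|j m' /= + jq [i1 Ij hI]]; first by split=> //; left.
rewrite m1 => jt; rewrite den_if /= jq (Ij (Ordinal jt)).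
case: ifP => [s0|/negbT s0]; split=> //=.
  by right; rewrite den_table0//=; split=> //; exists (Ordinal jt).
case: hI => [[f1 h]|h]; [left; split=> // tau|by right].
rewrite ltnS leq_eqVlt => /orP[/eqP tj|/h//].
have -> : tau = Ordinal jt by exact/val_inj.
by rewrite ltNge; exact: s0.
Qed.

Lemma loss_coords_eq0 (tau : 'I_t) : a tau = 0 -> A tau = 0.
Proof.
move=> a0; have hA : A tau \is hermsymmx by have [] := psdA (ltn_ord tau).
by rewrite -(coordsK hA) -/(a tau) a0 herm0.
Qed.

Lemma init_progP m : input m -> let m' := den init_prog m in
  exists c B,
   (ell_mem lam mu eps A t m' c B 0 /\ stop_state lam mu A t 1 c B thr) \/
   (ell_mem lam mu eps A t m' c B 1 /\ step_state lam mu A t 0 c B 1 /\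
    forall tau : 'I_t, A tau != 0).
Proof.
move=> im; rewrite /init_prog 2!den_seqs_cons.
have s0 := setup_init im; move: (den _ (den _ m)) s0 => {im} {}m s0.
have e3 : is_row (den mixed_prog m) 3 (@mixed_state R d).
  apply: is_row_vec; apply: table_mx => // [||i j]; rewrite ?/bval ?(setup_d s0)//.
  rewrite /nsum /delta !evalE /= (setup_d s0) mxE mulrb.
  by rewrite -val_eqE /=; case: eqP; rewrite ?mul1r ?mul0r.
step_over mixed_prog m keep_setup.
have e4 : is_mx (den identity_prog m) 4 (1%:M : 'M[R]_(d * d)).
  apply: table_mx => // [||i j]; rewrite ?/bval ?(setup_d s0)//.
  by rewrite /nsum /delta !evalE mxE.
step_over identity_prog m keep_setup.
have e20 : rarr (den (table 20 [::] [::] (nat_r 1)) m) 20 0 = 1 by rewrite den_table0.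
step_over (table 20 [::] [::] (nat_r 1)) m keep_setup.
have em : ell_mem lam mu eps A t m (@mixed_state R d) 1%:M 1 by split.
have e34 : is_row (den square_prog m) 34 (\row_tau dot (a tau) (a tau)).
  apply: table_row => //=; first exact: setup_t s0.
  move=> tau; rewrite (setup_d s0) mxE dotE; apply: eq_bigr => k _.
  by rewrite (setup_loss s0).
have {em} : ell_mem lam mu eps A t (den square_prog m) (@mixed_state R d) 1%:M 1.
  exact: ell_keep.
rewrite den_seqs_cons; move: (den _ m) e34 => {e3 e4 e20 s0} {}m e34 em.
rewrite den_seqs_cons.
have := nonzero_progP (setup_t (ell_setup em)) e34.
have {em} : ell_mem lam mu eps A t (den nonzero_prog m) (@mixed_state R d) 1%:M 1.
  exact: ell_keep.
move: (den _ m) => {e34} {}m em fl.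
rewrite den_seqs_cons den_seqs_nil den_if /=.
exists (@mixed_state R d).
case: fl => [[-> h]|[-> [tau h]]].
  rewrite ler10; exists 1%:M; right; split=> //.
  have A0 (tau : 'I_t) : A tau != 0.
    apply/eqP => Atau; have := h tau; rewrite mxE.
    have -> : a tau = 0 by rewrite /loss_coords Atau -herm0 hermK.
    by rewrite dot0l ltxx.
  by split=> //; exact: initial_state.
rewrite lexx; exists (thr *: 1%:M); left; split; first exact: shrink_progP em.
have Atau : A tau = 0.
  apply: loss_coords_eq0; apply/eqP; rewrite -dot_eq0 eq_le dot_ge0 andbT.
  by move: h; rewrite mxE.
have d1 : \det (1%:M : 'M[R]_(d * d)) <= 1 by rewrite det1.
have mz := zero_loss_minimizer mu d0 lam0 psdA Atau.
exact: (shrink_state d0 (em_init _) (@posdef1 R _) d1 mz (thr01 eps01)).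
Qed.

End InitCorrectness.

(** * Numerical constants *)

Section NumericBounds.
Context {R : realType}.
Implicit Types (eps : R).

(** [expR (- 4)] is the 32nd power of [expR (- 8^-1)], which is at least [7 / 8]; five squarings,
    with rational rounding down in between, reach [100^-1]. *)
Lemma expR4_le100 : expR (4 : R) <= 100.
Proof.
have sq (a b x : R) : 0 <= a -> a <= x -> b <= a ^+ 2 -> b <= x ^+ 2.
  by move=> a0 ax ba; apply: le_trans ba _; rewrite ler_pXn2r// nnegrE// (le_trans a0).
have h : expR (- 4 : R) = expR (- 8^-1) ^+ 2 ^+ 2 ^+ 2 ^+ 2 ^+ 2.
  by rewrite -!exprM -expRM_natr; congr expR; field.
have h0 : 7 / 8 <= expR (- 8^-1 : R) by apply: le_trans (expR_ge1Dx _); lra.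
have : 100^-1 <= expR (- 4 : R).
  rewrite h; apply: (sq (1 / 10)); [lra| |lra].
  apply: (sq (33 / 100)); [lra| |lra]; apply: (sq (58 / 100)); [lra| |lra].
  by apply: (sq (765 / 1000)); [lra| |lra]; apply: (sq (7 / 8)); [lra| |lra].
by rewrite expRN lef_pV2 ?posrE ?expR_gt0.
Qed.

Lemma expR_pi_le100 : expR (pi : R) <= 100.
Proof. by apply: le_trans expR4_le100; rewrite ler_expR; have := pihalf_lt2 R; lra. Qed.

Lemma ln_inv_ge eps : 0 < eps <= 2^-1 -> 2^-1 <= ln eps^-1 :> R.
Proof.
move=> /andP[e0 e1]; rewrite lnV ?posrE//.
have h : -1 < eps - 1 by lra.
by have := le_ln1Dx h; rewrite addrCA subrr addr0; move: (ln eps) => l; lra.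
Qed.

(** As [eps^-1 >= 2], its 7th power exceeds 100, so the left side is at most [2 * (7 + 1)] times
    [ln eps^-1]. *)
Lemma ln_threshold eps : 0 < eps <= 2^-1 ->
  - ln ((eps / 100) ^+ 2) <= 16 * ln eps^-1.
Proof.
move=> /andP[e0 e1]; have i0 : 0 < eps^-1 by rewrite invr_gt0.
have h : 100 <= eps^-1 ^+ 7.
  have h2 : 2 <= eps^-1 by rewrite -[2]invrK lef_pV2 ?posrE ?invr_gt0.
  apply: (@le_trans _ _ (2 ^+ 7)); first lra.
  by rewrite ler_pXn2r// nnegrE ltW.
have : ln 100 <= ln (eps^-1 ^+ 7) :> R by rewrite ler_ln ?posrE ?exprn_gt0.
rewrite !lnXn ?divr_gt0// ln_div ?posrE// lnV ?posrE//.
by move: (ln 100) (ln eps) => x y; lra.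
Qed.

Lemma ratio_le_expR n : n.+1%:R / n.+2%:R <= expR (- n.+2%:R^-1) :> R.
Proof.
apply: le_trans (expR_ge1Dx _); rewrite le_eqVlt; apply/orP; left; apply/eqP.
by rewrite -[in LHS]natr1; field; rewrite -!natrD pnatr_eq0.
Qed.

(** The ratio is at most [expR (- n.+2%:R^-1)], so [16 * (n + 2) * L] iterations suffice, rounded
    up. With [n >= 1] and [L >= 1 / 2], the bounds [n + 2 <= 3 n] and [1 <= 2 n L] give the constant
    [48 + 2 = 50]. *)
Lemma iterations_bound eps n : 0 < eps <= 2^-1 -> (0 < n)%N ->
  exists2 j : nat, (n.+1%:R / n.+2%:R) ^+ j <= (eps / 100) ^+ 2 &
    j%:R <= 50 * (n%:R * ln eps^-1) :> R.
Proof.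
move=> e01 n0; have /andP[e0 _] := e01.
have t0 : 0 < (eps / 100) ^+ 2 by rewrite exprn_gt0// divr_gt0.
have hT := ln_threshold e01; have hL := ln_inv_ge e01.
set L := ln eps^-1 in hT hL *; set th := (eps / 100) ^+ 2 in t0 hT *.
have N1 : 1 <= n%:R :> R by rewrite ler1n.
have n2 : 0 < n.+2%:R :> R by rewrite ltr0n.
have n2E : n.+2%:R = n%:R + 2 :> R by rewrite -!natr1; ring.
set x : R := n.+2%:R * (16 * L).
have x0 : 0 <= x by rewrite mulr_ge0// mulr_ge0//; lra.
exists (Num.truncn x).+1; last first.
  have /andP[h _] := truncn_itv x0.
  rewrite -natr1; apply: le_trans (lerD h (lexx 1)) _; rewrite /x n2E.
  move: (n%:R) N1 => N N1; nra.
have h : (n.+1%:R / n.+2%:R) ^+ (Num.truncn x).+1 <=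
    expR (- n.+2%:R^-1) ^+ (Num.truncn x).+1 :> R.
  by rewrite ler_pXn2r ?nnegrE ?expR_ge0 ?divr_ge0//; exact: ratio_le_expR.
apply: le_trans h _; rewrite -expRM_natr -[leRHS]lnK ?posrE// ler_expR.
rewrite mulNr lerNl; apply: le_trans hT _.
rewrite [leRHS]mulrC ler_pdivlMr// [leLHS]mulrC.
have /andP[_ h] := truncn_itv x0; exact: ltW.
Qed.

End NumericBounds.

Definition loop_guard : bexp := BNot (RLe (scal 20) thr_r).

Definition full_prog : com :=
  Seq (comp init_prog) (While loop_guard (comp body_prog)).

(** * The outer loop *)

Section Loop.
Context {R : realType} {d : nat}.
Variables (lam mu eps : R) (A : nat -> 'M[complex R]_d) (t : nat).
Hypotheses (d0 : (0 < d)%N) (lam0 : 0 < lam) (mu0 : 0 < mu).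
Hypothesis eps01 : 0 < eps <= 2^-1.
Hypothesis psdA : forall tau, (tau < t)%N -> psd (A tau).
Hypothesis A0 : forall tau : 'I_t, A tau != 0.
Implicit Types (m : memory R) (c g : 'rV[R]_(d * d)) (B : 'M[R]_(d * d)) (r : R).
Local Notation thr := ((eps / 100) ^+ 2).
Local Notation n := (d * d)%N.
Local Notation ell_mem := (ell_mem lam mu eps A t).
Local Notation step_state := (step_state lam mu A t).
Local Notation stop_state := (stop_state lam mu A t).
Local Notation q := (n.+1%:R / n.+2%:R : R).

(** This is what has to survive a round; the tables and the ellipsoid are built afresh from it in
    the next one. *)
Definition same_input m m' : Prop :=
  (forall v, (v <= 1)%N -> ireg m' v = ireg m v) /\
  (forall b l, (b <= 2)%N -> rarr m' b l = rarr m b l).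

Lemma same_input_den p m : wf p -> all (fun b => b \notin warrs p) [:: 0; 1; 2]%N ->
  same_input m (den p m).
Proof.
move=> wp /and4P[n0 n1 n2 _]; split=> [v v1|b l b2].
  by rewrite den_ireg// wf_wregs.
by rewrite den_rarr//; case: b b2 => [|[|[|]]].
Qed.

Lemma loop_guardE m c B r : ell_mem m c B r -> beval m loop_guard = ~~ (r <= thr).
Proof.
by move=> em; rewrite /= (ell_ratio em) (setup_eps (ell_setup em)) expr2.
Qed.

Definition loop_unit : nat := (bcost loop_guard).+1 + cst d t body_prog.

Lemma loop_exec j m k c B r : ell_mem m c B r -> r <= 1 -> step_state k c B r ->
  r * q ^+ j <= thr ->
  exists m' K k' c' B' r',
   [/\ exec (While loop_guard (comp body_prog)) m K m',
      (K <= j.+1 * loop_unit)%N, same_input m m',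
      ell_mem m' c' B' r' & stop_state k' c' B' thr /\ (k' <= k + j)%N].
Proof.
have q01 : 0 <= q <= 1.
  by rewrite divr_ge0//= ler_pdivrMr ?ltr0n// mul1r ler_nat.
elim: j m k c B r => [|j IH] m k c B r em r1 st.
  rewrite expr0 mulr1 => rt; exists m, (bcost loop_guard).+1, k, c, B, r; split=> //.
  - by apply: exec_while_stop; rewrite (loop_guardE em) rt.
  - by have [em' pB _ _ dB mx] := st; split; [split=> //; exact: le_trans dB rt|rewrite addn0].
move=> rj; have [rt|rt] := boolP (r <= thr).
  exists m, (bcost loop_guard).+1, k, c, B, r; split=> //.
  - by apply: exec_while_stop; rewrite (loop_guardE em) rt.
  - by have [em' pB _ _ dB mx] := st; split; [split=> //; exact: le_trans dB rt|rewrite leq_addr].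
have [k1 [e1 h1]] : exists k, exec (comp body_prog) m k (den body_prog m) /\
    (k <= cst (ireg m 0) (ireg m 1) body_prog)%N by apply: comp_exec; vm_compute.
rewrite (setup_d (ell_setup em)) (setup_t (ell_setup em)) in h1.
have sm : same_input m (den body_prog m) by apply: same_input_den; vm_compute.
have g1 : beval m loop_guard by rewrite (loop_guardE em).
have [c' [B' [[em' st']|[em' st']]]] := body_progP d0 lam0 mu0 eps01 psdA A0 em r1 st.
  (* After shrinking, the recorded bound is 0, so the next guard test ends the loop. *)
  exists (den body_prog m), (bcost loop_guard + k1 + (bcost loop_guard).+1).+1, k.+1, c', B', 0.
  split=> //.
  - apply: exec_while_step g1 e1 _; apply: exec_while_stop.
    by rewrite (loop_guardE em') sqr_ge0.
  - by rewrite /loop_unit !mulSn; move: (bcost _) (cst _ _ _) (j * _)%N h1 => b C Z h1; clear -h1; lia.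
  - by split=> //; rewrite addnS ltnS leq_addr.
have rq1 : r * q <= 1.
  have [] := andP q01 => q0 q1; have [r0|r0] := lerP 0 r; first exact: mulr_ile1.
  by rewrite (le_trans _ ler01)// mulr_le0_ge0// ltW.
have rqj : r * q * q ^+ j <= thr by rewrite -mulrA -exprS.
have [m' [K [k' [c2 [B2 [r' [ex hK sm' em2 [st2 hk]]]]]]]] :=
  IH _ _ _ _ _ em' rq1 st' rqj.
exists m', (bcost loop_guard + k1 + K).+1, k', c2, B2, r'; split=> //.
- exact: exec_while_step g1 e1 ex.
- rewrite mulSn; move: (j.+1 * _)%N hK h1 => Z; rewrite /loop_unit.
  by move: (bcost _) (cst _ _ _) => b C; clear; lia.
- have [s1 s2] := sm; have [s3 s4] := sm'.
  by split=> [v v1|b l b2]; rewrite ?s3 ?s4// ?s1 ?s2.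
- by split=> //; rewrite -addSnnS.
Qed.

Lemma stop_volume k c B : stop_state k c B thr ->
  (volume (ellipsoid c B) <= eps%:E)%E.
Proof.
move=> [_ pB dB _]; apply: le_trans (volume_ellipsoid c pB) _.
have /andP[e0 _] := eps01; rewrite lee_fin.
have h : Num.sqrt (\det B) <= eps / 100.
  rewrite -(ger0_norm (ltW (divr_gt0 e0 _)))// -sqrtr_sqr.
  by rewrite ler_wsqrtr.
apply: le_trans (ler_pM (expR_ge0 _) (sqrtr_ge0 _) (expR_pi_le100) h) _.
by rewrite mulrCA divff ?mulr1.
Qed.

End Loop.

(** * The round protocol *)

Section Round.
Context {R : realType}.

Definition body_cst (K : nat) : nat := ((bcost loop_guard).+1 + K)%N.

(** In [C], 50 bounds the iterations, [2 * Ki] pays for the initialization since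
    [1 <= 2 * (d * d) * L], and [52 * body_cst Kb] for the loop since
    [j + 1 <= 52 * (d * d) * L]. *)
Lemma round_exec (Ki Kb : nat) :
  (forall d t T, (0 < d)%N -> (t <= T)%N -> (0 < T)%N ->
    (cst d t init_prog <= Ki * (T * d ^ 6 + d ^ 8))%N) ->
  (forall d t T, (0 < d)%N -> (t <= T)%N -> (0 < T)%N ->
    (cst d t body_prog <= Kb * (T * d ^ 6 + d ^ 8))%N) ->
  forall (d T t : nat) (lam mu eps : R) (A : nat -> 'M[complex R]_d) m,
    (0 < d)%N -> 0 < lam -> 0 < mu -> 0 < eps <= 2^-1 -> (t < T)%N ->
    (forall tau, (tau < t)%N -> psd (A tau)) ->
    input lam mu eps A t m ->
    let C := (50 + 2 * Ki + 52 * body_cst Kb)%:R : R in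
    exists m' K,
      [/\ exec full_prog m K m', same_input m m',
        K%:R <= C * (T%:R * d%:R ^+ 8 * ln eps^-1 + d%:R ^+ 10 * ln eps^-1)
      & solves_round lam mu eps A t (C * (d%:R ^+ 2 * ln eps^-1))
          (output_center d m') (output_shape d m')].
Proof.
move=> hi hb d T t lam mu eps A m d0 lam0 mu0 e01 tT psdA im C.
have n0 : (0 < d * d)%N by rewrite muln_gt0 d0.
have [j qj hj] := iterations_bound e01 n0.
have L0 := ln_inv_ge e01; set L := ln eps^-1 in L0 hj *.
have T0 : (0 < T)%N by case: T tT.
have {}hi := hi d t T d0 (ltnW tT) T0.
have {}hb := hb d t T d0 (ltnW tT) T0.
set X := (T * d ^ 6 + d ^ 8)%N in hi hb.
have X0 : (0 < X)%N by rewrite addn_gt0 orbC expn_gt0 d0.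
have dL : 1 <= 2 * ((d * d)%:R * L).
  have : 1 <= (d * d)%:R :> R by rewrite ler1n.
  by move: (_%:R) => N N1; nra.
have jC : (j.+1)%:R <= 52 * ((d * d)%:R * L).
  by rewrite -natr1; move: (_ * L) hj dL => Y; lra.
have C50 : 50 <= C by rewrite ler_nat -addnA leq_addr.
have CK (k : nat) : k%:R <= 50 * ((d * d)%:R * L) -> k%:R <= C * (d%:R ^+ 2 * L).
  rewrite expr2 -natrM => hk; apply: le_trans hk _; rewrite ler_wpM2r//.
  by move: (_ * L) dL => Y; lra.
have [k0 [e0 h0]] : exists k, exec (comp init_prog) m k (den init_prog m) /\
    (k <= cst (ireg m 0) (ireg m 1) init_prog)%N by apply: comp_exec; vm_compute.
rewrite (input_d im) (input_t im) in h0.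
have s0 : same_input m (den init_prog m) by apply: same_input_den; vm_compute.
suff [m' [K [k' [c' [B' [r' [[ex hK sm em] [st hk]]]]]]]] : exists m' K k' c' B' r',
    [/\ exec (While loop_guard (comp body_prog)) (den init_prog m) K m',
     (K <= j.+1 * loop_unit (d := d) t)%N, same_input (den init_prog m) m' &
     ell_mem lam mu eps A t m' c' B' r'] /\
    stop_state lam mu A t k' c' B' ((eps / 100) ^+ 2) /\
      k'%:R <= 50 * ((d * d)%:R * L).
  exists m', (k0 + K)%N; split.
  - exact: exec_seq e0 ex.
  - have [s1 s2] := s0; have [s3 s4] := sm.
    by split=> [v v1|b l b2]; rewrite ?s3 ?s4// ?s1 ?s2.
  - have h1 : (k0 + K <= (Ki + j.+1 * body_cst Kb) * X)%N.
      rewrite mulnDl leq_add ?(leq_trans h0)// (leq_trans hK)// -mulnA leq_mul2l/=.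
      rewrite /loop_unit /body_cst mulnDl leq_add//.
      by rewrite leq_pmulr.
    rewrite -(ler_nat R) in h1; apply: le_trans h1 _.
    have -> : T%:R * d%:R ^+ 8 * L + d%:R ^+ 10 * L = (d * d)%:R * L * X%:R.
      by rewrite /X natrD [(T * _)%:R]natrM !natrX natrM; ring.
    rewrite natrM mulrA ler_wpM2r//.
    rewrite /C; move: (body_cst Kb) => N.
    have -> : (Ki + j.+1 * N)%:R = Ki%:R + j.+1%:R * N%:R :> R.
      by rewrite -natrM -natrD.
    have -> : (50 + 2 * Ki + 52 * N)%:R = 50 + 2 * Ki%:R + 52 * N%:R :> R.
      by rewrite -!natrM -!natrD.
    have I0 : 0 <= Ki%:R :> R by [].
    have N0 : 0 <= N%:R :> R by [].
    move: jC dL; move: (_ * L) (j.+1%:R) (Ki%:R) (N%:R) I0 N0 => Y J I N' I0 N0 jC dL.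
    have h2 : J * N' <= 52 * Y * N' by rewrite ler_wpM2r.
    have h3 : I * 1 <= I * (2 * Y) by rewrite ler_wpM2l.
    lra.
  - have [sm' pB dB mx] := st.
    have -> : output_center d m' = c'.
      by apply/rowP => k; rewrite mxE (ell_center em).
    have -> : output_shape d m' = B'.
      by apply/matrixP => k l; rewrite mxE (ell_shape em).
    split=> //; first by exists k' => //; exact: CK.
    exact: stop_volume st.
have [c [B [[em st]|[em [st A0]]]]] := init_progP d0 lam0 mu0 e01 psdA im.
  exists (den init_prog m), (bcost loop_guard).+1, 1%N, c, B, 0; split.
    by split=> //; apply: exec_while_stop; rewrite (loop_guardE em) negbK sqr_ge0.
  by split=> //; move: (_ * L) dL => Y; lra.
have [|m' [K [k' [c' [B' [r' [ex hK sm em' [st' hk]]]]]]]] :=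
  @loop_exec _ _ _ _ _ _ _ d0 lam0 mu0 e01 psdA A0 j _ _ _ _ _ em (lexx _) st.
  by rewrite mul1r.
exists m', K, k', c', B', r'; split=> //; split=> //.
by apply: le_trans hj; rewrite ler_nat.
Qed.

Lemma input_initial d (lam mu eps : R) (A : nat -> 'M[complex R]_d) :
  input lam mu eps A 0 (initial_memory d lam mu eps).
Proof. by split. Qed.

Lemma write_row_low N (f : nat -> R) b (v : 'rV[R]_N) l :
  (l < b)%N -> write_row f b v l = f l.
Proof. by move=> lb; rewrite /write_row leqNgt lb. Qed.

Lemma write_row_high N (f : nat -> R) b (v : 'rV[R]_N) (k : 'I_N) :
  write_row f b v (b + k)%N = v 0 k.
Proof.
rewrite /write_row leq_addr (_ : b + k - b = k)%N; last by rewrite addnC addnK.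
by rewrite valK.
Qed.

Lemma input_announce d (lam mu eps : R) (A : nat -> 'M[complex R]_d) t m :
  input lam mu eps A t m -> input lam mu eps A t.+1 (announce m t (A t)).
Proof.
move=> [h0 h1 hl hm he hr hi].
have low tau (i j : 'I_d) : (tau < t)%N -> (tau * (d * d) + (i * d + j) < t * (d * d))%N.
  by move=> tt; rewrite -val_mxvec_index; have := ltn_ord (mxvec_index i j); nia.
split=> // tau i j; rewrite ltnS leq_eqVlt => /orP[/eqP ->|tt] /=.
- by rewrite -val_mxvec_index write_row_high mxvecE mxE.
- by rewrite write_row_low ?low// hr.
- by rewrite -val_mxvec_index write_row_high mxvecE mxE.
- by rewrite write_row_low ?low// hi.
Qed.

Lemma input_same d (lam mu eps : R) (A : nat -> 'M[complex R]_d) t m m' :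
  same_input m m' -> input lam mu eps A t m -> input lam mu eps A t m'.
Proof.
move=> [s1 s2] [h0 h1 hl hm he hr hi].
by split; rewrite ?s1 ?s2// => tau i j tt; rewrite s2// ?hr ?hi.
Qed.

End Round.

Theorem theoremF3 (R : realType) :
  exists (prog : com) (C : R),
  forall (d T : nat) (lambda mu eps : R) (A : nat -> 'M[complex R]_d),
    (0 < d)%N -> 0 < lambda -> 0 < mu -> 0 < eps <= 2^-1 ->
    (forall t, (t < T)%N -> psd (A t)) ->
    (* [m t] and [m' t] are the memories before and after the computation that
       follows the announcement of A 0, ..., A (t - 1); its cost is [k t] *)
    exists (m m' : nat -> memory R) (k : nat -> nat),
      m 0%N = initial_memory d lambda mu eps /\
      forall t, (t < T)%N ->
        [/\ exec prog (m t) (k t) (m' t),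
            m t.+1 = announce (m' t) t (A t),
            (k t)%:R <= C * (T%:R * d%:R ^+ 8 * ln eps^-1
                             + d%:R ^+ 10 * ln eps^-1)
          & solves_round lambda mu eps A t (C * (d%:R ^+ 2 * ln eps^-1))
              (output_center d (m' t)) (output_shape d (m' t))].
Proof.
have [Ki hi] : exists K, forall d t T, (0 < d)%N -> (t <= T)%N -> (0 < T)%N ->
    (cst d t init_prog <= K * (T * d ^ 6 + d ^ 8))%N.
  by apply: cst_cheap; vm_compute.
have [Kb hb] : exists K, forall d t T, (0 < d)%N -> (t <= T)%N -> (0 < T)%N ->
    (cst d t body_prog <= K * (T * d ^ 6 + d ^ 8))%N.
  by apply: cst_cheap; vm_compute.
exists full_prog, (50 + 2 * Ki + 52 * body_cst Kb)%:R.
move=> d T lam mu eps A d0 lam0 mu0 e01 psdA.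
set C : R := _%:R.
(* The premises are part of [Q], so every pair of a round and a memory has an admissible image; a
   choice function then defines the memories by recursion on the round. *)
pose Q (x : nat * memory R) (y : memory R * nat) :=
  (x.1 < T)%N -> input lam mu eps A x.1 x.2 ->
  [/\ exec full_prog x.2 y.2 y.1, same_input x.2 y.1,
      y.2%:R <= C * (T%:R * d%:R ^+ 8 * ln eps^-1 + d%:R ^+ 10 * ln eps^-1)
    & solves_round lam mu eps A x.1 (C * (d%:R ^+ 2 * ln eps^-1))
        (output_center d y.1) (output_shape d y.1)].
have /choice[F FQ] x : exists y, Q x y.
  have [[xT im]|nx] := pselect ((x.1 < T)%N /\ input lam mu eps A x.1 x.2).
    have psdx tau : (tau < x.1)%N -> psd (A tau).
      by move=> tx; apply: psdA; exact: ltn_trans tx xT.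
    by have [m' [K h]] := round_exec hi hb d0 lam0 mu0 e01 xT psdx im; exists (m', K).
  (* A default value: the premises of [Q] fail here. *)
  by exists (x.2, 0%N) => xT im; case: nx.
pose fix M t := if t is t'.+1 then announce (F (t', M t')).1 t' (A t')
  else initial_memory d lam mu eps.
have IM t : (t <= T)%N -> input lam mu eps A t (M t).
  elim: t => [_|t IH tT]; first exact: input_initial.
  apply: input_announce; have im := IH (ltnW tT).
  by have [_ sm _ _] := FQ (t, M t) tT im; exact: input_same im.
exists M, (fun t => (F (t, M t)).1), (fun t => (F (t, M t)).2); split=> // t tT.
by have [ex _ hk hs] := FQ (t, M t) tT (IM t (ltnW tT)).
Qed.
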